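(* Let $n$ be a positive integer and consider the local analytic differential system $\dot x = Ax+f(x)$, $x\in\mathbb R^n$, where $A$ is a real $n\times n$ matrix and $f$ is an $\mathbb R^n$-valued analytic function defined in a neighborhood of the origin whose Taylor expansion at the origin has no constant and no linear terms. Let $\lambda_1,\ldots,\lambda_n\in\mathbb C$ be the eigenvalues of $A$ (counted with multiplicity). Assume that $\lambda_1=0$, and that $\lambda_2,\ldots,\lambda_n$ either all have positive real parts or all have negative real parts. Then the system has an analytic first integral in a neighborhood of the origin if and only if the singular point $x=0$ is not isolated.
   Context: A singular point of $\dot x=Ax+f(x)$ is a point $p$ with $Ap+f(p)=0$; the singular point $x=0$ is isolated if some neighborhood of $0$ contains no other singular point, and not isolated otherwise. An analytic first integral in a neighborhood of the origin is a non-constant real analytic function $H$ defined in some neighborhood of $0\in\mathbb R^n$ such that $\langle\nabla H(x),\,Ax+f(x)\rangle\equiv 0$ there, where $\nabla H$ is the gradient of $H$ and $\langle\cdot,\cdot\rangle$ is the inner product. *)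

(* Defs.v *)
From HB Require Import structures.
From mathcomp Require Import all_boot all_order all_algebra.
From mathcomp Require Import complex.
From mathcomp Require Import boolp classical_sets functions reals ereal.
From mathcomp Require Import topology normedtype numfun esum derive.

Set Implicit Arguments.
Unset Strict Implicit.
Unset Printing Implicit Defensive.

Import Order.TTheory GRing.Theory Num.Theory.
Import numFieldNormedType.Exports.

Local Open Scope classical_set_scope.
Local Open Scope ring_scope.

(* Absolute convergence of a family of real numbers, with sum s; [summable]
   makes both [esum]s finite, so the extended difference is never oo - oo. *)
Definition sums_to (R : realType) (I : choiceType) (u : I -> R) (s : R) : Prop :=
  let v := EFin \o u in
  summable [set: I] v /\
  (\esum_(i in [set: I]) v^\+ i - \esum_(i in [set: I]) v^\- i = s%:E)%E.

Definition multi_index (n : nat) := {ffun 'I_n -> nat}.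

Definition mdegree (n : nat) (a : multi_index n) : nat := (\sum_i a i)%N.

Definition monomial (R : realType) (n : nat) (x : 'cV[R]_n) (a : multi_index n) : R :=
  \prod_i x i 0 ^+ a i.

(* c is the family of Taylor coefficients of g at p, and the Taylor series
   represents g near p; c is uniquely determined by g and p. *)
Definition has_taylor_series (R : realType) (n : nat) (g : 'cV[R]_n -> R)
    (p : 'cV[R]_n) (c : multi_index n -> R) : Prop :=
  \forall x \near p, sums_to (fun a => c a * monomial (x - p) a) (g x).

(* Functions are total; only their values on the set U matter when U is open. *)
Definition analytic_on (R : realType) (n : nat) (U : set 'cV[R]_n)
    (g : 'cV[R]_n -> R) : Prop :=
  forall p, U p -> exists c, has_taylor_series g p c.

Definition gradient (R : realType) (n : nat) (H : 'cV[R]_n -> R)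
    (x : 'cV[R]_n) : 'cV[R]_n :=
  \col_i 'D_(delta_mx i 0) H x.

Definition inner (R : realType) (n : nat) (u v : 'cV[R]_n) : R :=
  \sum_i u i 0 * v i 0.

Definition vector_field (R : realType) (n : nat) (A : 'M[R]_n)
    (f : 'cV[R]_n -> 'cV[R]_n) (x : 'cV[R]_n) : 'cV[R]_n :=
  A *m x + f x.

Definition singular_points (R : realType) (n : nat) (V : set 'cV[R]_n)
    (X : 'cV[R]_n -> 'cV[R]_n) : set 'cV[R]_n :=
  [set p | V p /\ X p = 0].

(* The eigenvalues of A in C, listed with algebraic multiplicity. *)
Definition eigenvalue_list (R : realType) (n : nat) (A : 'M[R]_n)
    (lam : 'I_n -> R[i]) : Prop :=
  char_poly (map_mx (real_complex R) A) = \prod_i ('X - (lam i)%:P).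

(* The domain U of a first integral is required to be connected: otherwise a
   function vanishing near 0 and equal to 1 on a far away component of U would
   count as non-constant. *)
Definition has_analytic_first_integral (R : realType) (n : nat)
    (V : set 'cV[R]_n) (X : 'cV[R]_n -> 'cV[R]_n) : Prop :=
  exists (U : set 'cV[R]_n) (H : 'cV[R]_n -> R),
    [/\ [/\ open U, connected U, U 0 & U `<=` V],
        analytic_on U H,
        exists x y, [/\ U x, U y & H x <> H y] &
        forall x, U x -> inner (gradient H x) (X x) = 0].

(* Main.v *)
Require Import Defs.
From HB Require Import structures.
From mathcomp Require Import all_boot all_order all_algebra.
From mathcomp Require Import complex.
From mathcomp Require Import finmap zify ring lra.
From mathcomp Require Import mathcomp_extra boolp classical_sets functions cardinality fsbigop.
From mathcomp Require Import reals ereal topology normedtype numfun esum derive.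

(* Replacing the field by its opposite, we may take the nonzero eigenvalues in the
   right half-plane, and after a linear change of variables the linear part is 0 + B
   with <By, y> >= b|y|^2. The analytic inverse function theorem provides coordinates
   u = (x, y) in which the singular points lie on the axis y = 0, and the singular
   points on the axis are the zeros of one analytic function F_0(x, 0).

   If 0 is not isolated, F_0(x, 0) has zeros accumulating at 0, so the whole field F
   vanishes on the axis. Then F h = 0 has a unique formal solution h = x + O(y),
   because h |-> Dh(By) is invertible on polynomials of positive degree in y. In the
   weighted (Fischer) inner product of [wt] the coercivity of B gives
   <Dh(By), h> >= b deg_y(h) |h|^2, and the gain deg_y(h) compensates the derivatives
   in F h, since every term of F contains a factor y. Hence h converges.

   Conversely let H be a nonconstant first integral and h its Taylor series in the
   coordinates u. The lowest homogeneous part of h - h(0) is killed by h |-> Dh(By), so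
   it is c x^m. On the axis F(x, 0) = F_0(x, 0) v(x) with v(0) = (1, 0, ..., 0). If 0
   is isolated, F_0(x, 0) <> 0 for small x <> 0, whence Dh(v) = 0 on the axis; but the
   coefficient of x^(m - 1) in Dh(v) is m c. *)

Set Implicit Arguments.
Unset Strict Implicit.
Unset Printing Implicit Defensive.

Import Order.TTheory GRing.Theory Num.Theory.
Import numFieldNormedType.Exports.

Local Open Scope classical_set_scope.
Local Open Scope ring_scope.

(** * Absolutely convergent sums *)

(** Analytic germs are handled through their coefficient families at 0, measured by the majorant
    norm [nrm r], the sum of |u_a| r^|a|. Two series are constructed degree by degree, the inverse
    of the coordinate change and the integral h, and each needs a bound uniform in the degree. For
    the inverse, [nrm] itself is enough. For h it is not adapted: the homological operator is
    controlled only through the quadratic form of B, and each term x^a d_l h of F h costs a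
    derivative. The weighted square sums of the homogeneous parts of h ([energy]) are estimated
    instead, by induction on the degree. Inverting the operator gains deg_y of the product, whereas
    the derivative costs that same degree twice in the squared estimate; what remains is a factor
    |a| + 1 when it is compared with deg_y of the term of h involved. That factor depends only on
    the term x^a of F, not on h, and the coefficients of F absorb it: the nonlinear part of F has
    order 2, so its norm is small compared with the radius rho. *)

Definition absum (R : realType) (I : choiceType) (u : I -> R) : Prop :=
  summable [set: I] (EFin \o u).

(** Total form of the value in [sums_to], recovered by [sums_toE]. An infinite difference is sent to
    0 by [fine], so the value is meaningful only together with [absum]. *)
Definition tsum (R : realType) (I : choiceType) (u : I -> R) : R :=
  fine (\esum_(i in [set: I]) (EFin \o u)^\+ i -
        \esum_(i in [set: I]) (EFin \o u)^\- i)%E.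

Section AbsoluteSums.
Variable R : realType.
Implicit Types I J : choiceType.

Lemma absumE I (u : I -> R) :
  absum u <-> (\esum_(i in [set: I]) `|u i|%:E < +oo)%E.
Proof.
rewrite /absum /summable.
by under [in X in (X < _)%E]eq_esum do rewrite /= .
Qed.

Lemma absum_norm I (u : I -> R) : absum u -> absum (fun i => `|u i|).
Proof. by rewrite !absumE; under [in X in _ -> (X < _)%E]eq_esum do rewrite normr_id. Qed.

Lemma absum_le I (u v : I -> R) :
  (forall i, `|u i| <= v i) -> absum v -> absum u.
Proof.
rewrite !absumE => uv; apply: le_lt_trans; apply: le_esum => i _.
by rewrite lee_fin (le_trans (uv i))// ler_norm.
Qed.

Lemma esum_fin_num I (u : I -> R) : (forall i, 0 <= u i) -> absum u ->
  (\esum_(i in [set: I]) (u i)%:E)%E \is a fin_num.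
Proof.
move=> u0 /absumE; rewrite (eq_esum (b := fun i => (u i)%:E)); last first.
  by move=> i _; rewrite ger0_norm.
move=> h; rewrite ge0_fin_numE//; apply: esum_ge0 => i _; by rewrite lee_fin.
Qed.

Lemma tsum_sub I (p q : I -> R) :
  (forall i, 0 <= p i) -> (forall i, 0 <= q i) -> absum p -> absum q ->
  tsum (fun i => p i - q i) =
  fine (\esum_(i in [set: I]) (p i)%:E) - fine (\esum_(i in [set: I]) (q i)%:E).
Proof.
move=> p0 q0 sp sq; rewrite /tsum.
have := esumB sp sq.
have -> : ((EFin \o p) \- (EFin \o q))%E = EFin \o (fun i => p i - q i) by [].
move=> ->; last 2 first.
- by move=> i _ /=; rewrite lee_fin.
- by move=> i _ /=; rewrite lee_fin.
by rewrite fineB//; exact: esum_fin_num.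
Qed.

Lemma absum0 I : absum (fun _ : I => 0 : R).
Proof. by rewrite absumE esum1// => i _; rewrite normr0. Qed.

Lemma tsum_ge0E I (p : I -> R) : (forall i, 0 <= p i) -> absum p ->
  tsum p = fine (\esum_(i in [set: I]) (p i)%:E).
Proof.
move=> p0 sp; rewrite -[LHS]/(tsum (fun i => p i)).
under [in LHS]eq_fun do rewrite -[p _]subr0.
rewrite tsum_sub//; last exact: absum0.
by rewrite [X in _ - fine X]esum1// subr0.
Qed.

Lemma sums_toE I (u : I -> R) s : sums_to u s <-> absum u /\ tsum u = s.
Proof.
rewrite /sums_to; split=> [[su h]|[su <-]]; split=> //; first by rewrite /tsum h.
rewrite /tsum fineK// fin_numB; apply/andP; split.
  have := summable_funepos su; rewrite summableE.
  rewrite (eq_esum (b := ((EFin \o u)^\+)%E))// => i _.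
  by rewrite gee0_abs// funepos_ge0.
have := summable_funeneg su; rewrite summableE.
rewrite (eq_esum (b := ((EFin \o u)^\-)%E))// => i _.
by rewrite gee0_abs// funeneg_ge0.
Qed.

Definition rpos I (u : I -> R) i := Num.max (u i) 0.
Definition rneg I (u : I -> R) i := Num.max (- u i) 0.

Lemma rposBneg I (u : I -> R) i : u i = rpos u i - rneg u i.
Proof. by rewrite /rpos /rneg; case: (leP (u i) 0); case: (leP (- u i) 0) => *; lra. Qed.

Lemma rpos_ge0 I (u : I -> R) i : 0 <= rpos u i.
Proof. by rewrite /rpos le_max lexx orbT. Qed.

Lemma rneg_ge0 I (u : I -> R) i : 0 <= rneg u i.
Proof. by rewrite /rneg le_max lexx orbT. Qed.

Lemma rpos_le I (u : I -> R) i : rpos u i <= `|u i|.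
Proof. by rewrite /rpos ge_max ler_norm normr_ge0. Qed.

Lemma rneg_le I (u : I -> R) i : rneg u i <= `|u i|.
Proof. by rewrite /rneg ge_max -normrN ler_norm normr_ge0. Qed.

Lemma absum_rpos I (u : I -> R) : absum u -> absum (rpos u).
Proof.
move=> /absum_norm; apply: absum_le => i.
by rewrite ger0_norm ?rpos_ge0// rpos_le.
Qed.

Lemma absum_rneg I (u : I -> R) : absum u -> absum (rneg u).
Proof.
move=> /absum_norm; apply: absum_le => i.
by rewrite ger0_norm ?rneg_ge0// rneg_le.
Qed.

Lemma tsum_posneg I (u : I -> R) : absum u -> tsum u = tsum (rpos u) - tsum (rneg u).
Proof.
move=> su; rewrite -[LHS]/(tsum (fun i => u i)).
under [in LHS]eq_fun do rewrite rposBneg.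
rewrite tsum_sub; last 4 first.
- exact: rpos_ge0.
- exact: rneg_ge0.
- exact: absum_rpos.
- exact: absum_rneg.
by rewrite !tsum_ge0E//; [exact: rneg_ge0|exact: absum_rneg|exact: rpos_ge0|exact: absum_rpos].
Qed.

Lemma absumD I (u v : I -> R) : absum u -> absum v -> absum (fun i => u i + v i).
Proof. exact: summableD. Qed.

Lemma absumN I (u : I -> R) : absum u -> absum (fun i => - u i).
Proof. by rewrite !absumE; under [in X in _ -> (X < _)%E]eq_esum do rewrite normrN. Qed.

Lemma ge0_tsumD I (u v : I -> R) : (forall i, 0 <= u i) -> (forall i, 0 <= v i) ->
  absum u -> absum v -> tsum (fun i => u i + v i) = tsum u + tsum v.
Proof.
move=> u0 v0 su sv; rewrite !tsum_ge0E//; last 2 first.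
- by move=> i; rewrite addr_ge0.
- exact: absumD.
rewrite -fineD ?esum_fin_num// -esumD// => i _; by rewrite lee_fin.
Qed.

Lemma tsum_subr I (p q : I -> R) :
  (forall i, 0 <= p i) -> (forall i, 0 <= q i) -> absum p -> absum q ->
  tsum (fun i => p i - q i) = tsum p - tsum q.
Proof. by move=> *; rewrite tsum_sub// !tsum_ge0E. Qed.

Lemma tsumD I (u v : I -> R) : absum u -> absum v ->
  tsum (fun i => u i + v i) = tsum u + tsum v.
Proof.
move=> su sv.
have -> : (fun i => u i + v i) =
    (fun i => (rpos u i + rpos v i) - (rneg u i + rneg v i)).
  by apply/funext => i; rewrite {1}(rposBneg u) {1}(rposBneg v); ring.
have [[[pu nu] pv] nv] := (absum_rpos su, absum_rneg su, absum_rpos sv, absum_rneg sv).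
rewrite tsum_subr; last 4 first.
- by move=> i; rewrite addr_ge0 ?rpos_ge0.
- by move=> i; rewrite addr_ge0 ?rneg_ge0.
- exact: absumD.
- exact: absumD.
rewrite !ge0_tsumD//; try exact: rneg_ge0; try exact: rpos_ge0.
by rewrite (tsum_posneg su) (tsum_posneg sv); ring.
Qed.

Lemma tsumN I (u : I -> R) : absum u -> tsum (fun i => - u i) = - tsum u.
Proof.
move=> su.
have -> : (fun i => - u i) = (fun i => rneg u i - rpos u i).
  by apply/funext => i; rewrite {1}(rposBneg u); ring.
rewrite tsum_subr; last 4 first.
- exact: rneg_ge0.
- exact: rpos_ge0.
- exact: absum_rneg.
- exact: absum_rpos.
by rewrite (tsum_posneg su); ring.
Qed.

Lemma tsum0 I : tsum (fun _ : I => 0 : R) = 0.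
Proof. by rewrite tsum_ge0E ?esum1//; exact: absum0. Qed.

Lemma tsum_ge0 I (u : I -> R) : (forall i, 0 <= u i) -> 0 <= tsum u.
Proof.
move=> u0; rewrite /tsum [X in (_ - X)%E]esum1; last first.
  move=> i _; rewrite (ge0_funenegE (D := setT)) ?in_setT// => j _ /=.
  by rewrite lee_fin.
rewrite sube0 fine_ge0// esum_ge0// => i _; exact: funepos_ge0.
Qed.

Lemma ler_tsum I (u v : I -> R) : absum u -> absum v ->
  (forall i, u i <= v i) -> tsum u <= tsum v.
Proof.
move=> su sv uv; rewrite -subr_ge0 -tsumN// -tsumD//; last exact: absumN.
by apply: tsum_ge0 => i; rewrite subr_ge0.
Qed.

Lemma ler_norm_tsum I (u : I -> R) : absum u -> `|tsum u| <= tsum (fun i => `|u i|).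
Proof.
move=> su; rewrite ler_norml -tsumN; last exact: absum_norm.
have sn := absum_norm su.
apply/andP; split.
  by apply: (ler_tsum (absumN sn) su) => i; rewrite lerNl -normrN ler_norm.
by apply: (ler_tsum su sn) => i; exact: ler_norm.
Qed.

(** The working criterion for convergence: the sum of absolute values is a supremum over finite
    sets, so a uniform bound on finite sums suffices. Such a bound survives limits taken one
    coefficient at a time. *)
Lemma absum_bound I (u : I -> R) M :
  (forall X : {fset I}, \sum_(i <- X) `|u i| <= M) ->
  absum u /\ tsum (fun i => `|u i|) <= M.
Proof.
move=> uM.
have H : (\esum_(i in [set: I]) `|u i|%:E <= M%:E)%E.
  apply: ge_ereal_sup => _ [X [finX _] <-].
  by rewrite fsbig_finite//= sumEFin lee_fin.
have su : absum u by rewrite absumE (le_lt_trans H)// ltry.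
split => //; rewrite tsum_ge0E//; last exact: absum_norm.
by rewrite -lee_fin fineK//; apply: esum_fin_num => //; exact: absum_norm.
Qed.

Lemma sum_le_tsum I (u : I -> R) (X : {fset I}) : absum u ->
  \sum_(i <- X) `|u i| <= tsum (fun i => `|u i|).
Proof.
move=> /absum_norm su; rewrite tsum_ge0E// -lee_fin fineK ?esum_fin_num//.
apply: esum_ge; exists [set` X] => //.
by rewrite fsbig_finite//= set_fsetK sumEFin.
Qed.

Lemma absumZ I (k : R) (u : I -> R) : absum u -> absum (fun i => k * u i).
Proof.
move=> su; apply: (proj1 (absum_bound (M := `|k| * tsum (fun i => `|u i|)) _)) => X.
under eq_bigr do rewrite normrM.
by rewrite -mulr_sumr ler_wpM2l// sum_le_tsum.
Qed.

Lemma tsumZ I (k : R) (u : I -> R) : absum u ->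
  tsum (fun i => k * u i) = k * tsum u.
Proof.
move=> su.
suff H (l : R) (p : I -> R) : 0 <= l -> (forall i, 0 <= p i) -> absum p ->
    tsum (fun i => l * p i) <= l * tsum p.
  (* The reverse inequality is [H] for the scalar [l^-1] and the family [l * p]. *)
  have K (l : R) (p : I -> R) : 0 <= l -> (forall i, 0 <= p i) -> absum p ->
      tsum (fun i => l * p i) = l * tsum p.
    move=> l0 p0 sp; have [->|l1] := eqVneq l 0.
      by rewrite mul0r -[RHS](tsum0 I); congr tsum; apply/funext => i; rewrite mul0r.
    apply/eqP; rewrite eq_le H//= -ler_pdivlMl ?lt0r ?l1//.
    have := H l^-1 (fun i => l * p i); rewrite invr_ge0 => /(_ l0) h.
    have {1}-> : p = (fun i => l^-1 * (l * p i)).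
      by apply/funext => i; rewrite mulKf.
    by apply: h; [move=> i; rewrite mulr_ge0|exact: absumZ].
  have L (l : R) : 0 <= l -> tsum (fun i => l * u i) = l * tsum u.
    move=> l0; rewrite (tsum_posneg su) mulrBr -!K//; last 4 first.
    - exact: rneg_ge0.
    - exact: absum_rneg.
    - exact: rpos_ge0.
    - exact: absum_rpos.
    rewrite -tsum_subr; last 4 first.
    - by move=> i; rewrite mulr_ge0// rpos_ge0.
    - by move=> i; rewrite mulr_ge0// rneg_ge0.
    - by apply: absumZ; exact: absum_rpos.
    - by apply: absumZ; exact: absum_rneg.
    by congr tsum; apply/funext => i; rewrite -mulrBr -rposBneg.
  have [k0|k0] := leP 0 k; first exact: L.
  rewrite -[k in RHS]opprK mulNr -L; last by rewrite oppr_ge0 ltW.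
  rewrite -tsumN; last exact: absumZ.
  by congr tsum; apply/funext => i; rewrite mulNr opprK.
move=> l0 p0 sp.
have := proj2 (absum_bound (u := fun i => l * p i) (M := l * tsum p) _).
have -> : (fun i => `|l * p i|) = (fun i => l * p i).
  by apply/funext => i; rewrite ger0_norm// mulr_ge0.
apply=> X; under eq_bigr do rewrite normrM (ger0_norm l0).
rewrite -mulr_sumr ler_wpM2l//; have := sum_le_tsum X sp.
by under [in X in _ <= X -> _]eq_fun do rewrite ger0_norm//.
Qed.

Lemma absum_sum I (K : Type) (r : seq K) (u : K -> I -> R) :
  (forall k, absum (u k)) -> absum (fun i => \sum_(k <- r) u k i).
Proof.
move=> su; elim: r => [|k r IH].
  by under eq_fun do rewrite big_nil; exact: absum0.
by under eq_fun do rewrite big_cons; exact: absumD.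
Qed.

Lemma tsum_sum I (K : Type) (r : seq K) (u : K -> I -> R) :
  (forall k, absum (u k)) ->
  tsum (fun i => \sum_(k <- r) u k i) = \sum_(k <- r) tsum (u k).
Proof.
move=> su; elim: r => [|k r IH].
  by under [in LHS]eq_fun do rewrite big_nil; rewrite tsum0 big_nil.
under [in LHS]eq_fun do rewrite big_cons.
by rewrite tsumD//; [rewrite IH big_cons|exact: absum_sum].
Qed.

(** The injection has to reach only the support of the family. This is how sums over shifted
    multi-indices and over the graph of addition are rewritten. *)
Lemma esum_inj I J (f : J -> I) (u : I -> R) : injective f ->
  (forall i, 0 <= u i) -> (forall i, u i != 0 -> exists j, f j = i) ->
  (\esum_(i in [set: I]) (u i)%:E = \esum_(j in [set: J]) (u (f j))%:E)%E.
Proof.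
move=> finj u0 uf.
rewrite -(@esum_image R J I [set: J] f (fun i => (u i)%:E)); last first.
  by move=> x y _ _; exact: finj.
rewrite [RHS]esum_mkcond; apply: eq_esum => i _.
case: ifPn => // /negP; rewrite inE /= => h.
have [->//|/uf[j fj]] := eqVneq (u i) 0.
by case: h; exists j.
Qed.

Lemma absum_inj I J (f : J -> I) (u : I -> R) : injective f ->
  (forall i, u i != 0 -> exists j, f j = i) ->
  absum u <-> absum (fun j => u (f j)).
Proof.
move=> finj uf; rewrite !absumE (esum_inj finj)// => i; rewrite normr_eq0.
exact: uf.
Qed.

Lemma tsum_inj I J (f : J -> I) (u : I -> R) : injective f ->
  (forall i, u i != 0 -> exists j, f j = i) -> absum u ->
  tsum u = tsum (fun j => u (f j)).
Proof.
move=> finj uf su.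
have su' : absum (fun j => u (f j)) by rewrite -absum_inj.
rewrite (tsum_posneg su) (tsum_posneg su') !tsum_ge0E; last 8 first.
- exact: rneg_ge0.
- exact: absum_rneg.
- exact: rpos_ge0.
- exact: absum_rpos.
- exact: rneg_ge0.
- exact: absum_rneg.
- exact: rpos_ge0.
- exact: absum_rpos.
rewrite (esum_inj finj (u := rpos u)); last 2 first.
- exact: rpos_ge0.
- move=> i h; apply: uf; apply: contraNneq h => ui; by rewrite /rpos ui maxxx.
rewrite (esum_inj finj (u := rneg u)) //; first exact: rneg_ge0.
move=> i h; apply: uf; apply: contraNneq h => ui; by rewrite /rneg ui oppr0 maxxx.
Qed.

Lemma absum_comp_inj I J (f : J -> I) (u : I -> R) : injective f ->
  absum u -> absum (fun j => u (f j)).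
Proof.
move=> finj su.
pose v i := if `[< exists j, f j = i >] then u i else 0.
have -> : (fun j => u (f j)) = (fun j => v (f j)).
  by apply/funext => j; rewrite /v asboolT//; exists j.
apply/(absum_inj (u := v) finj).
  by move=> i; rewrite /v; case: asboolP => //; rewrite eqxx.
apply: absum_le (absum_norm su) => i.
by rewrite /v; case: asboolP => // _; rewrite normr0.
Qed.

Lemma absum_fin I (u : I -> R) (X : seq I) :
  (forall i, u i != 0 -> i \in X) -> absum u.
Proof.
move=> uX; apply: (proj1 (absum_bound (M := \sum_(i <- undup X) `|u i|) _)) => Y.
rewrite (bigID (fun i => i \in undup X))/= [X in _ + X]big1 ?addr0; last first.
  by move=> i; apply: contraNeq => /[!normr_eq0]/uX; rewrite mem_undup.
rewrite -big_filter [leRHS](bigID (fun i => i \in Y))/= -[X in _ <= X + _]big_filter.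
rewrite (perm_big [seq i <- undup X | i \in Y]); first by rewrite lerDl sumr_ge0.
apply: uniq_perm; rewrite ?filter_uniq ?undup_uniq// => i.
by rewrite !mem_filter andbC.
Qed.

Lemma tsum_fin I (u : I -> R) (X : seq I) : uniq X ->
  (forall i, u i != 0 -> i \in X) -> tsum u = \sum_(i <- X) u i.
Proof.
elim: X u => [|x X IH] u.
  move=> _ uX; rewrite big_nil -[RHS](tsum0 I); congr tsum; apply/funext => i.
  by apply/eqP/negP => /negP/uX.
move=> /= /andP[xX uniX] uX.
pose v i := if i == x then 0 else u i.
pose w i := if i == x then u i else 0.
have uE : u = (fun i => w i + v i).
  by apply/funext => i; rewrite /w /v; case: ifP; rewrite ?addr0 ?add0r.
have wX i : w i != 0 -> i \in [:: x].
  by rewrite /w inE; case: ifP => //; rewrite eqxx.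
have vX i : v i != 0 -> i \in X.
  rewrite /v; case: (eqVneq i x) => [_|ix h]; first by rewrite eqxx.
  by have := uX _ h; rewrite inE (negPf ix).
rewrite {1}uE tsumD; [|exact: absum_fin wX|exact: absum_fin vX].
rewrite (IH v)// big_cons; congr (_ + _); last first.
  by apply: eq_big_seq => i iX; rewrite /v; case: eqVneq => // ix; rewrite ix (negPf xX) in iX.
have sw : absum (rpos w) by apply: absum_rpos; exact: absum_fin wX.
have sw' : absum (rneg w) by apply: absum_rneg; exact: absum_fin wX.
rewrite tsum_posneg; last exact: absum_fin wX.
have E (p : I -> R) : (forall i, 0 <= p i) -> absum p ->
   (forall i, i != x -> p i = 0) -> tsum p = p x.
  move=> p0 sp px; rewrite tsum_ge0E// (esumID [set x])//; last first.
    by move=> i _; rewrite lee_fin.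
  rewrite setTI esum_set1 ?lee_fin// esum1 ?adde0// => i [_ /=] /eqP ix.
  by rewrite px.
rewrite !E//; try exact: rneg_ge0; try exact: rpos_ge0.
- by rewrite -rposBneg /w eqxx.
- by move=> i ix; rewrite /rneg /w (negPf ix) oppr0 maxxx.
- by move=> i ix; rewrite /rpos /w (negPf ix) maxxx.
Qed.

Lemma tsum1 I (u : I -> R) x : (forall i, i != x -> u i = 0) -> tsum u = u x.
Proof.
move=> ux; rewrite (tsum_fin (X := [:: x]))//; first by rewrite big_seq1.
by move=> i; apply: contraNT => /[!inE]/ux ->.
Qed.

(** * Double families: the theorems of Tonelli and Fubini *)

Lemma esum_pair I J (u : I * J -> R) : (forall k, 0 <= u k) ->
  (\esum_(i in [set: I]) \esum_(j in [set: J]) (u (i, j))%:E =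
   \esum_(k in [set: I * J]) (u k)%:E)%E.
Proof.
move=> u0; rewrite (esum_esum (a := fun i j => (u (i, j))%:E)).
  rewrite (_ : [set: I] `*`` _ = [set: I * J]); last by apply/seteqP; split.
  by apply: eq_esum => -[].
by move=> *; rewrite lee_fin.
Qed.

Lemma absum_row I J (u : I * J -> R) i : absum u -> absum (fun j => u (i, j)).
Proof. by apply: absum_comp_inj => x y []. Qed.

Lemma absum_pairP I J (u : I * J -> R) : (forall i, absum (fun j => u (i, j))) ->
  absum u <-> absum (fun i => tsum (fun j => `|u (i, j)|)).
Proof.
move=> su; rewrite !absumE -(esum_pair (u := fun k => `|u k|))//.
rewrite (eq_esum (b := fun i => `|tsum (fun j => `|u (i, j)|)|%:E))// => i _.
rewrite ger0_norm; last exact: tsum_ge0.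
have sui := absum_norm (su i).
by rewrite tsum_ge0E// fineK//; exact: esum_fin_num.
Qed.

Lemma ge0_tsum_pair I J (u : I * J -> R) : (forall k, 0 <= u k) -> absum u ->
  tsum (fun i => tsum (fun j => u (i, j))) = tsum u.
Proof.
move=> u0 su; have sr i := absum_row i su.
have su' : absum (fun i => tsum (fun j => u (i, j))).
  have := proj1 (absum_pairP sr) su; congr absum; apply/funext => i.
  by congr tsum; apply/funext => j; rewrite ger0_norm.
rewrite tsum_ge0E//; last by move=> i; exact: tsum_ge0.
rewrite tsum_ge0E// -esum_pair//; congr fine; apply: eq_esum => i _.
by rewrite tsum_ge0E// fineK// esum_fin_num.
Qed.

Lemma absum_tsum_row I J (u : I * J -> R) : absum u ->
  absum (fun i => tsum (fun j => u (i, j))).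
Proof.
move=> su; have sr i := absum_row i su.
have := proj1 (absum_pairP sr) su; apply: absum_le => i.
exact: ler_norm_tsum.
Qed.

Lemma tsum_pair I J (u : I * J -> R) : absum u ->
  tsum (fun i => tsum (fun j => u (i, j))) = tsum u.
Proof.
move=> su; have [sp sn] := (absum_rpos su, absum_rneg su).
rewrite (tsum_posneg su) -!ge0_tsum_pair//; try exact: rpos_ge0; try exact: rneg_ge0.
rewrite -tsum_subr; last 4 first.
- by move=> i; apply: tsum_ge0 => j; exact: rpos_ge0.
- by move=> i; apply: tsum_ge0 => j; exact: rneg_ge0.
- exact: absum_tsum_row.
- exact: absum_tsum_row.
congr tsum; apply/funext => i; rewrite -tsum_subr; last 4 first.
- by move=> j; exact: rpos_ge0.
- by move=> j; exact: rneg_ge0.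
- exact: absum_row sp.
- exact: absum_row sn.
by congr tsum; apply/funext => j; rewrite -rposBneg.
Qed.

Lemma absum_swap I J (u : I * J -> R) : absum u -> absum (fun k : J * I => u (k.2, k.1)).
Proof. by move=> su; apply: (absum_comp_inj (f := fun k : J * I => (k.2, k.1))) su => -[? ?] [? ?] [-> ->]. Qed.

Lemma tsum_exchange I J (u : I * J -> R) : absum u ->
  tsum (fun i => tsum (fun j => u (i, j))) =
  tsum (fun j => tsum (fun i => u (i, j))).
Proof.
move=> su; rewrite tsum_pair// (tsum_pair (absum_swap su)).
rewrite (tsum_inj (f := fun k : J * I => (k.2, k.1)) (u := u))//.
  by move=> [? ?] [? ?] [-> ->].
by move=> [i j] _; exists (j, i).
Qed.

Lemma absum_prod I J (u : I -> R) (v : J -> R) : absum u -> absum v ->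
  absum (fun k : I * J => u k.1 * v k.2).
Proof.
move=> su sv; apply/absum_pairP => /= [i|]; first exact: absumZ.
apply: (absum_le (v := fun i => tsum (fun j => `|v j|) * `|u i|)); last first.
  by apply: absumZ; exact: absum_norm.
move=> i; under eq_fun do rewrite normrM.
rewrite tsumZ; last exact: absum_norm.
rewrite normrM normr_id mulrC ger0_norm//; exact: tsum_ge0.
Qed.

Lemma tsum_prod I J (u : I -> R) (v : J -> R) : absum u -> absum v ->
  tsum (fun k : I * J => u k.1 * v k.2) = tsum u * tsum v.
Proof.
move=> su sv; rewrite -tsum_pair/=; last exact: absum_prod.
under eq_fun do rewrite tsumZ//.
under eq_fun do rewrite mulrC.
by rewrite tsumZ// mulrC.
Qed.

End AbsoluteSums.

(** * Families of Taylor coefficients *)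

Section MultiIndices.
Variable n : nat.
Implicit Types a b c : multi_index n.

Definition dl (k : 'I_n) : multi_index n := [ffun i => nat_of_bool (i == k)].

Lemma mdegreeD a b : mdegree (a + b) = (mdegree a + mdegree b)%N.
Proof. by rewrite /mdegree -big_split/=; apply: eq_bigr => i _; rewrite ffunE. Qed.

Lemma mdegree0 : mdegree (0 : multi_index n) = 0%N.
Proof. by rewrite /mdegree big1// => i _; rewrite ffunE. Qed.

Lemma mdegree_dl k : mdegree (dl k) = 1%N.
Proof.
rewrite /mdegree (bigD1 k)//= ffunE eqxx big1 ?addn0// => i /negPf ik.
by rewrite ffunE ik.
Qed.

Lemma mdegree_eq0 a : (mdegree a == 0%N) = (a == 0).
Proof.
apply/idP/eqP => [/eqP a0|->]; last by rewrite mdegree0.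
by apply/ffunP => i; rewrite ffunE; apply/eqP; rewrite -leqn0 -a0 /mdegree (bigD1 i)//= leq_addr.
Qed.

Lemma leq_mdegree a i : (a i <= mdegree a)%N.
Proof. by rewrite /mdegree (bigD1 i)//= leq_addr. Qed.

(** Truncated subtraction of [dl k]; it undoes the addition of [dl k] only where the exponent of
    index k is positive. *)
Definition mi_pred a k : multi_index n := [ffun i => (a i - (i == k))%N].

Lemma mi_predK a k : (0 < a k)%N -> mi_pred a k + dl k = a.
Proof.
move=> ak; apply/ffunP => i; rewrite !ffunE; apply: subnK.
by case: eqVneq => // ->.
Qed.

Lemma mi_addK a k : mi_pred (a + dl k) k = a.
Proof. by apply/ffunP => i; rewrite !ffunE; exact: addnK. Qed.

Lemma mi_addI b : injective (fun a => a + b).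
Proof.
move=> a a' /ffunP h; apply/ffunP => i; have := h i; rewrite !ffunE.
exact: addIn.
Qed.

Lemma mi_neq0P a : a != 0 -> exists k, (0 < a k)%N.
Proof.
move=> a0; apply: contrapT => h; move/eqP: a0; apply; apply/ffunP => i.
by rewrite ffunE; apply/eqP; rewrite -leqn0 leqNgt; apply/negP => ai; apply: h; exists i.
Qed.

(** The box of exponents at most m: larger than the set of degree at most m, but easy to enumerate.
    Exact sets are filtered from it. *)
Definition mlow m : seq (multi_index n) :=
  [seq [ffun i => nat_of_ord (f i)] | f : {ffun 'I_n -> 'I_m.+1}].

Lemma mlow_uniq m : uniq (mlow m).
Proof.
rewrite map_inj_uniq ?enum_uniq// => f g /ffunP h; apply/ffunP => i.
by apply: val_inj; have := h i; rewrite !ffunE.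
Qed.

Lemma mem_mlow m a : (mdegree a <= m)%N -> a \in mlow m.
Proof.
move=> am; apply/mapP; exists [ffun i => inord (a i)]; first by rewrite mem_enum.
apply/ffunP => i; rewrite !ffunE inordK// ltnS (leq_trans _ am)//.
exact: leq_mdegree.
Qed.

Lemma addmi_eq_dl a b k : (a + b == dl k) =
  ((a == 0) && (b == dl k)) || ((a == dl k) && (b == 0)).
Proof.
apply/eqP/orP => [e|[|] /andP[/eqP-> /eqP->]]; rewrite ?add0r ?addr0//.
have : (mdegree a + mdegree b = 1)%N by rewrite -mdegreeD e mdegree_dl.
case: (posnP (mdegree a)) => [/eqP|a0 ab].
  by rewrite mdegree_eq0 => /eqP a0 _; left; rewrite -e a0 add0r !eqxx.
have /eqP : mdegree b = 0%N by lia.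
by rewrite mdegree_eq0 => /eqP b0; right; rewrite -e b0 addr0 !eqxx.
Qed.

Lemma addmi_eq0 a b : (a + b == 0) = (a == 0) && (b == 0).
Proof. by rewrite -!mdegree_eq0 mdegreeD addn_eq0. Qed.

End MultiIndices.

Section Families.
Variables (R : realType).

Lemma absum_deg n (u : multi_index n -> R) m :
  (forall a, u a != 0 -> (mdegree a <= m)%N) -> absum u.
Proof. by move=> um; apply: (absum_fin (X := mlow n m)) => a /um; exact: mem_mlow. Qed.

Lemma monomialD n (x : 'cV[R]_n) a b : monomial x (a + b) = monomial x a * monomial x b.
Proof. by rewrite /monomial -big_split; apply: eq_bigr => i _; rewrite ffunE exprD. Qed.

Lemma monomial0 n (x : 'cV[R]_n) : monomial x 0 = 1.
Proof. by rewrite /monomial big1// => i _; rewrite ffunE expr0. Qed.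

Lemma monomial_dl n (x : 'cV[R]_n) k : monomial x (dl k) = x k 0.
Proof.
rewrite /monomial (bigD1 k)//= ffunE eqxx expr1 big1 ?mulr1// => i /negPf ik.
by rewrite ffunE ik expr0.
Qed.

Definition inbox n (r : R) (x : 'cV[R]_n) : Prop := forall i, `|x i 0| <= r.

Lemma norm_monomial_le n (x : 'cV[R]_n) r a : inbox r x ->
  `|monomial x a| <= r ^+ mdegree a.
Proof.
move=> xr; rewrite /monomial /mdegree normr_prod.
rewrite (_ : r ^+ _ = \prod_i r ^+ a i); last by rewrite prodrXr.
by apply: ler_prod => i _; rewrite normr_ge0/= normrX lerXn2r ?nnegrE// (le_trans _ (xr i)).
Qed.

(** Absolute convergence at the corner (r, ..., r), which for r >= 0 implies it on the whole closed
    cube [inbox r]. *)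
Definition conv n (r : R) (u : multi_index n -> R) : Prop :=
  absum (fun a => u a * r ^+ mdegree a).

(** The majorant norm: it bounds the values on the cube ([ev_le]) and is submultiplicative
    ([nrm_mul]), so it controls the substitution of series. *)
Definition nrm n (r : R) (u : multi_index n -> R) : R :=
  tsum (fun a => `|u a| * r ^+ mdegree a).

Definition ev n (u : multi_index n -> R) (x : 'cV[R]_n) : R :=
  tsum (fun a => u a * monomial x a).

Lemma conv_abs n r (u : multi_index n -> R) : 0 <= r -> conv r u ->
  absum (fun a => `|u a| * r ^+ mdegree a).
Proof.
move=> r0 /absum_norm; congr absum; apply/funext => a.
by rewrite normrM (ger0_norm (exprn_ge0 _ r0)).
Qed.

Lemma nrm_ge0 n r (u : multi_index n -> R) : 0 <= r -> 0 <= nrm r u.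
Proof. by move=> r0; apply: tsum_ge0 => a; rewrite mulr_ge0// exprn_ge0. Qed.

Lemma conv_ev n r (u : multi_index n -> R) x : 0 <= r -> conv r u -> inbox r x ->
  absum (fun a => u a * monomial x a).
Proof.
move=> r0 /(conv_abs r0) cu xr; apply: absum_le cu => a.
by rewrite normrM ler_wpM2l// norm_monomial_le.
Qed.

Lemma conv_le n r s (u : multi_index n -> R) : 0 <= r -> r <= s -> conv s u -> conv r u.
Proof.
move=> r0 rs /(conv_abs (le_trans r0 rs)); apply: absum_le => a.
by rewrite normrM ler_wpM2l// ger0_norm ?exprn_ge0// lerXn2r// nnegrE (le_trans r0).
Qed.

Lemma nrm_le n r s (u : multi_index n -> R) : 0 <= r -> r <= s -> conv s u -> nrm r u <= nrm s u.
Proof.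
move=> r0 rs cu; apply: ler_tsum.
- exact: conv_abs (conv_le r0 rs cu).
- exact: conv_abs (le_trans r0 rs) cu.
- by move=> a; rewrite ler_wpM2l// lerXn2r// nnegrE (le_trans r0).
Qed.

Lemma ev_le n r (u : multi_index n -> R) x : 0 <= r -> conv r u -> inbox r x ->
  `|ev u x| <= nrm r u.
Proof.
move=> r0 cu xr; apply: le_trans (ler_norm_tsum (conv_ev r0 cu xr)) _.
apply: ler_tsum; [exact/absum_norm/(conv_ev r0 cu)|exact: conv_abs|].
by move=> a; rewrite normrM ler_wpM2l// norm_monomial_le.
Qed.

Lemma evD n r (u v : multi_index n -> R) x : 0 <= r -> conv r u -> conv r v ->
  inbox r x -> ev (fun a => u a + v a) x = ev u x + ev v x.
Proof.
move=> r0 cu cv xr; rewrite /ev -tsumD; [|exact: conv_ev cu xr|exact: conv_ev cv xr].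
by congr tsum; apply/funext => a; rewrite mulrDl.
Qed.

Lemma convD n r (u v : multi_index n -> R) : conv r u -> conv r v ->
  conv r (fun a => u a + v a).
Proof.
move=> cu cv; have := absumD cu cv; congr absum; apply/funext => a.
by rewrite mulrDl.
Qed.

Lemma convZ n r k (u : multi_index n -> R) : conv r u -> conv r (fun a => k * u a).
Proof.
move=> /(absumZ k); congr absum; apply/funext => a.
by rewrite mulrA.
Qed.

Lemma evZ n r k (u : multi_index n -> R) x : 0 <= r -> conv r u ->
  inbox r x -> ev (fun a => k * u a) x = k * ev u x.
Proof.
move=> r0 cu xr; rewrite /ev -tsumZ; last exact: conv_ev cu xr.
by congr tsum; apply/funext => a; rewrite mulrA.
Qed.

Lemma conv_sum n r (K : Type) (s : seq K) (u : K -> multi_index n -> R) :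
  (forall k, conv r (u k)) -> conv r (fun a => \sum_(k <- s) u k a).
Proof.
move=> cu; have := absum_sum s cu; congr absum; apply/funext => a.
by rewrite mulr_suml.
Qed.

Lemma ev_sum n r (K : Type) (s : seq K) (u : K -> multi_index n -> R) x :
  0 <= r -> (forall k, conv r (u k)) -> inbox r x ->
  ev (fun a => \sum_(k <- s) u k a) x = \sum_(k <- s) ev (u k) x.
Proof.
move=> r0 cu xr; rewrite /ev -tsum_sum; last by move=> k; exact: conv_ev (cu k) xr.
by congr tsum; apply/funext => a; rewrite mulr_suml.
Qed.

Lemma nrmD n r (u v : multi_index n -> R) : 0 <= r -> conv r u -> conv r v ->
  nrm r (fun a => u a + v a) <= nrm r u + nrm r v.
Proof.
move=> r0 cu cv; rewrite /nrm -tsumD; [|exact: conv_abs cu|exact: conv_abs cv].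
apply: ler_tsum.
- by apply: conv_abs => //; exact: convD.
- by apply: absumD; exact: conv_abs.
- by move=> a; rewrite -mulrDl ler_wpM2r ?exprn_ge0// ler_normD.
Qed.

Lemma nrmZ n r k (u : multi_index n -> R) : 0 <= r -> conv r u ->
  nrm r (fun a => k * u a) = `|k| * nrm r u.
Proof.
move=> r0 cu; rewrite /nrm -tsumZ; last exact: conv_abs.
by congr tsum; apply/funext => a; rewrite normrM mulrA.
Qed.

Lemma nrm_sum n r (K : Type) (s : seq K) (u : K -> multi_index n -> R) :
  0 <= r -> (forall k, conv r (u k)) ->
  nrm r (fun a => \sum_(k <- s) u k a) <= \sum_(k <- s) nrm r (u k).
Proof.
move=> r0 cu; elim: s => [|k s IH].
  rewrite big_nil /nrm -[X in _ <= X](tsum0 R (multi_index n)).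
  by under eq_fun do rewrite big_nil normr0 mul0r.
under [X in nrm r X]eq_fun do rewrite big_cons.
by rewrite big_cons (le_trans (nrmD r0 (cu k) (conv_sum s cu)))// lerD2l.
Qed.

(** * Constants, coordinates and the Cauchy product *)

Definition fone n : multi_index n -> R := fun a => (a == 0)%:R.

Lemma fone_neq n (a : multi_index n) : fone a != 0 -> a = 0.
Proof. by rewrite /fone; case: (eqVneq a 0) => // _; rewrite eqxx. Qed.

Lemma conv_one n r : conv r (@fone n).
Proof.
apply: (absum_deg (m := 0)) => a; rewrite mulf_eq0 negb_or => /andP[/fone_neq -> _].
by rewrite mdegree0.
Qed.

Lemma ev_one n (x : 'cV[R]_n) : ev (@fone n) x = 1.
Proof.
rewrite /ev (tsum1 (x := 0)); first by rewrite monomial0 /fone eqxx mul1r.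
by move=> a /negPf a0; rewrite /fone a0 mul0r.
Qed.

Lemma nrm_one n r : nrm r (@fone n) = 1.
Proof.
rewrite /nrm (tsum1 (x := 0)).
  by rewrite mdegree0 /fone eqxx expr0 mulr1 normr1.
by move=> a /negPf a0; rewrite /fone a0 normr0 mul0r.
Qed.

Definition fvar n (k : 'I_n) : multi_index n -> R := fun a => (a == dl k)%:R.

Lemma conv_var n r (k : 'I_n) : conv r (fvar k).
Proof.
apply: (absum_deg (m := 1)) => a; rewrite mulf_eq0 negb_or => /andP[+ _].
by rewrite /fvar; case: (eqVneq a (dl k)) => [-> _|_]; rewrite ?mdegree_dl ?eqxx.
Qed.

Lemma ev_var n (k : 'I_n) (x : 'cV[R]_n) : ev (fvar k) x = x k 0.
Proof.
rewrite /ev (tsum1 (x := dl k)); first by rewrite monomial_dl /fvar eqxx mul1r.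
by move=> a /negPf a0; rewrite /fvar a0 mul0r.
Qed.

Lemma nrm_var n r (k : 'I_n) : nrm r (fvar k) = r.
Proof.
rewrite /nrm (tsum1 (x := dl k)).
  by rewrite mdegree_dl /fvar eqxx expr1 normr1 mul1r.
by move=> a /negPf a0; rewrite /fvar a0 normr0 mul0r.
Qed.

(** A sum over all pairs, so that the results on double families apply directly; only finitely many
    pairs contribute ([mulE]). *)
Definition mul n (u v : multi_index n -> R) : multi_index n -> R :=
  fun c => tsum (fun p : multi_index n * multi_index n =>
    if p.1 + p.2 == c then u p.1 * v p.2 else 0).

Definition mpairs n (c : multi_index n) : seq (multi_index n * multi_index n) :=
  [seq p <- [seq (a, b) | a <- mlow n (mdegree c), b <- mlow n (mdegree c)] |
    p.1 + p.2 == c].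

Lemma mem_mpairs n (c : multi_index n) p : (p \in mpairs c) = (p.1 + p.2 == c).
Proof.
rewrite mem_filter andb_idr// => /eqP <-; apply/allpairsP.
exists p; rewrite !mem_mlow ?mdegreeD ?leq_addr ?leq_addl//.
by case: p.
Qed.

Lemma mpairs_uniq n (c : multi_index n) : uniq (mpairs c).
Proof.
apply: filter_uniq; apply: allpairs_uniq; rewrite ?mlow_uniq//.
by move=> [? ?] [? ?].
Qed.

Lemma mulE n (u v : multi_index n -> R) c :
  mul u v c = \sum_(p <- mpairs c) u p.1 * v p.2.
Proof.
rewrite /mul (tsum_fin (mpairs_uniq c)).
  by apply: eq_big_seq => p; rewrite mem_mpairs => ->.
by move=> p; rewrite mem_mpairs; case: ifP => //; rewrite eqxx.
Qed.

(** Any multiplicative [m] turns the Cauchy product into a product of sums. Powers of r give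
    convergence and the norm estimate; [monomial x] gives the values. *)
Lemma mul_char n (m : multi_index n -> R) (u v : multi_index n -> R) :
  (forall a b, m (a + b) = m a * m b) ->
  absum (fun a => u a * m a) -> absum (fun a => v a * m a) ->
  [/\ absum (fun c => mul u v c * m c),
      tsum (fun c => mul u v c * m c) =
        tsum (fun a => u a * m a) * tsum (fun a => v a * m a) &
      tsum (fun c => `|mul u v c * m c|) <=
        tsum (fun a => `|u a * m a|) * tsum (fun a => `|v a * m a|)].
Proof.
move=> mD su sv.
(* [T] lives on triples (c, (a, b)) and is supported on the graph c = a + b. Its sum over (a, b) for
   fixed c is a Cauchy coefficient; reindexing the graph by (a, b) gives the product of the two
   sums. *)
pose T (k : multi_index n * (multi_index n * multi_index n)) :=
  (if k.2.1 + k.2.2 == k.1 then u k.2.1 * v k.2.2 else 0) * m k.1.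
pose f (p : multi_index n * multi_index n) := (p.1 + p.2, p).
have finj : injective f by move=> p q [].
have Tf k : T k != 0 -> exists p, f p = k.
  case: k => c p; rewrite /T /=; case: (eqVneq (p.1 + p.2) c) => [<- _|]; first by exists p.
  by rewrite mul0r eqxx.
have TfE p : T (f p) = (u p.1 * m p.1) * (v p.2 * m p.2).
  by rewrite /T /f /= eqxx mD; ring.
have sT : absum T.
  apply/(absum_inj finj Tf).
  under eq_fun do rewrite TfE.
  exact: absum_prod su sv.
have rowE c : tsum (fun p => T (c, p)) = mul u v c * m c.
  rewrite mulrC /mul -tsumZ; last first.
    apply: (absum_fin (X := mpairs c)) => p; rewrite mem_mpairs.
    by case: ifP => //; rewrite eqxx.
  by congr tsum; apply/funext => p; rewrite /T mulrC.
split.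
- have := absum_tsum_row sT; congr absum; apply/funext => c; exact: rowE.
- rewrite -(tsum_prod su sv) -(eq_fun TfE) -(tsum_inj finj Tf sT) -tsum_pair//.
  by congr tsum; apply/funext => c; rewrite rowE.
- rewrite -(tsum_prod (absum_norm su) (absum_norm sv)).
  have -> : (fun k : multi_index n * multi_index n =>
     `|u k.1 * m k.1| * `|v k.2 * m k.2|) = (fun p => `|T (f p)|).
    by apply/funext => p; rewrite TfE [RHS]normrM.
  rewrite -(tsum_inj (u := fun k => `|T k|) finj); last 2 first.
  - by move=> k; rewrite normr_eq0; exact: Tf.
  - exact: absum_norm.
  rewrite -tsum_pair; last exact: absum_norm.
  apply: ler_tsum.
  - have := absum_norm (absum_tsum_row sT); congr absum; apply/funext => c.
    by rewrite rowE.
  - exact: (absum_tsum_row (absum_norm sT)).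
  - move=> c; rewrite -rowE; apply: ler_norm_tsum; exact: absum_row sT.
Qed.

Lemma conv_mul n r (u v : multi_index n -> R) : conv r u -> conv r v -> conv r (mul u v).
Proof.
move=> cu cv; have [] := mul_char (m := fun a => r ^+ mdegree a) _ cu cv => //.
by move=> a b; rewrite mdegreeD exprD.
Qed.

Lemma nrm_mul n r (u v : multi_index n -> R) : 0 <= r -> conv r u -> conv r v ->
  nrm r (mul u v) <= nrm r u * nrm r v.
Proof.
move=> r0 cu cv.
have [] := mul_char (m := fun a => r ^+ mdegree a) _ cu cv.
  by move=> a b; rewrite mdegreeD exprD.
move=> _ _; rewrite /nrm.
have E (w : multi_index n -> R) : (fun a => `|w a * r ^+ mdegree a|) =
   (fun a => `|w a| * r ^+ mdegree a).
  by apply/funext => a; rewrite normrM (ger0_norm (exprn_ge0 _ r0)).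
by rewrite !E.
Qed.

Lemma ev_mul n r (u v : multi_index n -> R) x : 0 <= r -> conv r u -> conv r v ->
  inbox r x -> ev (mul u v) x = ev u x * ev v x.
Proof.
move=> r0 cu cv xr.
have [] := mul_char (m := monomial x) _ (conv_ev r0 cu xr) (conv_ev r0 cv xr) => //.
exact: monomialD.
Qed.

Lemma mul_0 n (u v : multi_index n -> R) : mul u v 0 = u 0 * v 0.
Proof.
rewrite /mul (tsum1 (x := (0, 0))) /= ?addr0 ?eqxx// => -[a b] /= ab.
by case: ifP => //; rewrite addmi_eq0 => /andP[/eqP a0 /eqP b0]; rewrite a0 b0 eqxx in ab.
Qed.

Lemma mul_dl n (u v : multi_index n -> R) k :
  mul u v (dl k) = u 0 * v (dl k) + u (dl k) * v 0.
Proof.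
have d0 : (dl k == 0 :> multi_index n) = false.
  by rewrite -mdegree_eq0 mdegree_dl.
rewrite /mul (tsum_fin (X := [:: (0, dl k); (dl k, 0)])).
- by rewrite big_cons big_seq1/= add0r addr0 eqxx.
- by rewrite /= inE xpair_eqE eq_sym d0.
- move=> [a b] /=; rewrite addmi_eq_dl !inE !xpair_eqE.
  by case: ifP => //; rewrite eqxx.
Qed.

End Families.

(** * Composition of power series *)

Section Composition.
Variable R : realType.

Definition pw n (u : multi_index n -> R) (k : nat) : multi_index n -> R :=
  iter k (mul u) (@fone R n).

Definition powf n m (d : 'I_n -> multi_index m -> R) (a : multi_index n) :
    multi_index m -> R :=
  \big[@mul R m/@fone R m]_(i < n) pw (d i) (a i).

(** Each coefficient is an infinite sum because the inner series may have constant terms, as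
    [translation] does. *)
Definition comp n m (c : multi_index n -> R) (d : 'I_n -> multi_index m -> R) :
    multi_index m -> R :=
  fun b => tsum (fun a => c a * powf d a b).

Definition evs n m (d : 'I_n -> multi_index m -> R) (x : 'cV[R]_m) : 'cV[R]_n :=
  \col_i ev (d i) x.

Lemma conv_pw n r (u : multi_index n -> R) k : conv r u -> conv r (pw u k).
Proof.
by move=> cu; elim: k => [|k IH] /=; [exact: conv_one|exact: conv_mul].
Qed.

Lemma ev_pw n r (u : multi_index n -> R) k x : 0 <= r -> conv r u -> inbox r x ->
  ev (pw u k) x = ev u x ^+ k.
Proof.
move=> r0 cu xr; elim: k => [|k IH] /=; first by rewrite ev_one expr0.
by rewrite (ev_mul r0 cu (conv_pw k cu) xr) IH exprS.
Qed.

Lemma nrm_pw n r (u : multi_index n -> R) k : 0 <= r -> conv r u ->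
  nrm r (pw u k) <= nrm r u ^+ k.
Proof.
move=> r0 cu; elim: k => [|k IH] /=; first by rewrite nrm_one expr0.
apply: le_trans (nrm_mul r0 cu (conv_pw k cu)) _.
by rewrite exprS ler_wpM2l// nrm_ge0.
Qed.

Lemma conv_powf n m r (d : 'I_n -> multi_index m -> R) a :
  (forall i, conv r (d i)) -> conv r (powf d a).
Proof.
move=> cd; apply: (big_ind (fun u => conv r u)); first exact: conv_one.
- by move=> *; exact: conv_mul.
- by move=> i _; exact: conv_pw.
Qed.

Lemma ev_powf n m r (d : 'I_n -> multi_index m -> R) a x : 0 <= r ->
  (forall i, conv r (d i)) -> inbox r x ->
  ev (powf d a) x = monomial (evs d x) a.
Proof.
move=> r0 cd xr.
suff [] : conv r (powf d a) /\ ev (powf d a) x = monomial (evs d x) a by [].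
apply: (big_ind2 (fun u y => conv r u /\ ev u x = y)).
- by split; [exact: conv_one|rewrite ev_one].
- move=> u y v z [cu <-] [cv <-]; split; first exact: conv_mul.
  exact: ev_mul xr.
- move=> i _; split; first exact: conv_pw.
  by rewrite (ev_pw _ r0 (cd i) xr) mxE.
Qed.

Lemma nrm_powf n m r s (d : 'I_n -> multi_index m -> R) a : 0 <= r ->
  (forall i, conv r (d i)) -> (forall i, nrm r (d i) <= s) ->
  nrm r (powf d a) <= s ^+ mdegree a.
Proof.
move=> r0 cd ds; rewrite /mdegree -prodrXr.
suff [] : conv r (powf d a) /\ nrm r (powf d a) <= \prod_i s ^+ a i by [].
apply: (big_ind2 (fun u y => conv r u /\ nrm r u <= y)).
- by split; [exact: conv_one|rewrite nrm_one].
- move=> u y v z [cu uy] [cv vz]; split; first exact: conv_mul.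
  by apply: le_trans (nrm_mul r0 cu cv) _; rewrite ler_pM// nrm_ge0.
- move=> i _; split; first exact: conv_pw.
  apply: le_trans (nrm_pw _ r0 (cd i)) _.
  by rewrite lerXn2r// nnegrE ?nrm_ge0// (le_trans _ (ds i))// nrm_ge0.
Qed.

Section Main.
Variables (n m : nat) (r s : R) (c : multi_index n -> R) (d : 'I_n -> multi_index m -> R).
Hypothesis r0 : 0 < r.
Hypothesis s0 : 0 <= s.
Hypothesis cc : conv s c.
Hypothesis cd : forall i, conv r (d i).
Hypothesis ds : forall i, nrm r (d i) <= s.

(** By [nrm_powf], the row of index a has absolute sum at most |c_a| s^|a|, and c converges at s.
    Convergence, norm and values of the composition then follow by exchanging the two sums. *)
Lemma absum_comp2 :
  absum (fun k : multi_index n * multi_index m => c k.1 * powf d k.1 k.2 * r ^+ mdegree k.2).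
Proof.
apply/absum_pairP => /= [a|].
  by under eq_fun do rewrite -mulrA; apply: absumZ; exact: conv_powf.
apply: absum_le (conv_abs s0 cc) => a.
under eq_fun do rewrite -mulrA normrM.
rewrite tsumZ; last exact/absum_norm/conv_powf.
rewrite normrM normr_id ler_wpM2l//.
apply: le_trans (nrm_powf a (ltW r0) cd ds).
rewrite ger0_norm; last exact: tsum_ge0.
rewrite /nrm le_eqVlt; apply/orP; left; apply/eqP; congr tsum; apply/funext => b.
by rewrite normrM (ger0_norm (exprn_ge0 _ (ltW r0))).
Qed.

Lemma absum_comp b : absum (fun a => c a * powf d a b).
Proof.
have /absum_swap/(absum_row b)/(absumZ (r ^- mdegree b)) := absum_comp2.
congr absum; apply/funext => a /=.
by rewrite mulrC mulfK// expf_neq0// gt_eqF.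
Qed.

Lemma conv_comp : conv r (comp c d).
Proof.
have /absum_swap/absum_tsum_row := absum_comp2.
congr absum; apply/funext => b /=.
under eq_fun do rewrite mulrC.
by rewrite tsumZ; [rewrite mulrC|exact: absum_comp].
Qed.

Lemma nrm_comp : nrm r (comp c d) <= nrm s c.
Proof.
have sS := absum_swap absum_comp2.
apply: (@le_trans _ _ (tsum (fun b => tsum (fun a => `|c a * powf d a b * r ^+ mdegree b|)))).
  apply: ler_tsum.
  - exact: conv_abs (ltW r0) conv_comp.
  - exact: (absum_tsum_row (absum_norm sS)).
  - move=> b; have /= h := absum_row b sS.
    apply: le_trans (ler_norm_tsum h).
    under eq_fun do rewrite mulrC.
    rewrite tsumZ; last exact: absum_comp.
    by rewrite normrM mulrC (ger0_norm (exprn_ge0 _ (ltW r0))).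
have /= <- := tsum_exchange (absum_norm absum_comp2).
apply: ler_tsum.
- exact: (absum_tsum_row (absum_norm absum_comp2)).
- exact: conv_abs s0 cc.
- move=> a; under eq_fun do rewrite -mulrA normrM.
  rewrite tsumZ; last exact/absum_norm/conv_powf.
  rewrite ler_wpM2l//.
  apply: le_trans (nrm_powf a (ltW r0) cd ds).
  rewrite /nrm le_eqVlt; apply/orP; left; apply/eqP; congr tsum; apply/funext => b.
  by rewrite normrM (ger0_norm (exprn_ge0 _ (ltW r0))).
Qed.

Lemma ev_comp x : inbox r x -> ev (comp c d) x = ev c (evs d x).
Proof.
move=> xr.
have S : absum (fun k : multi_index n * multi_index m => c k.1 * powf d k.1 k.2 * monomial x k.2).
  apply: absum_le (absum_norm absum_comp2) => -[a b] /=.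
  rewrite !normrM ler_wpM2l ?mulr_ge0//.
  by rewrite (ger0_norm (exprn_ge0 _ (ltW r0))) norm_monomial_le.
rewrite /ev.
transitivity (tsum (fun b => tsum (fun a => c a * powf d a b * monomial x b))).
  congr tsum; apply/funext => b; rewrite mulrC /comp -tsumZ; last exact: absum_comp.
  by congr tsum; apply/funext => a; rewrite mulrC.
have /= <- := tsum_exchange S.
congr tsum; apply/funext => a; under eq_fun do rewrite -mulrA.
rewrite tsumZ; last exact: conv_ev (ltW r0) (conv_powf a cd) xr.
by rewrite -/(ev _ _) (ev_powf a (ltW r0) cd xr).
Qed.

Lemma inbox_evs x : inbox r x -> inbox s (evs d x).
Proof.
move=> xr i; rewrite mxE; apply: le_trans (ds i).
exact: ev_le (ltW r0) (cd i) xr.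
Qed.

End Main.

(** * Formal derivatives, linear coefficients and recentring *)

Definition pd n (k : 'I_n) (u : multi_index n -> R) : multi_index n -> R :=
  fun a => (a k).+1%:R * u (a + dl k).

Lemma pw_0 n (u : multi_index n -> R) k : pw u k 0 = u 0 ^+ k.
Proof.
elim: k => [|k IH] /=; first by rewrite /fone eqxx.
by rewrite mul_0 IH exprS.
Qed.

Lemma dl_neq0 n (k : 'I_n) : (dl k == 0 :> multi_index n) = false.
Proof. by rewrite -mdegree_eq0 mdegree_dl. Qed.

Lemma pw_dl n (u : multi_index n -> R) k j :
  pw u k (dl j) = k%:R * u 0 ^+ k.-1 * u (dl j).
Proof.
elim: k => [|k IH] /=; first by rewrite /fone dl_neq0 !mul0r.
rewrite mul_dl IH pw_0; case: k {IH} => [|k] /=; first by ring.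
by rewrite exprS -[in RHS]natr1; ring.
Qed.


(** Leibniz rule at the origin: extracting the coefficient of x_j differentiates one factor and
    evaluates the others at their constant terms. *)
Lemma powf_dl n m (d : 'I_n -> multi_index m -> R) a j :
  powf d a (dl j) =
  \sum_i (a i)%:R * monomial (\col_i d i 0) (mi_pred a i) * d i (dl j).
Proof.
set q := \col_i d i 0.
have H (s : seq 'I_n) : uniq s ->
   (\big[@mul R m/@fone R m]_(i <- s) pw (d i) (a i)) 0 = \prod_(i <- s) q i 0 ^+ a i /\
   (\big[@mul R m/@fone R m]_(i <- s) pw (d i) (a i)) (dl j) =
   \sum_(i <- s) (a i)%:R * (\prod_(l <- s) q l 0 ^+ mi_pred a i l) * d i (dl j).
  elim: s => [|k s IH] /=; first by rewrite !big_nil /fone eqxx dl_neq0.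
  move=> /andP[ks /IH[IH1 IH2]].
  rewrite !big_cons mul_0 mul_dl IH1 IH2 pw_0 pw_dl; split; first by rewrite mxE.
  rewrite addrC; congr (_ + _).
    rewrite ffunE eqxx subn1 -!mulrA; congr (_ * _).
    rewrite mxE; congr (_ * _); rewrite mulrC; congr (_ * _).
    apply: eq_big_seq => l ls; rewrite ffunE.
    by case: eqVneq ls ks => [->->|] // _ _ _; rewrite subn0.
  rewrite mulr_sumr; apply: eq_big_seq => i i_s.
  rewrite big_cons ffunE (_ : (k == i) = false) ?subn0 ?mxE; first by ring.
  by apply/negP => /eqP ki; rewrite ki i_s in ks.
by have [_] := H _ (index_enum_uniq _).
Qed.

Lemma tsum_pd n (u : multi_index n -> R) (k : 'I_n) (q : 'cV[R]_n) :
  absum (fun a => pd k u a * monomial q a) ->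
  absum (fun a => u a * ((a k)%:R * monomial q (mi_pred a k))) /\
  tsum (fun a => u a * ((a k)%:R * monomial q (mi_pred a k))) = ev (pd k u) q.
Proof.
move=> su.
pose v a := u a * ((a k)%:R * monomial q (mi_pred a k)).
have finj : injective (fun a : multi_index n => a + dl k) by exact: mi_addI.
have vf a : v a != 0 -> exists b : multi_index n, b + dl k = a.
  move=> va; exists (mi_pred a k); rewrite mi_predK// lt0n.
  by apply: contraNneq va => a0; rewrite /v a0 mul0r mulr0.
have vE a : v (a + dl k) = pd k u a * monomial q a.
  rewrite /v /pd mi_addK !ffunE eqxx (_ : (a k + true%N)%R = (a k).+1); last exact: addn1.
  by ring.
have sv : absum v by apply/(absum_inj finj vf); under eq_fun do rewrite vE.
split=> //; rewrite (tsum_inj finj vf sv) /ev.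
by congr tsum; apply/funext => a; rewrite vE.
Qed.

(** The chain rule at the origin, read off from linear coefficients: the derivatives of the outer
    series are evaluated at the constant terms of the inner ones. *)
Lemma comp_dl n m (c : multi_index n -> R) (d : 'I_n -> multi_index m -> R) j :
  (forall i, absum (fun a => pd i c a * monomial (\col_i d i 0) a)) ->
  comp c d (dl j) = \sum_i ev (pd i c) (\col_i d i 0) * d i (dl j).
Proof.
move=> sc; rewrite /comp.
under eq_fun do rewrite powf_dl mulr_sumr.
set q := \col_i d i 0.
rewrite (_ : (fun a => _) = (fun a : multi_index n => \sum_(i < n)
    d i (dl j) * (c a * ((a i)%:R * monomial q (mi_pred a i))))); last first.
  by apply/funext => a; apply: eq_bigr => i _; ring.
have h i := tsum_pd (sc i).
rewrite tsum_sum; last by move=> i; apply: absumZ; exact: (h i).1.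
by apply: eq_bigr => i _; rewrite tsumZ ?(h i).2 1?mulrC//; exact: (h i).1.
Qed.

Lemma conv_pd n (k : 'I_n) r s (u : multi_index n -> R) : 0 < r -> r < s -> conv s u ->
  conv r (pd k u).
Proof.
move=> r0 rs cu.
have s0 : 0 < s by exact: lt_trans rs.
(* With s = r (1 + e), the factor a_k + 1 produced by differentiation is absorbed by (1 + e)^(|a| +
   1), through Bernoulli's inequality. *)
pose e := s / r - 1.
have e0 : 0 < e by rewrite subr_gt0 ltr_pdivlMr// mul1r.
have es : s = r * (1 + e) by rewrite /e addrC subrK mulrC divfK// gt_eqF.
have bern (m : nat) : m%:R * e <= (1 + e) ^+ m.
  elim: m => [|m IH]; first by rewrite mul0r ler01.
  have : 1 <= (1 + e) ^+ m by rewrite exprn_ege1// lerDl ltW.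
  by rewrite exprS -natr1; nra.
pose C := (r * e)^-1.
apply: (absum_le (v := fun a => C * `|u (a + dl k) * s ^+ mdegree (a + dl k)|)); last first.
  apply: absumZ; apply: (absum_comp_inj (f := fun a : multi_index n => a + dl k)
    (u := fun a => `|u a * s ^+ mdegree a|)); first exact: mi_addI.
  exact: absum_norm.
move=> a; rewrite /pd !normrM normr_nat mulrAC [X in _ <= X]mulrCA [X in X <= _]mulrC.
rewrite ler_wpM2l// mdegreeD mdegree_dl addn1 !normrX (gtr0_norm r0) (gtr0_norm s0).
rewrite /C ler_pdivlMl ?mulr_gt0// es exprMn.
apply: (@le_trans _ _ (r ^+ (mdegree a).+1 * ((mdegree a).+1%:R * e))); last first.
  by rewrite ler_wpM2l ?exprn_ge0 ?(ltW r0)// bern.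
rewrite [X in X <= _](_ : _ = (r * e * r ^+ mdegree a) * (a k).+1%:R); last by ring.
rewrite [X in _ <= X](_ : _ = (r * e * r ^+ mdegree a) * (mdegree a).+1%:R); last by rewrite exprS; ring.
apply: ler_wpM2l; first by rewrite !mulr_ge0 ?exprn_ge0// ltW.
by rewrite ler_nat ltnS leq_mdegree.
Qed.

Definition translation n (p : 'cV[R]_n) (i : 'I_n) : multi_index n -> R :=
  fun a => p i 0 * @fone R n a + fvar R i a.

Lemma conv_translation n (p : 'cV[R]_n) i r : conv r (translation p i).
Proof. by apply: convD; [exact/convZ/conv_one|exact: conv_var]. Qed.

Lemma nrm_translation n (p : 'cV[R]_n) i r t : 0 <= r -> inbox t p ->
  nrm r (translation p i) <= t + r.
Proof.
move=> r0 pt; rewrite /translation.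
apply: le_trans (nrmD r0 (convZ (p i 0) (@conv_one R n r)) (@conv_var R n r i)) _.
by rewrite nrmZ//; [rewrite nrm_one mulr1 nrm_var lerD2r|exact: conv_one].
Qed.

Lemma evs_translation n (p x : 'cV[R]_n) : evs (translation p) x = p + x.
Proof.
apply/colP => i; rewrite !mxE.
have xr : inbox (\sum_i `|x i 0|) x.
  by move=> k; rewrite (bigD1 k)//= lerDl sumr_ge0.
have r0 : 0 <= \sum_i `|x i 0| by rewrite sumr_ge0.
rewrite (evD r0 _ _ xr); [|exact/convZ/conv_one|exact: conv_var].
by rewrite (evZ _ r0 _ xr) ?ev_one ?mulr1 ?ev_var//; exact: conv_one.
Qed.

Lemma translation0 n (p : 'cV[R]_n) : \col_i translation p i 0 = p.
Proof.
apply/colP => i; rewrite mxE /translation /fone /fvar eqxx eq_sym dl_neq0.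
by rewrite mulr1 addr0.
Qed.

Lemma translation_dl n (p : 'cV[R]_n) i j : translation p i (dl j) = (i == j)%:R.
Proof.
rewrite /translation /fone /fvar dl_neq0 mulr0 add0r; congr (nat_of_bool _)%:R.
apply/eqP/eqP => [/ffunP/(_ j)|->//]; rewrite !ffunE eqxx.
by case: eqVneq.
Qed.

(** Expansion at p is composition with x |-> p + x. Its linear coefficients are values of [pd], so
    derivatives at p are obtained without differentiating a sum of functions term by term. *)
Lemma recenter n (c : multi_index n -> R) (p : 'cV[R]_n) r t : 0 < r -> 0 <= t ->
  conv (t + r) c -> inbox t p ->
  [/\ conv r (comp c (translation p)),
      forall x, inbox r x -> ev (comp c (translation p)) x = ev c (p + x) &
      forall j, comp c (translation p) (dl j) = ev (pd j c) p].
Proof.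
move=> r0 t0 cc pt.
have tr0 : 0 <= t + r by rewrite addr_ge0// ltW.
have nt i := nrm_translation i (ltW r0) pt.
have ct i := conv_translation p i r.
split.
- exact: conv_comp r0 tr0 cc ct nt.
- by move=> x xr; rewrite (ev_comp r0 tr0 cc ct nt xr) evs_translation.
- move=> j; rewrite comp_dl translation0.
    rewrite (bigD1 j)//= translation_dl eqxx mulr1 big1 ?addr0// => i /negPf ij.
    by rewrite translation_dl ij mulr0.
  move=> i; apply: (conv_ev (r := t + r / 2)).
  + by rewrite addr_ge0// divr_ge0// ltW.
  + apply: conv_pd cc; first by rewrite ltr_wpDl// divr_gt0.
    by rewrite ltrD2l ltr_pdivrMr// ltr_pMr// ltr1n.
  + by move=> k; rewrite (le_trans (pt k))// lerDl divr_ge0// ltW.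
Qed.

End Composition.

(** * Taylor series: derivatives and uniqueness *)

Section Taylor.
Variable R : realType.

Lemma near_inbox n (p : 'cV[R]_n) (P : set 'cV[R]_n) :
  (\forall x \near p, P x) <-> exists2 r, 0 < r & forall x, inbox r (x - p) -> P x.
Proof.
split=> [/nbhs_ballP[e e0 eP]|[r r0 rP]].
  have e0' : (0 : R) < e by exact: e0.
  exists (e / 2); first by rewrite divr_gt0.
  move=> x xp; apply: eP; split=> // i j; rewrite [j]ord1.
  rewrite -ball_normE /= distrC.
  have := xp i; rewrite !mxE => h; apply: le_lt_trans h _.
  by rewrite ltr_pdivrMr// ltr_pMr// ltr1n.
apply/nbhs_ballP; exists r => // x [_ px]; apply: rP => i.
have := px i 0; rewrite -ball_normE /= distrC !mxE; exact: ltW.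
Qed.

Lemma inbox_const n (r : R) : 0 <= r -> inbox r (\col_(i < n) r).
Proof. by move=> r0 i; rewrite mxE ger0_norm. Qed.

Lemma monomial_const n (r : R) a : monomial (\col_(i < n) r) a = r ^+ mdegree a.
Proof. by rewrite /monomial /mdegree -prodrXr; apply: eq_bigr => i _; rewrite mxE. Qed.

Lemma has_taylorP n (g : 'cV[R]_n -> R) p c : has_taylor_series g p c <->
  exists2 r, 0 < r & conv r c /\ forall x, inbox r (x - p) -> g x = ev c (x - p).
Proof.
rewrite /has_taylor_series near_inbox; split=> -[r r0].
  move=> h; exists r => //; split.
    have /h/sums_toE[+ _] : inbox r ((p + \col_i r) - p).
      by rewrite addrC addKr; apply: inbox_const; exact: ltW.
    rewrite addrC addKr; congr absum; apply/funext => a.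
    by rewrite monomial_const.
  by move=> x /h/sums_toE[].
move=> [cc h]; exists r => // x xp; apply/sums_toE; split; last by rewrite h.
exact: conv_ev (ltW r0) cc xp.
Qed.

Lemma monomialZ n (h : R) (v : 'cV[R]_n) a :
  monomial (h *: v) a = h ^+ mdegree a * monomial v a.
Proof.
rewrite /monomial /mdegree -prodrXr -big_split; apply: eq_bigr => i _.
by rewrite mxE exprMn.
Qed.

Lemma dl_inj n : injective (@dl n).
Proof.
by move=> i j /ffunP/(_ i); rewrite !ffunE eqxx; case: eqVneq.
Qed.

Lemma mdegree1P n (a : multi_index n) : mdegree a = 1%N -> exists i, a = dl i.
Proof.
move=> a1; have [i ai] : exists k, (0 < a k)%N.
  by apply: mi_neq0P; rewrite -mdegree_eq0 a1.
exists i; have := mi_predK ai => e; have := congr1 (@mdegree n) e.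
rewrite mdegreeD mdegree_dl a1 => /eqP; rewrite addn1 eqSS mdegree_eq0 => /eqP h.
by rewrite -e h add0r.
Qed.

Definition tail2 n (c : multi_index n -> R) : multi_index n -> R :=
  fun a => if (mdegree a <= 1)%N then 0 else c a.

Lemma tail2E n (c : multi_index n -> R) a :
  c a = (c 0 * @fone R n a + \sum_i c (dl i) * fvar R i a) + tail2 c a.
Proof.
have [->|a0] := eqVneq a 0.
  rewrite /fone eqxx mulr1 /tail2 mdegree0 addr0 big1 ?addr0// => i _.
  by rewrite /fvar eq_sym dl_neq0 mulr0.
rewrite /fone (negPf a0) mulr0 add0r /tail2; case: leqP => a1.
  have [i ->] : exists i, a = dl i.
    by apply: mdegree1P; move: a0; rewrite -mdegree_eq0; case: mdegree a1 => [|[]].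
  rewrite addr0 (bigD1 i)//= /fvar eqxx mulr1 big1 ?addr0// => j ji.
  by rewrite (inj_eq (@dl_inj n)) eq_sym (negPf ji) mulr0.
rewrite big1 ?add0r// => i _; rewrite /fvar; case: eqVneq => [ai|]; last by rewrite mulr0.
by rewrite ai mdegree_dl in a1.
Qed.

Lemma conv_tail2 n r (c : multi_index n -> R) : conv r c -> conv r (tail2 c).
Proof.
move=> /absum_norm; apply: absum_le => a.
by rewrite /tail2; case: ifP => //; rewrite mul0r normr0.
Qed.

Lemma ev_tail2 n r (c : multi_index n -> R) x : 0 <= r -> conv r c -> inbox r x ->
  ev c x = c 0 + \sum_i c (dl i) * x i 0 + ev (tail2 c) x.
Proof.
move=> r0 cc xr.
have cv i : conv r (fun a => c (dl i) * fvar R i a) by exact/convZ/conv_var.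
have co : conv r (fun a => c 0 * @fone R n a) by exact/convZ/conv_one.
rewrite {1}(_ : c = (fun a => (c 0 * @fone R n a + \sum_i c (dl i) * fvar R i a) + tail2 c a)); last first.
  by apply/funext => a; exact: tail2E.
rewrite (evD r0 _ _ xr); [|apply: convD => //; exact: conv_sum|exact: conv_tail2].
rewrite (evD r0 co _ xr); last exact: conv_sum.
rewrite (evZ _ r0 _ xr) ?ev_one ?mulr1; last exact: conv_one.
congr (_ + _ + _); rewrite (ev_sum _ r0 _ xr)//; apply: eq_bigr => i _.
by rewrite (evZ _ r0 _ xr) ?ev_var//; exact: conv_var.
Qed.

Lemma ev_tail2_small n r (c : multi_index n -> R) (v : 'cV[R]_n) : 0 <= r -> conv r c ->
  inbox r v -> forall h, `|h| <= 1 -> `|ev (tail2 c) (h *: v)| <= h ^+ 2 * nrm r c.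
Proof.
move=> r0 cc vr h h1.
have cv := conv_ev r0 cc vr.
have hle a : `|tail2 c a * monomial (h *: v) a| <= h ^+ 2 * (`|c a| * r ^+ mdegree a).
  rewrite /tail2; case: leqP => a1.
    by rewrite mul0r normr0 mulr_ge0 ?sqr_ge0// mulr_ge0// exprn_ge0.
  rewrite monomialZ normrM normrM mulrCA; apply: ler_pM; rewrite ?mulr_ge0//.
    by rewrite normrX -[X in _ <= X]ger0_norm ?sqr_ge0// normrX ler_wiXn2l.
  by rewrite ler_wpM2l// norm_monomial_le.
have sr := absumZ (h ^+ 2) (conv_abs r0 cc).
have sl : absum (fun a => tail2 c a * monomial (h *: v) a) by exact: absum_le sr.
apply: le_trans (ler_norm_tsum sl) _.
rewrite /nrm -tsumZ; last exact: conv_abs.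
by apply: ler_tsum => //; exact: absum_norm.
Qed.

(** The terms of degree at least 2 contribute O(h^2) at p + h v, so the difference quotient tends to
    the linear part. *)
Lemma has_taylor_derive n (g : 'cV[R]_n -> R) p c (v : 'cV[R]_n) :
  has_taylor_series g p c -> 'D_v g p = \sum_i c (dl i) * v i 0.
Proof.
move=> /has_taylorP[r r0 [cc gE]].
set L := \sum_i _.
pose M := 1 + \sum_i `|v i 0|.
have M0 : 0 < M by rewrite ltr_pwDl// sumr_ge0.
(* Rescaling v into the cube of radius r allows [ev_tail2_small] to be applied with parameter h /
   rho. *)
pose rho := r / M.
have rho0 : 0 < rho by rewrite divr_gt0.
have vr : inbox r (rho *: v).
  move=> i; rewrite mxE normrM gtr0_norm// /rho mulrAC ler_pdivrMr// ler_wpM2l ?(ltW r0)//.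
  by rewrite /M (bigD1 i)//= addrCA lerDl addr_ge0// sumr_ge0.
pose K := nrm r c / rho ^+ 2.
have K0 : 0 <= K by rewrite divr_ge0 ?nrm_ge0 ?exprn_ge0// ltW.
have main h : h != 0 -> `|h| <= rho ->
    `|L - h^-1 *: ((g \o shift p) (h *: v) - g p)| <= `|h| * K.
  move=> h0 hr.
  have hv : h *: v = (h / rho) *: (rho *: v) by rewrite scalerA divfK// gt_eqF.
  have hr1 : `|h / rho| <= 1.
    by rewrite normrM normfV (gtr0_norm rho0) ler_pdivrMr// mul1r.
  have hvr : inbox r (h *: v).
    move=> i; rewrite hv mxE normrM; apply: le_trans (vr i).
    by rewrite ler_piMl.
  have z0 : inbox r (0 : 'cV[R]_n) by move=> i; rewrite mxE normr0 ltW.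
  have c0 : ev c 0 = c 0.
    rewrite (ev_tail2 (ltW r0) cc z0) big1 ?addr0; last by move=> i _; rewrite mxE mulr0.
    have := ev_tail2_small (ltW r0) cc z0 (h := 0).
    by rewrite normr0 ler01 scale0r expr0n /= mul0r normr_le0 => /(_ isT)/eqP->; rewrite addr0.
  rewrite /= gE ?addrK// (gE p) ?subrr// c0 (ev_tail2 (ltW r0) cc hvr).
  have -> : \sum_i c (dl i) * (h *: v) i 0 = h * L.
    by rewrite mulr_sumr; apply: eq_bigr => i _; rewrite mxE mulrCA.
  rewrite (_ : L - _ = - (h^-1 * ev (tail2 c) (h *: v))); last first.
    by rewrite /GRing.scale /=; field.
  rewrite normrN normrM normfV ler_pdivrMl ?normr_gt0// hv.
  apply: le_trans (ev_tail2_small (ltW r0) cc vr hr1) _.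
  rewrite /K exprMn exprVn -[h ^+ 2]ger0_norm ?sqr_ge0// normrX le_eqVlt; apply/orP; left.
  apply/eqP; ring.
rewrite /derive; apply: cvg_lim => //.
apply/cvgrPdist_le => e e0; near=> h.
have h0 : h != 0 by near: h; exact: nbhs_dnbhs_neq.
have hr : `|h| <= rho.
  near: h; apply: dnbhs0_le; exact: rho0.
apply: le_trans (main h h0 hr) _.
have he : `|h| <= e / (1 + K).
  by near: h; apply: dnbhs0_le; rewrite divr_gt0// ltr_pwDl.
apply: le_trans (ler_wpM2r K0 he) _.
rewrite mulrAC ler_pdivrMr ?ltr_pwDl// ler_wpM2l ?(ltW e0)//.
by rewrite lerDr.
Unshelve. all: by end_near. Qed.

Lemma ev0 n r (c : multi_index n -> R) : 0 < r -> conv r c -> ev c 0 = c 0.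
Proof.
move=> r0 cc; rewrite /ev (tsum1 (x := 0)) ?monomial0 ?mulr1// => a /mi_neq0P[k ak].
by rewrite /monomial (bigD1 k)//= mxE expr0n eqn0Ngt ak /= mul0r mulr0.
Qed.

(** Recentring at each point of the cube of half the size shows that every [pd k c] also represents
    0 there, and passing to [pd k c] lowers the degree of the coefficient in question. *)
Lemma coeffs_eq0 n r (c : multi_index n -> R) : 0 < r -> conv r c ->
  (forall x, inbox r x -> ev c x = 0) -> forall a, c a = 0.
Proof.
move=> r0 cc c0 a; have [m am] := ubnP (mdegree a).
elim: m => // m IH in r c r0 cc c0 a am *.
have z0 : inbox r (0 : 'cV[R]_n) by move=> i; rewrite mxE normr0 ltW.
have [->|/mi_neq0P[k ak]] := eqVneq a 0; first by rewrite -(ev0 r0 cc) c0.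
have r20 : 0 < r / 2 by rewrite divr_gt0.
have r2r : r / 2 < r by rewrite ltr_pdivrMr// ltr_pMr// ltr1n.
have pd0 x : inbox (r / 2) x -> ev (pd k c) x = 0.
  move=> xr; have cc' : conv (r / 2 + r / 2) c by rewrite -splitr.
  have [ce eE <-] := recenter r20 (ltW r20) cc' xr.
  have T : has_taylor_series (fun _ => 0 : R) 0 (comp c (translation x)).
    apply/has_taylorP; exists (r / 2) => //; split=> // y; rewrite subr0 => yr.
    rewrite eE// c0// => i; rewrite mxE (splitr r).
    by apply: le_trans (ler_normD _ _) _; rewrite lerD.
  have := has_taylor_derive (\col_i (i == k)%:R) T.
  rewrite derive_cst (bigD1 k)//= mxE eqxx mulr1 big1 ?addr0// => i /negPf ik.
  by rewrite mxE ik mulr0.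
have := IH (r / 2) (pd k c) r20 (conv_pd _ r20 r2r cc) pd0 (mi_pred a k).
rewrite /pd mi_predK// => h; apply/eqP.
have : (mdegree (mi_pred a k) < m)%N.
  by have := congr1 (@mdegree n) (mi_predK ak); rewrite mdegreeD mdegree_dl; lia.
by move=> /h/eqP; rewrite mulf_eq0 pnatr_eq0.
Qed.

Lemma convN n r (c : multi_index n -> R) : conv r c -> conv r (fun a => - c a).
Proof. by move=> /absumN; congr absum; apply/funext => a; rewrite mulNr. Qed.

Lemma coeffs_eq n r (c d : multi_index n -> R) : 0 < r -> conv r c -> conv r d ->
  (forall x, inbox r x -> ev c x = ev d x) -> forall a, c a = d a.
Proof.
move=> r0 cc cd cdE a; apply/eqP; rewrite -subr_eq0; apply/eqP.
apply: (coeffs_eq0 (c := fun a => c a - d a) r0).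
  by apply: convD => //; exact: convN.
move=> x xr; rewrite (evD (ltW r0) cc _ xr); last exact: convN.
rewrite (_ : (fun a => - d a) = (fun a => -1 * d a)); last first.
  by apply/funext => b; rewrite mulN1r.
by rewrite (evZ _ (ltW r0) cd xr) mulN1r cdE// subrr.
Qed.

End Taylor.

(** * Germs of analytic functions at the origin *)

Section Germs.
Variable R : realType.

Definition germ n (c : multi_index n -> R) : Prop := exists2 r, 0 < r & conv r c.

Definition ord n (p : nat) (c : multi_index n -> R) : Prop :=
  forall a, (mdegree a < p)%N -> c a = 0.

Lemma near0P n (P : 'cV[R]_n -> Prop) :
  (\forall x \near (0 : 'cV[R]_n), P x) <-> exists2 r, 0 < r & forall x, inbox r x -> P x.
Proof.
rewrite near_inbox; split=> -[r r0 h]; exists r => // x xr; apply: h.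
  by rewrite subr0.
by rewrite subr0 in xr.
Qed.

Lemma inbox_le n r s (x : 'cV[R]_n) : r <= s -> inbox r x -> inbox s x.
Proof. by move=> rs xr i; exact: le_trans (xr i) rs. Qed.

Lemma near_and n (P Q : 'cV[R]_n -> Prop) :
  (\forall x \near (0 : 'cV[R]_n), P x) -> (\forall x \near (0 : 'cV[R]_n), Q x) ->
  \forall x \near (0 : 'cV[R]_n), P x /\ Q x.
Proof. by move=> hP hQ; apply: filterS2 hP hQ. Qed.

Lemma near_all n (K : finType) (P : K -> 'cV[R]_n -> Prop) :
  (forall k, \forall x \near (0 : 'cV[R]_n), P k x) ->
  \forall x \near (0 : 'cV[R]_n), forall k, P k x.
Proof.
move=> h; have /choice[r rP] : forall k, exists r, 0 < r /\ forall x, inbox r x -> P k x.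
  by move=> k; have /near0P[r r0 hr] := h k; exists r.
pose t := \big[Order.min/1]_k r k.
have t0 : 0 < t.
  by rewrite /t; elim/big_ind: _ => // [x y x0 y0|k _]; [rewrite lt_min x0|exact: (rP k).1].
apply/near0P; exists t => // x xt k; apply: (rP k).2; apply: inbox_le xt.
by rewrite /t (bigD1 k)//= ge_min lexx.
Qed.

Lemma germ_fin n (K : finType) (c : K -> multi_index n -> R) :
  (forall k, germ (c k)) -> exists2 r, 0 < r & forall k, conv r (c k).
Proof.
move=> gc; have /choice[r rP] : forall k, exists r, 0 < r /\ conv r (c k).
  by move=> k; have [r r0 cr] := gc k; exists r.
pose t := \big[Order.min/1]_k r k.
have t0 : 0 < t.
  by rewrite /t; elim/big_ind: _ => // [x y x0 y0|k _]; [rewrite lt_min x0|exact: (rP k).1].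
exists t => // k; apply: conv_le (ltW t0) _ (rP k).2.
by rewrite /t (bigD1 k)//= ge_min lexx.
Qed.

(** A Schwarz-type estimate: every monomial of degree at least p shrinks by at least the factor (r /
    s)^p. *)
Lemma nrm_ord n p r s (c : multi_index n -> R) : 0 <= r -> r <= s -> 0 < s -> conv s c ->
  ord p c -> nrm r c <= (r / s) ^+ p * nrm s c.
Proof.
move=> r0 rs s0 cc oc; rewrite /nrm -tsumZ; last exact: conv_abs (ltW s0) cc.
apply: ler_tsum.
- exact: conv_abs r0 (conv_le r0 rs cc).
- by apply: absumZ; exact: conv_abs (ltW s0) cc.
- move=> a; case: (ltnP (mdegree a) p) => ap; first by rewrite oc// normr0 !mul0r mulr0.
  rewrite mulrCA ler_wpM2l//.
  have -> : r ^+ mdegree a = (r / s) ^+ mdegree a * s ^+ mdegree a.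
    by rewrite -exprMn divfK// gt_eqF.
  rewrite ler_wpM2r ?exprn_ge0 ?(ltW s0)// ler_wiXn2l//.
    by rewrite divr_ge0// ltW.
  by rewrite ler_pdivrMr// mul1r.
Qed.

(** Finitely many series without constant term have arbitrarily small norm on small cubes, which is
    the condition for substituting them into a germ. *)
Lemma small_nrm n (K : finType) (d : K -> multi_index n -> R) e : 0 < e ->
  (forall k, germ (d k)) -> (forall k, ord 1 (d k)) ->
  exists2 r, 0 < r & forall k, conv r (d k) /\ nrm r (d k) <= e.
Proof.
move=> e0 gd od; have [s s0 cd] := germ_fin gd.
pose M := 1 + \sum_k nrm s (d k) / s.
have M0 : 0 < M.
  by rewrite ltr_pwDl// sumr_ge0// => k _; rewrite divr_ge0 ?nrm_ge0// ltW.
pose r := Order.min s (e / M).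
have r0 : 0 < r by rewrite lt_min s0 divr_gt0.
have rs : r <= s by rewrite ge_min lexx.
exists r => // k; split; first exact: conv_le (ltW r0) rs (cd k).
apply: le_trans (nrm_ord (ltW r0) rs s0 (cd k) (od k)) _.
rewrite expr1 mulrAC -mulrA.
apply: (@le_trans _ _ (r * M)); last by rewrite -ler_pdivlMr// ge_min lexx orbT.
rewrite ler_wpM2l ?(ltW r0)// /M (bigD1 k)//= addrCA lerDl addr_ge0// sumr_ge0// => j _.
by rewrite divr_ge0 ?nrm_ge0// ltW.
Qed.

Lemma near_evs n m (d : 'I_n -> multi_index m -> R) (P : 'cV[R]_n -> Prop) :
  (forall i, germ (d i)) -> (forall i, ord 1 (d i)) ->
  (\forall z \near (0 : 'cV[R]_n), P z) -> \forall x \near (0 : 'cV[R]_m), P (evs d x).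
Proof.
move=> gd od /near0P[e e0 eP]; have [r r0 rd] := small_nrm e0 gd od.
apply/near0P; exists r => // x xr; apply: eP.
by apply: inbox_evs xr => // i; [exact: (rd i).1|exact: (rd i).2].
Qed.

Lemma germ_one n : germ (@fone R n).
Proof. by exists 1 => //; exact: conv_one. Qed.

Lemma germ_var n k : germ (@fvar R n k).
Proof. by exists 1 => //; exact: conv_var. Qed.

Lemma germ_pd n k (c : multi_index n -> R) : germ c -> germ (pd k c).
Proof.
move=> [r r0 cc]; exists (r / 2); first by rewrite divr_gt0.
by apply: conv_pd cc; rewrite ?divr_gt0// ltr_pdivrMr// ltr_pMr// ltr1n.
Qed.

Lemma germ_tail2 n (c : multi_index n -> R) : germ c -> germ (tail2 c).
Proof. by move=> [r r0 cc]; exists r => //; exact: conv_tail2. Qed.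

Lemma germZ n k (c : multi_index n -> R) : germ c -> germ (fun a => k * c a).
Proof. by move=> [r r0 cc]; exists r => //; exact: convZ. Qed.

Lemma near_evZ n k (c : multi_index n -> R) : germ c ->
  \forall x \near (0 : 'cV[R]_n), ev (fun a => k * c a) x = k * ev c x.
Proof.
move=> [r r0 cc]; apply/near0P; exists r => // x xr.
exact: evZ (ltW r0) cc xr.
Qed.

Lemma germD n (c d : multi_index n -> R) : germ c -> germ d -> germ (fun a => c a + d a).
Proof.
move=> gc gd; have [|r r0 h] := @germ_fin n bool (fun b => if b then c else d).
  by case.
by exists r => //; apply: convD; [exact: (h true)|exact: (h false)].
Qed.

Lemma near_evD n (c d : multi_index n -> R) : germ c -> germ d ->
  \forall x \near (0 : 'cV[R]_n), ev (fun a => c a + d a) x = ev c x + ev d x.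
Proof.
move=> gc gd; have [|r r0 h] := @germ_fin n bool (fun b => if b then c else d).
  by case.
apply/near0P; exists r => // x xr; exact: evD (ltW r0) (h true) (h false) xr.
Qed.

Lemma germ_mul n (c d : multi_index n -> R) : germ c -> germ d -> germ (mul c d).
Proof.
move=> gc gd; have [|r r0 h] := @germ_fin n bool (fun b => if b then c else d).
  by case.
by exists r => //; exact: conv_mul (h true) (h false).
Qed.

Lemma near_ev_mul n (c d : multi_index n -> R) : germ c -> germ d ->
  \forall x \near (0 : 'cV[R]_n), ev (mul c d) x = ev c x * ev d x.
Proof.
move=> gc gd; have [|r r0 h] := @germ_fin n bool (fun b => if b then c else d).
  by case.
apply/near0P; exists r => // x xr; exact: ev_mul (ltW r0) (h true) (h false) xr.
Qed.

Lemma germ_sum n (K : finType) (c : K -> multi_index n -> R) : (forall k, germ (c k)) ->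
  germ (fun a => \sum_k c k a).
Proof. by move=> /germ_fin[r r0 h]; exists r => //; exact: conv_sum. Qed.

Lemma near_ev_sum n (K : finType) (c : K -> multi_index n -> R) : (forall k, germ (c k)) ->
  \forall x \near (0 : 'cV[R]_n), ev (fun a => \sum_k c k a) x = \sum_k ev (c k) x.
Proof.
move=> /germ_fin[r r0 h]; apply/near0P; exists r => // x xr.
exact: ev_sum (ltW r0) h xr.
Qed.

Lemma germ_comp n m (c : multi_index n -> R) (d : 'I_n -> multi_index m -> R) :
  germ c -> (forall i, germ (d i)) -> (forall i, ord 1 (d i)) -> germ (comp c d).
Proof.
move=> [s s0 cc] gd od; have [r r0 h] := small_nrm s0 gd od.
by exists r => //; exact: conv_comp r0 (ltW s0) cc (fun i => (h i).1) (fun i => (h i).2).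
Qed.

Lemma near_ev_comp n m (c : multi_index n -> R) (d : 'I_n -> multi_index m -> R) :
  germ c -> (forall i, germ (d i)) -> (forall i, ord 1 (d i)) ->
  \forall x \near (0 : 'cV[R]_m), ev (comp c d) x = ev c (evs d x).
Proof.
move=> [s s0 cc] gd od; have [r r0 h] := small_nrm s0 gd od.
apply/near0P; exists r => // x.
exact: ev_comp r0 (ltW s0) cc (fun i => (h i).1) (fun i => (h i).2) x.
Qed.

Lemma germ_eq n (c d : multi_index n -> R) : germ c -> germ d ->
  (\forall x \near (0 : 'cV[R]_n), ev c x = ev d x) -> c = d.
Proof.
move=> gc gd /near0P[s s0 sE].
have [|r r0 h] := @germ_fin n bool (fun b => if b then c else d); first by case.
have t0 : 0 < Order.min r s by rewrite lt_min r0.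
apply/funext; apply: (coeffs_eq t0).
- by apply: conv_le (ltW t0) _ (h true); rewrite ge_min lexx.
- by apply: conv_le (ltW t0) _ (h false); rewrite ge_min lexx.
- by move=> x xt; apply: sE; apply: inbox_le xt; rewrite ge_min lexx orbT.
Qed.

Lemma ev_germ0 n (c : multi_index n -> R) : germ c -> ev c 0 = c 0.
Proof. by move=> [r r0 cc]; exact: ev0 cc. Qed.

(** The expansion is made at all points z near 0, not only at 0: the first integral equation has to
    be checked on a whole neighbourhood, and [H] has to be analytic there. *)
Lemma chain_rule n m (H : 'cV[R]_m -> R) (h : multi_index n -> R)
    (d : 'I_n -> multi_index m -> R) :
  germ h -> (forall i, germ (d i)) -> (forall i, ord 1 (d i)) ->
  (\forall z \near (0 : 'cV[R]_m), H z = ev h (evs d z)) ->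
  \forall z \near (0 : 'cV[R]_m), (exists c, has_taylor_series H z c) /\
    forall v : 'cV[R]_m, 'D_v H z =
      \sum_l ev (pd l h) (evs d z) * \sum_k ev (pd k (d l)) z * v k 0.
Proof.
move=> [s s0 ch] gd od /near0P[e e0 eH].
have s20 : 0 < s / 2 by rewrite divr_gt0.
have s2s : s / 2 < s by rewrite ltr_pdivrMr// ltr_pMr// ltr1n.
have [r r0 rd] := small_nrm s20 gd od.
(* Halved radii: z and the displacement from z each stay within t, so their sum stays where the
   inner series converge and where [H] equals the composite. *)
pose t := Order.min (r / 2) (e / 2).
have t0 : 0 < t by rewrite lt_min !divr_gt0.
have ttr : t + t <= r by rewrite (splitr r) lerD// ge_min lexx.
have tte : t + t <= e by rewrite (splitr e) lerD// ge_min lexx orbT.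
have tt0 : 0 <= t + t by rewrite addr_ge0// ltW.
apply/near0P; exists t => // z zt.
pose dz l := comp (d l) (translation z).
have cdl l : conv (t + t) (d l) by exact: conv_le tt0 ttr (rd l).1.
have nt i := nrm_translation i (ltW t0) zt.
have ct i := @conv_translation R m z i t.
have cdz l : conv t (dz l) by exact: conv_comp t0 tt0 (cdl l) ct nt.
have ndz l : nrm t (dz l) <= s / 2.
  apply: le_trans (nrm_comp t0 tt0 (cdl l) ct nt) _.
  exact: le_trans (nrm_le tt0 ttr (rd l).1) (rd l).2.
have ch2 : conv (s / 2) h by exact: conv_le (ltW s20) (ltW s2s) ch.
have T : has_taylor_series H z (comp h dz).
  apply/has_taylorP; exists t => //; split; first exact: conv_comp (ltW s20) ch2 cdz ndz.
  move=> x xz; rewrite (ev_comp t0 (ltW s20) ch2 cdz ndz xz) eH; last first.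
    move=> i; rewrite -[x](subrK z) mxE; apply: le_trans (ler_normD _ _) _.
    by apply: le_trans tte; rewrite lerD.
  congr ev; apply/colP => i; rewrite !mxE.
  have [_ -> //] := recenter t0 (ltW t0) (cdl i) zt.
  by rewrite addrC subrK.
split; first by exists (comp h dz).
have z0 : inbox t (0 : 'cV[R]_m) by move=> i; rewrite mxE normr0 ltW.
have qE : \col_i dz i 0 = evs d z.
  apply/colP => i; rewrite !mxE -(ev0 t0 (cdz i)).
  by have [_ -> //] := recenter t0 (ltW t0) (cdl i) zt; rewrite addr0.
have qs : inbox (s / 2) (evs d z).
  apply: (inbox_evs r0 (fun i => (rd i).1) (fun i => (rd i).2)).
  apply: inbox_le zt; rewrite ge_min (_ : r / 2 <= r) ?orTb//.
  by rewrite ler_pdivrMr// ler_pMr// ler1n.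
move=> v; rewrite (has_taylor_derive v T).
under eq_bigr => k _.
  rewrite comp_dl; last first.
    move=> i; rewrite qE; apply: (conv_ev (ltW s20) _ qs).
    exact: conv_pd s20 s2s ch.
  rewrite mulr_suml; over.
rewrite exchange_big; apply: eq_bigr => l _; rewrite mulr_sumr.
apply: eq_bigr => k _; rewrite qE mulrA; congr (_ * _ * _).
by have [_ _ hk] := recenter t0 (ltW t0) (cdl l) zt; exact: hk.
Qed.

End Germs.

(** * The analytic inverse function theorem *)

Section Inverse.
Variable R : realType.

(* [u] and [v] agree in degrees below [m + p - 1]; written without subtraction. *)
Definition agree n (m p : nat) (u v : multi_index n -> R) : Prop :=
  [/\ ord p u, ord p v & forall a, (mdegree a + 1 < m + p)%N -> u a = v a].

Lemma ord_mul n p q (u v : multi_index n -> R) : ord p u -> ord q v -> ord (p + q) (mul u v).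
Proof.
move=> ou ov c cpq; rewrite mulE big_seq big1// => -[a b] /=.
rewrite mem_mpairs /= => /eqP abc; rewrite -abc mdegreeD in cpq.
case: (ltnP (mdegree a) p) => ap; first by rewrite ou// mul0r.
by rewrite ov ?mulr0//; lia.
Qed.

Lemma agree_mul n m p q (u u' v v' : multi_index n -> R) :
  agree m p u u' -> agree m q v v' -> agree m (p + q) (mul u v) (mul u' v').
Proof.
move=> [ou ou' uu] [ov ov' vv]; split; [exact: ord_mul|exact: ord_mul|].
move=> c cm; rewrite !mulE; apply: eq_big_seq => -[a b] /=.
rewrite mem_mpairs /= => /eqP abc; rewrite -abc mdegreeD in cm.
case: (ltnP (mdegree a) p) => ap; first by rewrite ou// ou'// !mul0r.
case: (ltnP (mdegree b) q) => bq; first by rewrite ov// ov'// !mulr0.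
by rewrite uu ?vv//; lia.
Qed.

Lemma agree_powf n k m (d d' : 'I_n -> multi_index k -> R) a :
  (forall i, agree m 1 (d i) (d' i)) -> agree m (mdegree a) (powf d a) (powf d' a).
Proof.
move=> dd; rewrite /powf /mdegree.
elim/big_rec3: _ => [|i x y z _ IH]; first by split=> // -[].
apply: agree_mul IH; elim: (a i) => [|l IH] /=; first by split=> // -[].
by rewrite -[l.+1]add1n; apply: agree_mul.
Qed.

(** In a product of at least two factors of order 1, a coefficient of degree at most m involves only
    coefficients of degree below m of each factor. *)
Lemma agree_comp n k m (c : multi_index n -> R) (d d' : 'I_n -> multi_index k -> R) b :
  ord 2 c -> (forall i, agree m 1 (d i) (d' i)) -> (mdegree b <= m)%N ->
  comp c d b = comp c d' b.
Proof.
move=> oc dd bm; rewrite /comp; congr tsum; apply/funext => a.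
case: (ltnP (mdegree a) 2) => a2; first by rewrite oc// !mul0r.
have [_ _ ->//] := agree_powf a dd; lia.
Qed.

Lemma ord_comp n k p (c : multi_index n -> R) (d : 'I_n -> multi_index k -> R) :
  ord p c -> (forall i, ord 1 (d i)) -> ord p (comp c d).
Proof.
move=> oc od b bp; rewrite /comp (_ : (fun a => _) = (fun=> 0)) ?tsum0//.
apply/funext => a; case: (ltnP (mdegree a) p) => ap; first by rewrite oc ?mul0r.
have [h _ _] : agree 0 (mdegree a) (powf d a) (powf d a).
  by apply: agree_powf => i; split => //; exact: od.
by rewrite h ?mulr0//; lia.
Qed.

Lemma ord_tail2 n (c : multi_index n -> R) : ord 2 (tail2 c).
Proof. by move=> a a2; rewrite /tail2 -ltnS a2. Qed.

Lemma ordS n p (c : multi_index n -> R) : ord p.+1 c -> ord p c.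
Proof. by move=> oc a ap; apply: oc; rewrite ltnS ltnW. Qed.

Lemma ord1P n (c : multi_index n -> R) : ord 1 c <-> c 0 = 0.
Proof.
split=> [->//|c0 a]; first by rewrite mdegree0.
by rewrite ltnS leqn0 mdegree_eq0 => /eqP ->.
Qed.

(** The equation psi = P (x - theta(psi)) is causal: as theta has order 2, its right-hand side in
    degree m depends only on psi in degrees below m. The iterates from 0 therefore stabilise
    coefficientwise, and a norm bound preserved by the iteration passes to the limit. *)
Lemma solve_fixpoint n (P : 'M[R]_n) (theta : 'I_n -> multi_index n -> R) :
  (forall i, germ (theta i)) -> (forall i, ord 2 (theta i)) ->
  exists psi : 'I_n -> multi_index n -> R,
  [/\ forall i, germ (psi i), forall i, ord 1 (psi i) &
      forall i b, psi i b = \sum_j P i j * (fvar R j b - comp (theta j) psi b)].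
Proof.
move=> gt ot; have [s s0 ct] := germ_fin gt.
pose C := 1 + \sum_i \sum_j `|P i j|.
have C0 : 0 < C by rewrite ltr_pwDl// sumr_ge0// => i _; rewrite sumr_ge0.
pose K := 1 + \sum_j nrm s (theta j) / s ^+ 2.
have K0 : 0 < K.
  by rewrite ltr_pwDl// sumr_ge0// => i _; rewrite divr_ge0 ?nrm_ge0 ?exprn_ge0// ltW.
(* Chosen so that C (r + s1^2 K) <= s1 with r = s1 / (2 C): each of the two terms is at most s1 / 2,
   so the ball of norm s1 is invariant. *)
pose s1 := Order.min s (2 * C * K)^-1.
have s10 : 0 < s1 by rewrite lt_min s0 invr_gt0 !mulr_gt0.
have s1s : s1 <= s by rewrite ge_min lexx.
pose r := s1 / (2 * C).
have r0 : 0 < r by rewrite divr_gt0// mulr_gt0.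
have nt j : nrm s1 (theta j) <= s1 ^+ 2 * K.
  apply: le_trans (nrm_ord (ltW s10) s1s s0 (ct j) (ot j)) _.
  rewrite expr_div_n mulrAC -mulrA ler_wpM2l ?exprn_ge0 ?(ltW s10)//.
  rewrite /K (bigD1 j)//= addrCA lerDl addr_ge0// sumr_ge0// => i _.
  by rewrite divr_ge0 ?nrm_ge0 ?exprn_ge0// ltW.
have ct1 j : conv s1 (theta j) by exact: conv_le (ltW s10) s1s (ct j).
pose T (psi : 'I_n -> multi_index n -> R) i b :=
  \sum_j P i j * (fvar R j b - comp (theta j) psi b).
pose Inv (psi : 'I_n -> multi_index n -> R) :=
  forall i, [/\ ord 1 (psi i), conv r (psi i) & nrm r (psi i) <= s1].
have InvT psi : Inv psi -> Inv (T psi).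
  move=> h i.
  have [c1 c2 c3] : [/\ forall i, ord 1 (psi i), forall i, conv r (psi i) &
    forall i, nrm r (psi i) <= s1] by split=> k; have [] := h k.
  have cc j : conv r (comp (theta j) psi) by exact: conv_comp r0 (ltW s10) (ct1 j) c2 c3.
  have cb j : conv r (fun b => fvar R j b - comp (theta j) psi b).
    by apply: convD; [exact: conv_var|exact: convN].
  have cP j : conv r (fun b => P i j * (fvar R j b - comp (theta j) psi b)) by exact: convZ.
  split.
  - apply/ord1P; rewrite /T big1// => j _; rewrite (ord_comp (ordS (ot j)) c1) ?mdegree0//.
    by rewrite /fvar eq_sym dl_neq0 subr0 mulr0.
  - exact: conv_sum.
  - apply: le_trans (nrm_sum _ (ltW r0) cP) _.
    apply: (@le_trans _ _ (\sum_j `|P i j| * (r + s1 ^+ 2 * K))).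
      apply: ler_sum => j _; rewrite nrmZ ?(ltW r0)// ler_wpM2l//.
      apply: le_trans (nrmD (ltW r0) (@conv_var _ _ r j) (convN (cc j))) _.
      rewrite nrm_var lerD2l; apply: le_trans (nt j).
      apply: le_trans (nrm_comp r0 (ltW s10) (ct1 j) c2 c3).
      by rewrite /nrm; under eq_fun do rewrite normrN.
    rewrite -mulr_suml.
    have h1 : C * s1 * K <= 1 / 2.
      rewrite mulrAC -ler_pdivlMl ?mulr_gt0//.
      have : s1 <= (2 * C * K)^-1 by rewrite ge_min lexx orbT.
      by rewrite -mulrA invfM mulrC mul1r.
    have h2 : \sum_j `|P i j| <= C.
      rewrite /C [X in _ <= 1 + X](bigD1 i)//= addrCA lerDl addr_ge0// sumr_ge0// => k _.
      by rewrite sumr_ge0.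
    apply: (@le_trans _ _ (C * (r + s1 ^+ 2 * K))).
      have h3 : 0 <= s1 ^+ 2 * K by rewrite mulr_ge0 ?exprn_ge0// ltW.
      by rewrite ler_wpM2r// addr_ge0// ltW.
    have -> : C * (r + s1 ^+ 2 * K) = s1 / 2 + s1 * (C * s1 * K).
      by rewrite /r; field; rewrite gt_eqF.
    rewrite [X in _ <= X](splitr s1) lerD2l ler_wpM2l ?(ltW s10)//.
    by move: h1; rewrite mul1r.
have causal m psi psi' : Inv psi -> Inv psi' ->
    (forall i b, (mdegree b < m)%N -> psi i b = psi' i b) ->
    forall i b, (mdegree b <= m)%N -> T psi i b = T psi' i b.
  move=> h h' e i b bm; apply: eq_bigr => j _; congr (_ * (_ - _)).
  apply: (agree_comp (m := m)) => // k; split; [by have [] := h k|by have [] := h' k|].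
  by move=> a; rewrite !addn1 ltnS; exact: e.
pose it k := iter k T (fun _ _ => 0).
have Inv0 : Inv (it 0%N).
  have z : (fun b : multi_index n => `|(0:R)| * r ^+ mdegree b) = (fun=> 0).
    by apply/funext => b; rewrite normr0 mul0r.
  move=> i; split=> //.
    by rewrite /conv; under eq_fun do rewrite mul0r; exact: absum0.
  by rewrite /nrm z tsum0 ltW.
have InvI k : Inv (it k) by elim: k => [//|k IH]; exact: (InvT _ IH).
have stab1 k i b : (mdegree b < k)%N -> it k i b = it k.+1 i b.
  elim: k i b => [//|k IH] i b bk.
  by apply: (causal k _ _ (InvI k) (InvI k.+1)) => // j a ak; exact: IH.
have stab k l i b : (mdegree b < k)%N -> (k <= l)%N -> it k i b = it l i b.
  move=> bk; elim: l => [|l IH]; first by rewrite leqn0 => /eqP ->.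
  rewrite leq_eqVlt => /orP[/eqP->//|]; rewrite ltnS => kl.
  by rewrite IH// stab1// (leq_trans bk).
pose psi i b := it (mdegree b).+1 i b.
have psiE k i b : (mdegree b < k)%N -> psi i b = it k i b.
  by move=> bk; exact: stab.
(* Finitely many coefficients of the limit all belong to a single iterate, whose norm is at most
   s1. *)
have fine_psi i : absum (fun b => psi i b * r ^+ mdegree b) /\
    tsum (fun b => `|psi i b * r ^+ mdegree b|) <= s1.
  apply: absum_bound => X.
  pose m := (\max_(b <- X) mdegree b).+1.
  have [_ ci ni] := InvI m i.
  apply: le_trans ni.
  have := sum_le_tsum X ci; rewrite /nrm.
  have E (w : multi_index n -> R) : (fun a => `|w a * r ^+ mdegree a|) =
      (fun a => `|w a| * r ^+ mdegree a).
    by apply/funext => a; rewrite normrM (ger0_norm (exprn_ge0 _ (ltW r0))).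
  rewrite E; apply: le_trans; rewrite le_eqVlt; apply/orP; left; apply/eqP.
  apply: eq_big_seq => b bX; rewrite (psiE m)//.
  by rewrite ltnS (big_rem b)//= leq_maxl.
have Ipsi : Inv psi.
  move=> i; have [cp np] := fine_psi i; split=> //.
    by apply/ord1P; rewrite (psiE 1%N) ?mdegree0//; have [h _ _] := InvI 1%N i; rewrite h ?mdegree0.
  apply: le_trans np; rewrite /nrm le_eqVlt; apply/orP; left; apply/eqP.
  by congr tsum; apply/funext => a; rewrite normrM (ger0_norm (exprn_ge0 _ (ltW r0))).
exists psi; split.
- by move=> i; exists r => //; have [] := Ipsi i.
- by move=> i; have [] := Ipsi i.
- move=> i b; rewrite -/(T psi i b) (causal (mdegree b) psi (it (mdegree b)))//.
  by move=> j a; exact: psiE.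
Qed.

(** With Theta(z) = Q z + theta(z), the solution of psi = P (x - theta(psi)) satisfies Theta(psi(x))
    = x because Q P = 1. *)
Lemma right_inverse n (P Q : 'M[R]_n) (Theta : 'I_n -> multi_index n -> R) :
  P *m Q = 1%:M -> (forall i, germ (Theta i)) -> (forall i, ord 1 (Theta i)) ->
  (forall i j, Theta i (dl j) = Q i j) ->
  exists psi : 'I_n -> multi_index n -> R,
  [/\ forall i, germ (psi i), forall i, ord 1 (psi i),
      forall i j, psi i (dl j) = P i j &
      \forall x \near (0 : 'cV[R]_n), evs Theta (evs psi x) = x].
Proof.
move=> PQ gT oT linT.
have QP : Q *m P = 1%:M by exact: mulmx1C.
have gt i : germ (tail2 (Theta i)) by exact: germ_tail2.
have [psi [gp op psiE]] := solve_fixpoint P gt (fun i => ord_tail2 (Theta i)).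
exists psi; split; [exact: gp|exact: op| |].
  move=> i j; rewrite psiE.
  under eq_bigr => k _.
    rewrite (ord_comp (ord_tail2 (Theta k)) op) ?mdegree_dl// subr0 /fvar (inj_eq (@dl_inj n)).
    over.
  by rewrite (bigD1 j)//= eqxx mulr1 big1 ?addr0// => k /negPf; rewrite eq_sym => ->; rewrite mulr0.
have [r r0 cT] := germ_fin gT.
have T2 : \forall z \near (0 : 'cV[R]_n), evs Theta z = Q *m z + evs (fun i => tail2 (Theta i)) z.
  apply/near0P; exists r => // z zr; apply/colP => i.
  rewrite !mxE (ev_tail2 (ltW r0) (cT i) zr) (ord1P _).1// add0r; congr (_ + _).
  by apply: eq_bigr => j _; rewrite linT.
have gc j : germ (comp (tail2 (Theta j)) psi) by exact: germ_comp.
have gb j : germ (fun b => fvar R j b - comp (tail2 (Theta j)) psi b).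
  apply: germD; first exact: germ_var.
  by have [t t0 ctj] := gc j; exists t => //; exact: convN.
have pE : \forall x \near (0 : 'cV[R]_n),
    evs psi x = P *m (x - evs (fun i => tail2 (Theta i)) (evs psi x)).
  have [t t0 ctj] := germ_fin gc.
  have hc : \forall x \near (0 : 'cV[R]_n), forall j,
      ev (comp (tail2 (Theta j)) psi) x = ev (tail2 (Theta j)) (evs psi x).
    by apply: near_all => j; exact: near_ev_comp (gt j) gp op.
  have hb : \forall x \near (0 : 'cV[R]_n), inbox t x.
    by apply/near0P; exists t.
  apply: filterS2 hc hb => x hc xt; apply/colP => i.
  rewrite !mxE [X in ev X _](_ : _ = (fun b => \sum_j P i j *
     (fvar R j b + -1 * comp (tail2 (Theta j)) psi b))); last first.
    by apply/funext => b; rewrite psiE; apply: eq_bigr => j _; rewrite mulN1r.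
  have cN j : conv t (fun b => -1 * comp (tail2 (Theta j)) psi b) by exact: convZ.
  have cS j : conv t (fun b => fvar R j b + -1 * comp (tail2 (Theta j)) psi b).
    by apply: convD => //; exact: conv_var.
  rewrite (ev_sum _ (ltW t0) _ xt); last by move=> j; exact: convZ.
  apply: eq_bigr => j _; rewrite (evZ _ (ltW t0) (cS j) xt) !mxE; congr (_ * _).
  rewrite (evD (ltW t0) (@conv_var _ _ t j) (cN j) xt) ev_var.
  by rewrite (evZ _ (ltW t0) (ctj j) xt) mulN1r hc.
have T2' := near_evs gp op T2.
apply: filterS2 T2' pE => x -> h; rewrite {1}h mulmxA QP mul1mx.
by rewrite subrK.
Qed.

Lemma local_inverse n (P Q : 'M[R]_n) (Theta : 'I_n -> multi_index n -> R) :
  P *m Q = 1%:M -> (forall i, germ (Theta i)) -> (forall i, ord 1 (Theta i)) ->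
  (forall i j, Theta i (dl j) = Q i j) ->
  exists psi : 'I_n -> multi_index n -> R,
  [/\ forall i, germ (psi i), forall i, ord 1 (psi i),
      forall i j, psi i (dl j) = P i j,
      \forall x \near (0 : 'cV[R]_n), evs Theta (evs psi x) = x &
      \forall z \near (0 : 'cV[R]_n), evs psi (evs Theta z) = z].
Proof.
move=> PQ gT oT linT.
have [psi [gp op linp Tp]] := right_inverse PQ gT oT linT.
(* psi has in turn a right inverse chi. Evaluating Theta(psi(u)) = u at u = chi(z) gives Theta = chi
   near 0, so psi is a two-sided inverse. *)
have [chi [gc oc linc pc]] := right_inverse (mulmx1C PQ) gp op linp.
exists psi; split; [exact: gp|exact: op|exact: linp|exact: Tp|].
have Tpc := near_evs gc oc Tp.
by apply: filterS2 pc Tpc => z pc; rewrite pc => ->.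
Qed.

End Inverse.

(** * Coercive normal form of the linear part *)

Section LinearAlgebra.
Variable R : realType.
Local Notation toC := (real_complex R).

Definition quad m (M : 'M[R]_m) (y : 'rV[R]_m) : R := (y *m M *m y^T) 0 0.

Definition sqn m (y : 'rV[R]_m) : R := (y *m y^T) 0 0.

Lemma sqnE m (y : 'rV[R]_m) : sqn y = \sum_k y 0 k ^+ 2.
Proof. by rewrite /sqn mxE; apply: eq_bigr => k _; rewrite mxE. Qed.

Lemma sqn_ge0 m (y : 'rV[R]_m) : 0 <= sqn y.
Proof. by rewrite sqnE sumr_ge0// => k _; rewrite sqr_ge0. Qed.

Lemma sqn_le0 m (y : 'rV[R]_m) : sqn y <= 0 -> y = 0.
Proof.
move=> y0; apply/rowP => k; rewrite mxE; apply/eqP; rewrite -sqrf_eq0 eq_le sqr_ge0 andbT.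
apply: le_trans y0; rewrite sqnE (bigD1 k)//= lerDl sumr_ge0// => i _; exact: sqr_ge0.
Qed.

Definition coercive m (M : 'M[R]_m) (b : R) := forall y, b * sqn y <= quad M y.

(** Coercivity depends on the basis, since [quad] sees only the symmetric part of a matrix; a
    positive spectrum guarantees it only up to similarity. *)
Definition similar_coercive m (M : 'M[R]_m) := exists G G' : 'M[R]_m, exists b : R,
  [/\ 0 < b, G *m G' = 1%:M & coercive (G *m M *m G') b].

Definition spectrum_pos m (M : 'M[R]_m) :=
  forall z, root (map_poly toC (char_poly M)) z -> 0 < complex.Re z.

Lemma bilinear_bound k p (M : 'M[R]_(p, k)) :
  exists2 C, 0 <= C & forall a b, `|(b *m M *m a^T) 0 0| <= C * (sqn a + sqn b).
Proof.
exists (\sum_i \sum_j `|M i j|); first by rewrite sumr_ge0// => i _; rewrite sumr_ge0.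
move=> a b.
have -> : (b *m M *m a^T) 0 0 = \sum_i \sum_j b 0 i * M i j * a 0 j.
  rewrite mxE exchange_big; apply: eq_bigr => j _; rewrite mxE mulr_suml.
  by apply: eq_bigr => i _; rewrite mxE.
apply: le_trans (ler_norm_sum _ _ _) _; rewrite mulr_suml; apply: ler_sum => i _.
apply: le_trans (ler_norm_sum _ _ _) _; rewrite mulr_suml; apply: ler_sum => j _.
rewrite !normrM mulrAC mulrC ler_wpM2l//.
have ha : a 0 j ^+ 2 <= sqn a.
  by rewrite sqnE (bigD1 j)//= lerDl sumr_ge0// => l _; exact: sqr_ge0.
have hb : b 0 i ^+ 2 <= sqn b.
  by rewrite sqnE (bigD1 i)//= lerDl sumr_ge0// => l _; exact: sqr_ge0.
apply: le_trans (lerD ha hb).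
rewrite -[a 0 j ^+ 2]real_normK ?num_real// -[b 0 i ^+ 2]real_normK ?num_real//.
have := normr_ge0 (a 0 j); have := normr_ge0 (b 0 i).
set s := `|_|; set t := `|_| => s0 t0; nra.
Qed.

Lemma quad_lblock k p (T : 'M[R]_k) (M : 'M[R]_(p, k)) (B : 'M[R]_p) a b :
  quad (block_mx T 0 M B) (row_mx a b) = quad T a + (b *m M *m a^T) 0 0 + quad B b.
Proof.
rewrite /quad mul_row_block tr_row_mx mul_row_col mulmx0 add0r mulmxDl.
by rewrite [LHS]mxE; congr (_ + _); rewrite mxE.
Qed.

Lemma sqn_row_mx k p (a : 'rV[R]_k) (b : 'rV[R]_p) : sqn (row_mx a b) = sqn a + sqn b.
Proof. by rewrite /sqn tr_row_mx mul_row_col mxE. Qed.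

(** The off-diagonal block can spoil coercivity only by its size. Half of min(s, t) is kept as r,
    and e makes the cross term at most r (|a|^2 + |b|^2). *)
Lemma coercive_lblock k p (T : 'M[R]_k) (M : 'M[R]_(p, k)) (B : 'M[R]_p) s t :
  0 < s -> 0 < t -> coercive T s -> coercive B t ->
  exists e r, [/\ 0 < e, 0 < r & coercive (block_mx T 0 (e *: M) B) r].
Proof.
move=> s0 t0 cT cB; have [C C0 hC] := bilinear_bound M.
pose r := Order.min s t / 2.
have m0 : 0 < Order.min s t by rewrite lt_min s0.
have r0 : 0 < r by rewrite divr_gt0.
pose e := r / (1 + C).
have C1 : 0 < 1 + C by rewrite ltr_pwDl.
have e0 : 0 < e by rewrite divr_gt0.
exists e, r; split=> // y; rewrite -[y]hsubmxK; set a := lsubmx y; set b := rsubmx y.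
rewrite quad_lblock sqn_row_mx -scalemxAr -scalemxAl mxE.
have h1 : r + r <= s by rewrite -splitr ge_min lexx.
have h2 : r + r <= t by rewrite -splitr ge_min lexx orbT.
have h3 : e * C <= r by rewrite /e mulrAC ler_pdivrMr// ler_wpM2l ?(ltW r0)// lerDr.
have := cT a; have := cB b; have := hC a b; rewrite ler_norml => /andP[h4 _].
have a0 := sqn_ge0 a; have b0 := sqn_ge0 b.
have h5 : - (r * (sqn a + sqn b)) <= e * (b *m M *m a^T) 0 0.
  rewrite lerNl -mulrN; apply: (@le_trans _ _ (e * (C * (sqn a + sqn b)))).
    by rewrite ler_wpM2l ?(ltW e0)// lerNl.
  by rewrite mulrA ler_wpM2r// addr_ge0.
have h6 : (r + r) * sqn a <= s * sqn a by rewrite ler_wpM2r.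
have h7 : (r + r) * sqn b <= t * sqn b by rewrite ler_wpM2r.
move: h5 h6 h7; rewrite mulrDr !mulrDl; lra.
Qed.

Lemma similar_coercive_conj m (S S' M : 'M[R]_m) : S *m S' = 1%:M ->
  similar_coercive (S *m M *m S') -> similar_coercive M.
Proof.
move=> SS' [G [G' [b [b0 GG' cM]]]]; exists (G *m S), (S' *m G'), b; split=> //.
  by rewrite mulmxA -(mulmxA G) SS' mulmx1.
by move: cM; rewrite !mulmxA.
Qed.

(** Conjugation by diag(1, e G) brings the lower diagonal block to coercive form and turns M into e
    G M, with e as small as desired. *)
Lemma similar_coercive_lblock k p (T : 'M[R]_k) (M : 'M[R]_(p, k)) (B : 'M[R]_p) s :
  0 < s -> coercive T s -> similar_coercive B -> similar_coercive (block_mx T 0 M B).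
Proof.
move=> s0 cT [G [G' [t [t0 GG' cB]]]].
have [e [r [e0 r0 cr]]] := coercive_lblock (G *m M) s0 t0 cT cB.
exists (block_mx 1%:M 0 0 (e *: G)), (block_mx 1%:M 0 0 (e^-1 *: G')), r; split=> //.
  rewrite mulmx_block !mulmx0 !mul0mx mulmx1 !addr0 add0r.
  by rewrite -scalemxAl -scalemxAr scalerA divff ?gt_eqF// scale1r GG' -scalar_mx_block.
rewrite !mulmx_block !(mulmx0, mul0mx, mul1mx, mulmx1, addr0, add0r).
by rewrite -!scalemxAl -scalemxAr scalerA divff ?gt_eqF// scale1r.
Qed.

Lemma char_poly_lblock k p (T : 'M[R]_k) (M : 'M[R]_(p, k)) (B : 'M[R]_p) :
  char_poly (block_mx T 0 M B) = char_poly T * char_poly B.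
Proof.
rewrite /char_poly /char_poly_mx map_block_mx raddf0 scalar_mx_block opp_block_mx add_block_mx.
by rewrite oppr0 addr0 det_lblock.
Qed.

Lemma char_poly_conj m (S S' M : 'M[R]_m) : S *m S' = 1%:M ->
  char_poly (S *m M *m S') = char_poly M.
Proof.
move=> SS'.
have e : map_mx polyC S *m map_mx polyC S' = 1%:M by rewrite -map_mxM SS' map_mx1.
have -> : char_poly (S *m M *m S') =
    \det (map_mx polyC S *m char_poly_mx M *m map_mx polyC S').
  rewrite /char_poly /char_poly_mx !map_mxM mulmxBr mulmxBl.
  by rewrite mul_mx_scalar -scalemxAl e scalemx1.
by rewrite !det_mulmx mulrAC -det_mulmx e det1 mul1r.
Qed.

Lemma spectrum_pos_conj m (S S' M : 'M[R]_m) : S *m S' = 1%:M ->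
  spectrum_pos M -> spectrum_pos (S *m M *m S').
Proof. by move=> SS' h z; rewrite char_poly_conj//; exact: h. Qed.

Lemma spectrum_pos_lblock k p (T : 'M[R]_k) (M : 'M[R]_(p, k)) (B : 'M[R]_p) :
  spectrum_pos (block_mx T 0 M B) -> spectrum_pos B.
Proof.
move=> h z zB; apply: h; rewrite char_poly_lblock rmorphM /= rootM zB orbT //.
Qed.

(** In the Gaussian decomposition of [W], the last p rows of the invertible matrix [row_ebase W]
    complete the rows of [W] to a basis. *)
Lemma row_free_extend k p (W : 'M[R]_(k, k + p)) : row_free W ->
  exists W' : 'M[R]_(p, k + p), col_mx W W' \in unitmx.
Proof.
move=> /eqP rW; have := mulmx_ebase W; rewrite rW.
set C := col_ebase W; set E := row_ebase W => e.
have uE : E \in unitmx by exact: row_ebase_unit.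
have uC : C \in unitmx by exact: col_ebase_unit.
exists (dsubmx E).
have -> : col_mx W (dsubmx E) = block_mx C 0 0 1%:M *m E.
  rewrite -[in RHS](vsubmxK E) mul_block_col !mul0mx mul1mx addr0 add0r.
  congr col_mx; rewrite -e pid_mx_row -[in LHS](vsubmxK E) -mulmxA.
  by rewrite mul_row_col mul1mx mul0mx addr0.
rewrite unitmx_mul uE andbT unitmxE det_ublock det1 mulr1.
by rewrite -unitmxE.
Qed.

Lemma invariant_subspace k p (B : 'M[R]_(k + p)) (W : 'M[R]_(k, k + p)) T :
  row_free W -> W *m B = T *m W ->
  exists (S S' : 'M[R]_(k + p)) (M : 'M[R]_(p, k)) (B' : 'M[R]_p),
    S *m S' = 1%:M /\ S *m B *m S' = block_mx T 0 M B'.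
Proof.
move=> /row_free_extend[W' uS] WB; set S := col_mx W W' in uS.
pose X := S *m B *m invmx S.
exists S, (invmx S), (dlsubmx X), (drsubmx X); rewrite mulmxV//; split=> //.
rewrite -/X -[LHS]submxK; congr block_mx.
  have : usubmx X = row_mx T 0.
    rewrite /X /S mul_col_mx WB mul_col_mx col_mxKu.
    have -> : T *m W = row_mx T 0 *m S by rewrite mul_row_col mul0mx addr0.
    by rewrite -mulmxA mulmxV// mulmx1.
  by rewrite /ulsubmx => ->; rewrite row_mxKl.
have : usubmx X = row_mx T 0.
  rewrite /X /S mul_col_mx WB mul_col_mx col_mxKu.
  have -> : T *m W = row_mx T 0 *m S by rewrite mul_row_col mul0mx addr0.
  by rewrite -mulmxA mulmxV// mulmx1.
by rewrite /ursubmx => ->; rewrite row_mxKr.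
Qed.

(** x and y are the real and imaginary parts of a complex left eigenvector, so their span is a real
    invariant subspace. *)
Lemma complex_eigenvector m (B : 'M[R]_m.+1) : exists (al om : R) (x y : 'rV[R]_m.+1),
  [/\ root (map_poly toC (char_poly B)) (Complex al om),
      x *m B = al *: x - om *: y, y *m B = om *: x + al *: y & (x != 0) || (y != 0)].
Proof.
have : size (char_poly (map_mx toC B)) != 1%N by rewrite size_char_poly.
move=> /closed_rootP[z zr]; have := zr; rewrite -eigenvalue_root_char => /eigenvalueP[v vB v0].
pose x : 'rV[R]_m.+1 := \row_j complex.Re (v 0 j).
pose y : 'rV[R]_m.+1 := \row_j complex.Im (v 0 j).
exists (complex.Re z), (complex.Im z), x, y.
have H j : (x *m B) 0 j = (complex.Re z *: x - complex.Im z *: y) 0 j /\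
           (y *m B) 0 j = (complex.Im z *: x + complex.Re z *: y) 0 j.
  have /matrixP/(_ 0 j) := vB; rewrite !mxE.
  have -> : \sum_k v 0 k * map_mx toC B k j =
     Complex (\sum_k x 0 k * B k j) (\sum_k y 0 k * B k j).
    transitivity (\sum_k Complex (x 0 k * B k j) (y 0 k * B k j)).
      apply: eq_bigr => k _; rewrite !mxE; case: (v 0 k) => a b /=.
      by apply/eqP; rewrite eq_complex /= !mulr0 subr0 add0r !eqxx.
    elim: (index_enum _) => [|k s IH]; first by rewrite !big_nil.
    by rewrite !big_cons IH.
  by case: z {vB zr} => a b; case: (v 0 j) => c d [-> ->]; split => //; rewrite addrC.
split.
- by rewrite map_char_poly; case: z zr {vB H}.
- by apply/rowP => j; exact: (H j).1.
- by apply/rowP => j; exact: (H j).2.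
- apply: contraNT v0; rewrite negb_or !negbK => /andP[/eqP/rowP x0 /eqP/rowP y0].
  apply/eqP/rowP => j; have := x0 j; have := y0 j; rewrite !mxE.
  by case: (v 0 j) => a b /= -> ->.
Qed.

(** Induction on the dimension, splitting off a real eigenvector if there is one and otherwise the
    plane spanned by the two parts of a complex eigenvector. The quadratic form of the new diagonal
    block is the real part of an eigenvalue times |v|^2. *)
Lemma spectrum_pos_similar_coercive m (B : 'M[R]_m) : spectrum_pos B -> similar_coercive B.
Proof.
have [N mN] := ubnP m; elim: N => // N IH in m B mN *.
case: m B mN => [|m] B mN pB.
  exists 0, 0, 1; split=> //; first by rewrite [LHS]flatmx0 [RHS]flatmx0.
  by move=> y; rewrite [y]thinmx0 /sqn /quad !mul0mx !mxE mulr0.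
have step1 (w : 'rV[R]_m.+1) mu : w != 0 -> w *m B = mu *: w -> similar_coercive B.
  move=> w0 wB.
  have fw : row_free (w : 'M_(1, 1 + m)).
    by rewrite /row_free rank_rV w0.
  have wB' : w *m B = mu%:M *m w by rewrite wB mul_scalar_mx.
  have [S [S' [M [B' [SS' e]]]]] := @invariant_subspace 1 m B w mu%:M fw wB'.
  have pE := spectrum_pos_conj SS' pB; rewrite e in pE.
  apply: (similar_coercive_conj SS'); rewrite e.
  have mu0 : 0 < mu.
    apply: (pE (toC mu)); rewrite char_poly_lblock rmorphM /= rootM; apply/orP; left.
    rewrite /root horner_map /= /char_poly det_mx11 !mxE !eqxx hornerD hornerN !mulr1n.
    by rewrite hornerX hornerC subrr rmorph0.
  apply: (@similar_coercive_lblock 1 m _ _ _ mu) => //.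
    by move=> y; rewrite /quad mul_mx_scalar -scalemxAl mxE.
  by apply: IH; [lia|exact: spectrum_pos_lblock pE].
have [al [om [x [y [rz xB yB xy]]]]] := complex_eigenvector B.
case: (pselect (exists2 w : 'rV[R]_m.+1, w != 0 & exists mu, w *m B = mu *: w)).
  by move=> [w w0 [mu]]; exact: step1.
move=> noreal.
have y0 : y != 0.
  apply/negP => /eqP y0; apply: noreal; exists x; first by move: xy; rewrite y0 eqxx orbF.
  by exists al; rewrite xB y0 scaler0 subr0.
(* In the absence of real eigenvectors, a linear relation between x and y would make y one. *)
have indep (a b : R) : a *: x + b *: y = 0 -> a = 0 /\ b = 0.
  have [->|a0] := eqVneq a 0.
    rewrite scale0r add0r => /eqP; rewrite scaler_eq0 (negPf y0) orbF => /eqP ->//.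
  move=> /eqP; rewrite addr_eq0 => /eqP e; exfalso; apply: noreal; exists y => //.
  have ex : x = - (a^-1 * b) *: y.
    by rewrite -[LHS](scalerK a0) e scalerN scalerA scaleNr.
  by exists (om * - (a^-1 * b) + al); rewrite yB {1}ex scalerA -scalerDl.
case: m B mN pB x y step1 rz xB yB xy noreal y0 indep => [|m] B mN pB x y step1 rz xB yB xy noreal y0 indep.
  (* In dimension 1 two vectors are always dependent, so this case is contradictory. *)
  have h : y 0 0 *: x + - x 0 0 *: y = 0.
    by apply/rowP => j; rewrite !ord1 !mxE mulNr mulrC subrr.
  have [hy _] := indep _ _ h.
  by move/eqP: y0; case; apply/rowP => j; rewrite !ord1 mxE.
pose W : 'M[R]_(1 + 1, 2 + m) := col_mx x y.
pose T : 'M[R]_(1 + 1) := block_mx al%:M (- om)%:M om%:M al%:M.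
have fW : row_free W.
  apply: inj_row_free => v; rewrite -[v]hsubmxK mul_row_col.
  rewrite [lsubmx v]mx11_scalar [rsubmx v]mx11_scalar !mul_scalar_mx => /indep[-> ->].
  by rewrite !raddf0 row_mx0.
have WB : W *m B = T *m W.
  by rewrite mul_col_mx mul_block_col !mul_scalar_mx xB yB scaleNr.
have [S [S' [M [B' [SS' e]]]]] := @invariant_subspace 2 m B W T fW WB.
have pE := spectrum_pos_conj SS' pB; rewrite e in pE.
apply: (similar_coercive_conj SS'); rewrite e.
apply: (@similar_coercive_lblock (1 + 1) m _ _ _ al).
- exact: pB rz.
- move=> v; rewrite -[v]hsubmxK [lsubmx v]mx11_scalar [rsubmx v]mx11_scalar.
  set a := lsubmx v 0 0; set b := rsubmx v 0 0.
  rewrite /quad /sqn mul_row_block tr_row_mx !mul_row_col !tr_scalar_mx -!scalar_mxM.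
  rewrite -!raddfD /= -!scalar_mxM -!raddfD /= !mxE !eqxx !mulr1n.
  by rewrite le_eqVlt; apply/orP; left; apply/eqP; ring.
- by apply: IH; [lia|exact: spectrum_pos_lblock pE].
Qed.

End LinearAlgebra.

Section NormalForm.
Variable R : realType.
Local Notation toC := (real_complex R).

Lemma coercive_unitmx m (B : 'M[R]_m) b : 0 < b -> coercive B b -> B \in unitmx.
Proof.
move=> b0 cB; rewrite -row_free_unit; apply: inj_row_free => v vB.
apply: sqn_le0; rewrite -(pmulr_rle0 _ b0); apply: le_trans (cB v) _.
by rewrite /quad vB mul0mx mxE.
Qed.

(** A left null vector of [A] gives the block form with rows (0, 0) and (M, B). Since B is
    invertible, some K satisfies B K = M, and a shear by K removes M. [L'] is the inverse of the
    block of [L], bordered by zeros. *)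
Lemma coercive_normal_form n (A : 'M[R]_n.+1) (lam : 'I_n.+1 -> R[i]) :
  eigenvalue_list A lam -> lam ord0 = 0 ->
  (forall i, i != ord0 -> 0 < complex.Re (lam i)) ->
  exists (P Q L L' : 'M[R]_n.+1) (b : R),
  [/\ [/\ P *m Q = 1%:M, Q *m A *m P = L & 0 < b],
      (forall j, L 0 j = 0 /\ L j 0 = 0), (forall j, L' 0 j = 0),
      L *m L' = 1%:M - delta_mx 0 0 /\ L' *m L = 1%:M - delta_mx 0 0 &
      forall y : 'I_n.+1 -> R,
        b * \sum_(k | k != ord0) y k ^+ 2 <= \sum_k \sum_l L k l * y k * y l].
Proof.
move=> lamE lam00 lam_pos.
have lamE' : map_poly toC (char_poly A) = \prod_i ('X - (lam i)%:P).
  by rewrite map_char_poly.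
have r0 : root (char_poly A) 0.
  rewrite -(fmorph_root toC) lamE' rmorph0 /root horner_prod (bigD1 ord0)//=.
  by rewrite hornerXsubC lam00 subrr mul0r.
move: r0; rewrite -eigenvalue_root_char => /eigenvalueP[w wA w0].
have fw : row_free (w : 'M_(1, 1 + n)) by rewrite /row_free rank_rV w0.
have wA' : w *m A = (0 : 'M_1) *m w by rewrite wA scale0r mul0mx.
have [S [S' [M [B [SS' e]]]]] := @invariant_subspace R 1 n A w 0 fw wA'.
have cpE : char_poly A = 'X * char_poly B.
  rewrite -(char_poly_conj A SS') e (@char_poly_lblock R 1 n); congr (_ * _).
  by rewrite /char_poly det_mx11 !mxE eqxx mulr1n subr0.
(* Cancelling the factor X in the characteristic polynomial of [A] leaves for B exactly the [lam i]
   with i nonzero. *)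
have pB : spectrum_pos B.
  have : map_poly toC (char_poly B) = \prod_(i | i != ord0) ('X - (lam i)%:P).
    apply: (mulfI (x := 'X)); first by rewrite polyX_eq0.
    rewrite -[X in X * _ = _](map_polyX toC) -rmorphM /= -cpE lamE' (bigD1 ord0)//= lam00.
    by rewrite subr0.
  move=> h z; rewrite h /root horner_prod => /prodf_eq0[i i0].
  by rewrite hornerXsubC subr_eq0 => /eqP ->; exact: lam_pos.
have [G [G' [b [b0 GG' cB]]]] := spectrum_pos_similar_coercive pB.
have G'G : G' *m G = 1%:M by exact: mulmx1C.
have [B2 B2E] : exists B2, B2 = G *m B *m G' by exists (G *m B *m G').
rewrite -B2E in cB.
have uB2 : B2 \in unitmx by exact: coercive_unitmx cB.
have BE : B = G' *m B2 *m G by rewrite B2E !mulmxA G'G mul1mx -mulmxA G'G mulmx1.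
pose K := G' *m invmx B2 *m G *m M.
have BK : B *m K = M.
  rewrite BE /K !mulmxA -(mulmxA _ G G') GG' mulmx1 -(mulmxA _ B2) mulmxV// mulmx1.
  by rewrite G'G mul1mx.
pose Q : 'M[R]_(1 + n) := block_mx 1%:M 0 (G *m K) G *m S.
pose P : 'M[R]_(1 + n) := S' *m block_mx 1%:M 0 (- K) G'.
have QP : Q *m P = 1%:M.
  rewrite /Q /P mulmxA -(mulmxA _ S S') SS' mulmx1 mulmx_block.
  rewrite !(mulmx0, mul0mx, mul1mx, mulmx1, addr0, add0r) GG' mulmxN subrr.
  by rewrite -scalar_mx_block.
pose L : 'M[R]_(1 + n) := block_mx 0 0 0 B2.
pose L' : 'M[R]_(1 + n) := block_mx 0 0 0 (invmx B2).
have QAP : Q *m A *m P = L.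
  rewrite /Q /P !mulmxA -(mulmxA _ S A) -(mulmxA _ (S *m A) S') e !mulmx_block.
  rewrite !(mulmx0, mul0mx, mul1mx, mulmx1, addr0, add0r) mulmxN -(mulmxA G B K) BK subrr.
  by rewrite /L B2E.
have D : (1%:M - delta_mx 0 0 : 'M[R]_(1 + n)) = block_mx 0 0 0 1%:M.
  apply/matrixP => k j; rewrite -[k]fintype.splitK -[j]fintype.splitK.
  case: (fintype.split k) => i'; case: (fintype.split j) => j' /=;
    rewrite ?(block_mxEul, block_mxEur, block_mxEdl, block_mxEdr) !mxE ?ord1 ?subrr ?subr0//.
have z0 : (0 : 'I_n.+1) = lshift n (0 : 'I_1) by exact: val_inj.
exists P, Q, L, L', b; split.
- by split=> //; exact: mulmx1C.
- move=> j; rewrite z0 -(@fintype.splitK 1 n j).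
  case: (@fintype.split 1 n j) => j' /=; split.
  + by rewrite [LHS]block_mxEul mxE.
  + by rewrite [LHS]block_mxEul mxE.
  + by rewrite [LHS]block_mxEur mxE.
  + by rewrite [LHS]block_mxEdl mxE.
- move=> j; rewrite z0 -(@fintype.splitK 1 n j).
  case: (@fintype.split 1 n j) => j' /=.
    by rewrite [LHS]block_mxEul mxE.
  by rewrite [LHS]block_mxEur mxE.
- rewrite D; split; rewrite [LHS](@mulmx_block _ 1 n 1 n 1 n).
    by rewrite !(mulmx0, mul0mx, addr0, add0r) mulmxV.
  by rewrite !(mulmx0, mul0mx, addr0, add0r) mulVmx.
- move=> y.
  have -> : \sum_k \sum_l L k l * y k * y l = quad L (\row_k y k).
    rewrite /quad mxE exchange_big; apply: eq_bigr => l _; rewrite mxE mulr_suml.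
    by apply: eq_bigr => k _; rewrite !mxE; ring.
  set v := \row_k y k; rewrite -[v](@hsubmxK _ 1 1 n).
  rewrite quad_lblock /quad !mulmx0 !mul0mx ![(0 : 'M_1) 0 0]mxE !add0r.
  apply: le_trans (cB _); rewrite ler_wpM2l ?(ltW b0)// sqnE.
  rewrite big_mkcond big_ord_recl eqxx /= add0r le_eqVlt; apply/orP; left; apply/eqP.
  apply: eq_bigr => k _; rewrite !mxE; congr (y _ ^+ 2); exact: val_inj.
Qed.

End NormalForm.

(** * The weighted inner product and the homological operator *)

Section Weights.
Variables (R : realType) (n : nat).
Local Notation mi := (multi_index n.+1).
Implicit Types a b c : mi.

(** The degree in y, that is, in all variables but the first; it is 0 exactly for the powers of the
    axis variable. *)
Definition yd c : nat := (\sum_(k < n.+1 | k != ord0) c k)%N.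

Lemma mdegree_yd c : mdegree c = (c ord0 + yd c)%N.
Proof. by rewrite /mdegree /yd (bigD1 ord0). Qed.

Lemma ydD a b : yd (a + b) = (yd a + yd b)%N.
Proof. by rewrite /yd -big_split; apply: eq_bigr => k _; rewrite ffunE. Qed.

Lemma yd_dl k : yd (dl k) = (k != ord0).
Proof.
have := mdegree_yd (dl k); rewrite mdegree_dl ffunE eq_sym.
by case: eqVneq => _ /=; lia.
Qed.

Lemma leq_yd c k : k != ord0 -> (c k <= yd c)%N.
Proof. by move=> k0; rewrite /yd (bigD1 k)//= leq_addr. Qed.

Lemma addmi_dl c k i : (c + dl k) i = (c i + (i == k))%N.
Proof. by rewrite !ffunE. Qed.

(* With i = c_0, j the degree in the other variables and m = i + j, this is the Fischer
   weight (prod_{k > 0} c_k!) / j! times (i! j! / m!)^2; the second factor makes the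
   derivation [d_0] followed by multiplication with [x_k], k > 0, bounded by j + 1. *)
Definition wt c : R :=
  (\prod_(k < n.+1 | k != ord0) ((c k)`!)%:R) * ((c ord0)`!)%:R ^+ 2 * ((yd c)`!)%:R
  / ((mdegree c)`!)%:R ^+ 2.

Lemma factR_gt0 m : 0 < (m`!)%:R :> R.
Proof. by rewrite ltr0n fact_gt0. Qed.

Lemma wt_gt0 c : 0 < wt c.
Proof.
rewrite /wt divr_gt0 ?exprn_gt0 ?factR_gt0// !mulr_gt0 ?exprn_gt0 ?factR_gt0//.
by apply: prodr_gt0 => k _; exact: factR_gt0.
Qed.

Lemma wt_dlS c k : k != ord0 ->
  wt (c + dl k) = (c k).+1%:R * (yd c).+1%:R / (mdegree c).+1%:R ^+ 2 * wt c.
Proof.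
move=> k0; rewrite /wt mdegreeD mdegree_dl addn1 ydD yd_dl k0 addn1 !factS !natrM.
rewrite (bigD1 k)//= [in RHS](bigD1 k)//= !addmi_dl eqxx addn1 factS natrM.
rewrite eq_sym (negPf k0) addn0 (eq_bigr (fun i => ((c i)`!)%:R)); last first.
  by move=> i /andP[_ /negPf ik]; rewrite addmi_dl ik addn0.
have m0 := factR_gt0 (mdegree c); have m1 : 0 < (mdegree c).+1%:R :> R by rewrite ltr0n.
by field; rewrite !gt_eqF//.
Qed.

Lemma wt_dl0 c :
  wt (c + dl ord0) = (c ord0).+1%:R ^+ 2 / (mdegree c).+1%:R ^+ 2 * wt c.
Proof.
rewrite /wt mdegreeD mdegree_dl addn1 ydD yd_dl eqxx addn0 !factS !natrM.
rewrite !addmi_dl eqxx addn1 factS natrM.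
rewrite (eq_bigr (fun i => ((c i)`!)%:R)); last first.
  by move=> i /negPf ik; rewrite addmi_dl ik addn0.
have m0 := factR_gt0 (mdegree c); have m1 : 0 < (mdegree c).+1%:R :> R by rewrite ltr0n.
by field; rewrite !gt_eqF//.
Qed.

(** What remains of the weight of c + [dl k], k > 0, after removal of c_k + 1. That it does not
    depend on k turns the weighted pairing into the quadratic form of a matrix. *)
Definition wtU c : R := (yd c).+1%:R / (mdegree c).+1%:R ^+ 2 * wt c.

Lemma wtU_ge0 c : 0 <= wtU c.
Proof. by rewrite /wtU mulr_ge0 ?(ltW (wt_gt0 _))// divr_ge0// exprn_ge0. Qed.

Lemma wtUE c k : k != ord0 -> wt (c + dl k) = (c k).+1%:R * wtU c.
Proof. by move=> k0; rewrite wt_dlS// /wtU !mulrA. Qed.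

Lemma wt_dl_le c k : wt (c + dl k) <= wt c.
Proof.
rewrite -[X in _ <= X]mul1r.
have m1 : 0 < (mdegree c).+1%:R ^+ 2 :> R by rewrite exprn_gt0// ltr0n.
have [->|k0] := eqVneq k ord0.
  rewrite wt_dl0 ler_wpM2r ?(ltW (wt_gt0 _))// ler_pdivrMr// mul1r -!natrX ler_nat.
  by rewrite leq_exp2r// ltnS leq_mdegree.
rewrite wt_dlS// ler_wpM2r ?(ltW (wt_gt0 _))// ler_pdivrMr// mul1r -natrM -natrX ler_nat.
rewrite -mulnn leq_mul// ltnS ?leq_mdegree// mdegree_yd; lia.
Qed.

Lemma wtD_le a b : wt (a + b) <= wt b.
Proof.
have [m am] := ubnP (mdegree a); elim: m => // m IH in a am *.
have [->|/mi_neq0P[k ak]] := eqVneq a 0; first by rewrite add0r.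
rewrite -(mi_predK ak) addrAC; apply: le_trans (wt_dl_le _ _) _; apply: IH.
by have := congr1 (@mdegree _) (mi_predK ak); rewrite mdegreeD mdegree_dl; lia.
Qed.

Lemma yd_gt0P a : (0 < yd a)%N -> exists2 k, k != ord0 & (0 < a k)%N.
Proof.
move=> ya; apply: contrapT => h.
suff : yd a = 0%N by lia.
rewrite /yd big1// => k k0; apply/eqP; rewrite -leqn0 leqNgt; apply/negP => ak.
by apply: h; exists k.
Qed.

(* The operators [u |-> x^a d_l u] lose no more than the factor [yd (a + b)],
   which is recovered by inverting the homological operator. *)
Lemma wt_shift a b l : (0 < yd a)%N ->
  (b l).+1%:R ^+ 2 * wt (a + b) <= (yd (a + b))%:R ^+ 2 * wt (b + dl l).
Proof.
move=> /yd_gt0P[k k0 ak]; rewrite -(mi_predK ak); set a' := mi_pred a k.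
(* A single y-variable x_k of x^a is kept to offset the derivative; the rest of x^a does not
   increase the weight. *)
have h : wt (a' + dl k + b) <= wt (b + dl k).
  by rewrite -addrA [dl k + b]addrC; exact: wtD_le.
apply: le_trans (ler_wpM2l (exprn_ge0 2 (ler0n _ _)) h) _.
have U0 := wtU_ge0 b.
apply: (@le_trans _ _ ((yd b).+1%:R ^+ 2 * wt (b + dl l))); last first.
  rewrite ler_wpM2r ?(ltW (wt_gt0 _))// -!natrX ler_nat leq_exp2r// !ydD yd_dl k0; lia.
rewrite wtUE//; have [->|l0] := eqVneq l ord0.
  have -> : (yd b).+1%:R ^+ 2 * wt (b + dl ord0) =
     (b ord0).+1%:R ^+ 2 * ((yd b).+1%:R * wtU b).
    by rewrite wt_dl0 /wtU; ring.
  by rewrite ler_wpM2l ?exprn_ge0// ler_wpM2r// ler_nat ltnS leq_yd.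
rewrite wtUE//; move: (wtU b) U0 => U U0; rewrite !mulrA ler_wpM2r// -!natrX -!natrM ler_nat.
have := leq_yd b l0; have := leq_yd b k0; nia.
Qed.

(** Multinomial coefficients of degree m are at most p^m. The induction rests on m! being the sum of
    c_k (m - 1)! over k, as m is the sum of the c_k. *)
Lemma fact_mdegree_le p (c : multi_index p) :
  ((mdegree c)`! <= p ^ mdegree c * \prod_k (c k)`!)%N.
Proof.
have [m cm] := ubnP (mdegree c); elim: m => // m IH in c cm *.
case e : (mdegree c) cm => [|d] cm; first by rewrite expn0 mul1n prodn_gt0// => k; exact: fact_gt0.
have H k : (c k * d`! <= c k * (p ^ d * \prod_k0 (mi_pred c k k0)`!))%N.
  have [->//|ck] := posnP (c k).
  have pk := congr1 (@mdegree _) (mi_predK ck); rewrite mdegreeD mdegree_dl e addn1 in pk.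
  rewrite leq_mul2l; apply/orP; right.
  by have := IH (mi_pred c k); rewrite (_ : mdegree _ = d); [apply; lia|lia].
have K k : (c k * (p ^ d * \prod_k0 (mi_pred c k k0)`!) <= p ^ d * \prod_k (c k)`!)%N.
  rewrite mulnCA leq_mul2l; apply/orP; right.
  rewrite (bigD1 k)//= [X in (_ <= X)%N](bigD1 k)//= mulnA ffunE eqxx subn1.
  rewrite (eq_bigr (fun i => (c i)`!)); last first.
    by move=> i /negPf ik; rewrite ffunE ik subn0.
  by case: (c k) => [|q] //=; rewrite factS.
rewrite factS -{1}e {1}/mdegree big_distrl /=.
apply: (@leq_trans (\sum_(k < p) p ^ d * \prod_k0 (c k0)`!)).
  by apply: leq_sum => k _; exact: leq_trans (H k) (K k).
by rewrite sum_nat_const card_ord expnS mulnA.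
Qed.

Lemma fact_add_le i j : ((i + j)`! <= 2 ^ (i + j) * (i`! * j`!))%N.
Proof.
have := fact_mdegree_le ([ffun k : 'I_2 => if k == ord0 then i else j]).
by rewrite /mdegree !big_ord_recl !big_ord0 !ffunE /= addn0 muln1.
Qed.

(** The weight decays at most geometrically: the multinomial bound applies to all exponents and the
    binomial one to the splitting into c_0 and [yd c]. Weighted estimates thus yield geometric
    bounds on coefficients. *)
Lemma wt_lower c : 1 <= (2 * n.+1)%:R ^+ mdegree c * wt c.
Proof.
have h1 := fact_mdegree_le c; have h2 := fact_add_le (c ord0) (yd c).
rewrite -mdegree_yd in h2.
have M0 : 0 < ((mdegree c)`!)%:R ^+ 2 :> R by rewrite exprn_gt0// factR_gt0.
rewrite /wt mulrA ler_pdivlMr// mul1r.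
rewrite -natr_prod -!natrX -!natrM ler_nat -mulnn.
apply: leq_trans (leq_mul h1 h2) _; rewrite (bigD1 ord0)//= expnMn -mulnn.
by rewrite leq_eqVlt; apply/orP; left; apply/eqP; move: (2 ^ _)%N (n.+1 ^ _)%N (\prod_(_ < _ | _) _)%N => x y z; ring.
Qed.

End Weights.

(** * The homological operator on homogeneous polynomials *)

Section HomologicalOperator.
Variables (R : realType) (n : nat) (Lam : 'M[R]_n.+1) (beta : R).
Local Notation mi := (multi_index n.+1).
Implicit Types a b c : mi.
Hypothesis beta0 : 0 < beta.
Hypothesis Lam_row0 : forall j, Lam 0 j = 0.
Hypothesis Lam_col0 : forall j, Lam j 0 = 0.
Hypothesis Lam_coercive : forall y : 'I_n.+1 -> R,
  beta * \sum_(k | k != ord0) y k ^+ 2 <= \sum_k \sum_l Lam k l * y k * y l.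

Definition slice m : seq mi := [seq c <- mlow n.+1 m | mdegree c == m].

Lemma mem_slice m c : (c \in slice m) = (mdegree c == m).
Proof. by rewrite mem_filter andb_idr// => /eqP <-; exact: mem_mlow. Qed.

Lemma slice_uniq m : uniq (slice m).
Proof. by rewrite filter_uniq// mlow_uniq. Qed.

Lemma big_slice_dl m l (g : mi -> R) :
  \sum_(c <- slice m.+1 | (0 < c l)%N) g c = \sum_(b <- slice m) g (b + dl l).
Proof.
rewrite -[RHS](big_map (fun b => b + dl l) xpredT g) -[LHS]big_filter; apply: perm_big.
apply: uniq_perm; first exact/filter_uniq/slice_uniq.
  by rewrite map_inj_uniq ?slice_uniq//; exact: mi_addI.
move=> c; rewrite mem_filter mem_slice; apply/andP/mapP => [[cl /eqP cm]|[b]].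
  exists (mi_pred c l); last by rewrite mi_predK.
  rewrite mem_slice; have := congr1 (@mdegree _) (mi_predK cl).
  by rewrite mdegreeD mdegree_dl cm addn1 => -[->].
rewrite mem_slice => /eqP bm ->; rewrite addmi_dl eqxx addn1 mdegreeD mdegree_dl bm.
by rewrite addn1.
Qed.

(* [Lop h] is the derivative of [h] along the linear vector field [x |-> Lam x]. *)
Definition Lop (h : mi -> R) : mi -> R := fun c =>
  \sum_k \sum_l Lam k l * (if (0 < c l)%N then pd k h (mi_pred c l) else 0).

Lemma Lop_yd0 h c : yd c = 0%N -> Lop h c = 0.
Proof.
move=> c0; rewrite /Lop big1// => k _; rewrite big1// => l _.
have [->|l0] := eqVneq l ord0; first by rewrite Lam_col0 mul0r.
have := leq_yd c l0; rewrite c0 leqn0 => /eqP ->.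
by rewrite mulr0.
Qed.

(** The shift c = b + [dl l] rewrites the pairing as the sum over b of [wtU b] times the quadratic
    form of [Lam] at the gradient coefficients of h. Coercivity applies for each b, and shifting
    back turns the squares of the derivatives into the factor [yd c]. *)
Lemma fischer m h :
  beta * \sum_(c <- slice m) (yd c)%:R * wt R c * h c ^+ 2 <=
  \sum_(c <- slice m) wt R c * Lop h c * h c.
Proof.
case: m => [|m].
  rewrite !big_seq !big1 ?mulr0// => c; rewrite mem_slice mdegree_eq0 => /eqP ->.
    by rewrite Lop_yd0 ?mulr0 ?mul0r// /yd big1// => k _; rewrite ffunE.
  by rewrite (_ : yd 0 = 0%N) ?mul0r// /yd big1// => k _; rewrite ffunE.
have -> : \sum_(c <- slice m.+1) wt R c * Lop h c * h c =
    \sum_(b <- slice m) wtU R b * (\sum_k \sum_l Lam k l * pd k h b * pd l h b).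
  transitivity (\sum_k \sum_l \sum_(c <- slice m.+1 | (0 < c l)%N)
      Lam k l * (wt R c * h c * pd k h (mi_pred c l))).
    under eq_bigr => c _.
      rewrite /Lop mulrAC mulr_sumr.
      under eq_bigr do rewrite mulr_sumr.
      over.
    rewrite exchange_big; apply: eq_bigr => k _.
    rewrite exchange_big; apply: eq_bigr => l _.
    rewrite [RHS]big_mkcond; apply: eq_bigr => c _.
    by case: ifP => _; [ring|rewrite !mulr0].
  under [RHS]eq_bigr => b _.
    rewrite mulr_sumr.
    under eq_bigr do rewrite mulr_sumr.
    over.
  rewrite [RHS]exchange_big; apply: eq_bigr => k _.
  rewrite [RHS]exchange_big; apply: eq_bigr => l _.
  rewrite big_slice_dl; apply: eq_bigr => b _; rewrite mi_addK.
  have [->|l0] := eqVneq l ord0; first by rewrite Lam_col0 !mul0r mulr0.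
  by rewrite wtUE// /pd; ring.
apply: (@le_trans _ _ (\sum_(b <- slice m) wtU R b *
    (beta * \sum_(k | k != ord0) pd k h b ^+ 2))); last first.
  by apply: ler_sum => b _; rewrite ler_wpM2l ?wtU_ge0.
rewrite le_eqVlt; apply/orP; left; apply/eqP.
under [RHS]eq_bigr => b _ do rewrite mulrCA mulr_sumr.
rewrite -mulr_sumr; congr (_ * _).
rewrite exchange_big /=.
transitivity (\sum_(k < n.+1 | k != ord0) \sum_(c <- slice m.+1 | (0 < c k)%N)
    (c k)%:R * wt R c * h c ^+ 2); last first.
  apply: eq_bigr => k k0; rewrite big_slice_dl; apply: eq_bigr => b _.
  by rewrite addmi_dl eqxx addn1 wtUE// /pd; ring.
under [RHS]eq_bigr => k _ do rewrite big_mkcond.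
rewrite exchange_big /=; apply: eq_bigr => c _.
rewrite /yd natr_sum !mulr_suml; apply: eq_bigr => k _.
by case: posnP => [->|//]; rewrite !mul0r.
Qed.

Lemma Lop_inj m h : (forall c, mdegree c = m -> Lop h c = 0) ->
  forall c, mdegree c = m -> (0 < yd c)%N -> h c = 0.
Proof.
move=> Lh c cm yc; have := fischer m h.
rewrite [X in _ <= X]big_seq [X in _ <= X]big1; last first.
  by move=> d; rewrite mem_slice => /eqP/Lh ->; rewrite mulr0 mul0r.
rewrite pmulr_rle0// => h0; apply/eqP; rewrite -sqrf_eq0 eq_le sqr_ge0 andbT.
have yw : 0 < (yd c)%:R * wt R c by rewrite mulr_gt0 ?wt_gt0// ltr0n.
rewrite -(pmulr_rle0 _ yw); apply: le_trans h0.
rewrite [X in _ <= X](bigD1_seq c) ?slice_uniq//=; last by rewrite mem_slice cm.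
rewrite lerDl sumr_ge0// => d _; rewrite mulr_ge0 ?sqr_ge0// mulr_ge0//.
exact: ltW (wt_gt0 _ _).
Qed.

(** [Lop] preserves the degree and the y-degree, because row 0 and column 0 of [Lam] vanish. *)
Lemma Lop_local (h h' : mi -> R) c :
  (forall a, mdegree a = mdegree c -> yd a = yd c -> h a = h' a) -> Lop h c = Lop h' c.
Proof.
move=> hh; apply: eq_bigr => k _; apply: eq_bigr => l _.
have [->|l0] := eqVneq l ord0; first by rewrite Lam_col0 !mul0r.
have [->|k0] := eqVneq k ord0; first by rewrite Lam_row0 !mul0r.
congr (_ * _); case: ifP => // cl; rewrite /pd; congr (_ * _).
have e := mi_predK cl.
have d1 := congr1 (@mdegree _) e; have d2 := congr1 (@yd n) e.
rewrite mdegreeD mdegree_dl in d1; rewrite ydD yd_dl l0 in d2.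
by apply: hh; rewrite ?mdegreeD ?mdegree_dl ?ydD ?yd_dl ?k0.
Qed.

Lemma Lop_sum (K : Type) (s : seq K) (v : K -> R) (u : K -> mi -> R) c :
  Lop (fun a => \sum_(i <- s) v i * u i a) c = \sum_(i <- s) v i * Lop (u i) c.
Proof.
rewrite /Lop.
under [RHS]eq_bigr => i _.
  rewrite mulr_sumr; under eq_bigr do rewrite mulr_sumr; over.
rewrite [RHS]exchange_big; apply: eq_bigr => k _.
rewrite [RHS]exchange_big; apply: eq_bigr => l _.
case: ifP => _; last by rewrite mulr0 big1// => i _; rewrite !mulr0.
rewrite /pd !mulr_sumr; apply: eq_bigr => i _; ring.
Qed.

(** The monomials of degree m and positive y-degree span a finite-dimensional space, on which
    injectivity gives surjectivity; [M] is the matrix of [Lop] there. *)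
Lemma Lop_surj m (g : mi -> R) : exists h : mi -> R,
  forall c, mdegree c = m -> (0 < yd c)%N -> Lop h c = g c.
Proof.
pose s := [seq c <- slice m | (0 < yd c)%N].
have us : uniq s by rewrite filter_uniq// slice_uniq.
have ms c : (c \in s) = (0 < yd c)%N && (mdegree c == m) by rewrite mem_filter mem_slice.
pose N := size s; pose e (i : 'I_N) := nth 0 s i.
have es i : e i \in s by rewrite mem_nth.
have ei i j : (e i == e j) = (i == j) by rewrite nth_uniq.
pose u (i : 'I_N) : mi -> R := fun c => (c == e i)%:R.
pose M : 'M[R]_N := \matrix_(i, j) Lop (u i) (e j).
have vE (v : 'rV[R]_N) j : (v *m M) 0 j =
    Lop (fun a => \sum_(i <- index_enum 'I_N) v 0 i * u i a) (e j).
  by rewrite Lop_sum mxE; apply: eq_bigr => i _; rewrite mxE.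
have uM : M \in unitmx.
  rewrite -row_free_unit; apply: inj_row_free => v vM0; apply/rowP => j; rewrite mxE.
  have := es j; rewrite ms => /andP[yj /eqP mj].
  have := Lop_inj (h := fun a => \sum_i v 0 i * u i a) _ mj yj.
  rewrite (bigD1 j)//= /u eqxx mulr1 big1 ?addr0; last first.
    by move=> i /negPf ij; rewrite ei eq_sym ij mulr0.
  apply=> c cm; case: (posnP (yd c)) => yc; first exact: Lop_yd0.
  have cs : c \in s by rewrite ms yc cm eqxx.
  have ci : (index c s < N)%N by rewrite index_mem.
  have := vE v (Ordinal ci); rewrite vM0 mxE /e /= nth_index// => /esym; exact.
pose v := (\row_j g (e j)) *m invmx M.
exists (fun a => \sum_i v 0 i * u i a) => c cm yc.
have cs : c \in s by rewrite ms yc cm eqxx.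
have ci : (index c s < N)%N by rewrite index_mem.
have := vE v (Ordinal ci); rewrite mulmxKV// mxE /e /= nth_index// => /esym; exact.
Qed.

End HomologicalOperator.

(** * First integrals of vector fields vanishing on the axis *)

Section FirstIntegral.
Variables (R : realType) (n : nat) (Lam : 'M[R]_n.+1) (beta : R).
Local Notation mi := (multi_index n.+1).
Implicit Types a b c : mi.
Hypothesis beta0 : 0 < beta.
Hypothesis Lam_row0 : forall j, Lam 0 j = 0.
Hypothesis Lam_col0 : forall j, Lam j 0 = 0.
Hypothesis Lam_coercive : forall y : 'I_n.+1 -> R,
  beta * \sum_(k | k != ord0) y k ^+ 2 <= \sum_k \sum_l Lam k l * y k * y l.

Lemma sum_uniq_le_tsum (I : choiceType) (s : seq I) (u : I -> R) : uniq s -> absum u ->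
  \sum_(i <- s) `|u i| <= tsum (fun i => `|u i|).
Proof.
move=> us su; pose v i := if i \in s then `|u i| else 0.
have vs i : v i != 0 -> i \in s by rewrite /v; case: ifP => //; rewrite eqxx.
rewrite (_ : \sum_(i <- s) _ = \sum_(i <- s) v i); last first.
  by apply: eq_big_seq => i i_s; rewrite /v i_s.
rewrite -(tsum_fin us vs); apply: ler_tsum; [exact: absum_fin vs|exact: absum_norm|].
by move=> i; rewrite /v; case: ifP.
Qed.

Lemma mul_var (u : mi -> R) j c :
  mul (fvar R j) u c = if (0 < c j)%N then u (mi_pred c j) else 0.
Proof.
rewrite mulE; case: posnP => [cj|cj].
  rewrite big_seq big1// => -[a b]; rewrite mem_mpairs /= => /eqP abc.
  rewrite /fvar; case: eqVneq => [aj|]; last by rewrite mul0r.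
  by move: cj; rewrite -abc aj addrC addmi_dl eqxx addn1.
have m : (dl j, mi_pred c j) \in mpairs c by rewrite mem_mpairs /= addrC mi_predK.
rewrite (bigD1_seq _ m (mpairs_uniq c)) /= /fvar eqxx mul1r.
rewrite big_seq_cond big1 ?addr0// => -[a b] /=; rewrite mem_mpairs /= => /andP[/eqP abc ne].
case: eqVneq => [aj|]; last by rewrite mul0r.
case/negP: ne; rewrite xpair_eqE aj eqxx /= -abc aj.
by rewrite [dl j + b]addrC mi_addK.
Qed.

Lemma mul_Lop (G : 'I_n.+1 -> mi -> R) (h : mi -> R) c :
  \sum_l mul (fun a => \sum_j Lam l j * fvar R j a + G l a) (pd l h) c =
  Lop Lam h c + \sum_l mul (G l) (pd l h) c.
Proof.
rewrite /Lop -big_split; apply: eq_bigr => l _ /=.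
rewrite !mulE.
under [LHS]eq_bigr do rewrite mulrDl.
rewrite big_split; congr (_ + _) => /=.
under eq_bigr do rewrite mulr_suml.
rewrite exchange_big; apply: eq_bigr => j _.
under eq_bigr do rewrite -mulrA.
by rewrite -mulr_sumr -mulE mul_var.
Qed.

(** For a fixed sum c the first index determines the pair, so no term is counted twice. *)
Lemma sum_mpairs_fst_le (c : mi) (u : mi -> R) : absum u ->
  \sum_(p <- mpairs c) `|u p.1| <= tsum (fun a => `|u a|).
Proof.
move=> su; rewrite -(big_map fst xpredT (fun a => `|u a|)); apply: sum_uniq_le_tsum => //.
rewrite map_inj_in_uniq ?mpairs_uniq// => -[a b] [a' b'].
rewrite !mem_mpairs /= => /eqP <- /eqP e aa; rewrite aa in e *; congr (_, _).
by apply: (@mi_addI _ a'); rewrite addrC -e addrC.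
Qed.

Definition dle m : seq mi := [seq a <- mlow n.+1 m | (mdegree a <= m)%N].

Lemma mem_dle m a : (a \in dle m) = (mdegree a <= m)%N.
Proof. by rewrite mem_filter andb_idr//; exact: mem_mlow. Qed.

Lemma big_slice_mpairs m (f : mi -> mi -> R) :
  \sum_(c <- slice n m) \sum_(p <- mpairs c) f p.1 p.2 =
  \sum_(a <- dle m) \sum_(b <- slice n (m - mdegree a)%N) f a b.
Proof.
transitivity (\sum_(p <- [seq p | c <- slice n m, p <- mpairs c]) f p.1 p.2).
  by rewrite big_allpairs_dep.
transitivity (\sum_(p <- [seq (a, b) | a <- dle m, b <- slice n (m - mdegree a)%N]) f p.1 p.2).
  apply: perm_big; apply: uniq_perm.
  - apply: allpairs_uniq_dep => [|c _|]; [exact: slice_uniq|exact: mpairs_uniq|].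
    move=> [c p] [c' p'] /allpairsPdep[d [q [_ + [-> ->]]]] /allpairsPdep[d' [q' [_ + [-> ->]]]] /=.
    by rewrite !mem_mpairs => /eqP <- /eqP <- ->.
  - apply: allpairs_uniq_dep => [|a _|]; [by rewrite filter_uniq// mlow_uniq|exact: slice_uniq|].
    by move=> [a b] [a' b'] _ _ /= [-> ->].
  - move=> [a b]; apply/allpairsPdep/allpairsPdep => -[].
      move=> c [p [+ + e]]; rewrite -e mem_mpairs mem_slice /= => /eqP cm /eqP abc.
      exists a, b; rewrite mem_dle mem_slice -cm -abc mdegreeD leq_addr addKn eqxx.
      by split.
    move=> a' [b' [+ + [-> ->]]]; rewrite mem_dle mem_slice => am /eqP bm.
    by exists (a' + b'), (a', b'); rewrite mem_slice mem_mpairs mdegreeD bm subnKC// !eqxx.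
by rewrite big_allpairs_dep.
Qed.

(** * Construction and convergence of the formal first integral *)

Section Construction.
Variable G : 'I_n.+1 -> mi -> R.
Hypothesis germG : forall l, germ (G l).
Hypothesis ordG : forall l, ord 2 (G l).
Hypothesis axisG : forall l a, yd a = 0%N -> G l a = 0.

Definition rhs (h : mi -> R) : mi -> R := fun c => - \sum_l mul (G l) (pd l h) c.

Lemma rhs_causal (h h' : mi -> R) m :
  (forall a, (mdegree a < m)%N -> h a = h' a) ->
  forall c, (mdegree c <= m)%N -> rhs h c = rhs h' c.
Proof.
move=> hh c cm; congr (- _); apply: eq_bigr => l _; rewrite !mulE.
apply: eq_big_seq => -[a b]; rewrite mem_mpairs /= => /eqP abc.
have := congr1 (@mdegree _) abc; rewrite mdegreeD => e.
case: (ltnP (mdegree a) 2) => a2; first by rewrite ordG// !mul0r.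
by rewrite /pd hh// mdegreeD mdegree_dl; lia.
Qed.

Lemma formal_solution : exists h : mi -> R,
  (forall c, yd c = 0%N -> h c = fvar R ord0 c) /\
  (forall c, (0 < yd c)%N -> Lop Lam h c = rhs h c).
Proof.
(* [restr] forgets all values that do not enter the equation in degree m, so the chosen solution
   depends on those data alone and the iteration is causal. *)
pose restr m (g : mi -> R) c := if (mdegree c == m) && (0 < yd c)%N then g c else 0.
have solP m g := cid (Lop_surj beta0 Lam_col0 Lam_coercive m g).
pose sol m g := sval (solP m g).
pose T h c := if yd c == 0%N then fvar R ord0 c else sol (mdegree c) (restr (mdegree c) (rhs h)) c.
have causal m h h' : (forall a, (mdegree a < m)%N -> h a = h' a) ->
    forall c, (mdegree c <= m)%N -> T h c = T h' c.
  move=> hh c cm; rewrite /T; case: ifP => // _; congr (sol _ _ _); apply/funext => d.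
  rewrite /restr; case: ifP => // /andP[/eqP dc _]; apply: (rhs_causal hh).
  by rewrite dc.
pose it k := iter k T (fun _ => 0).
have stab1 k c : (mdegree c < k)%N -> it k c = it k.+1 c.
  by elim: k c => [//|k IH] c ck; apply: (causal k) => // a ak; exact: IH.
have stab k l c : (mdegree c < k)%N -> (k <= l)%N -> it k c = it l c.
  move=> ck; elim: l => [|l IH]; first by rewrite leqn0 => /eqP ->.
  rewrite leq_eqVlt => /orP[/eqP->//|]; rewrite ltnS => kl.
  by rewrite IH// stab1// (leq_trans ck).
pose h c := it (mdegree c).+1 c.
have hT c : h c = T h c.
  rewrite [LHS]/h /=; apply: (causal (mdegree c)) => // a ac.
  by rewrite /h; apply/esym; exact: stab.
exists h; split=> c yc; first by rewrite hT /T yc eqxx.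
have -> : Lop Lam h c = Lop Lam (sol (mdegree c) (restr (mdegree c) (rhs h))) c.
  apply: (Lop_local Lam_row0 Lam_col0) => a ac ya.
  by rewrite hT /T ya (gtn_eqF yc) ac.
rewrite /sol; case: (solP _ _) => u /= ->//.
by rewrite /restr eqxx yc.
Qed.

(** [maxn 1] gives the axis monomials a positive weight as well: their derivative in x enters the
    estimates although their y-degree is 0. *)
Definition energy (h : mi -> R) m : R :=
  \sum_(c <- slice n m) (maxn 1 (yd c))%:R * wt R c * h c ^+ 2.

Lemma energy_summand_ge0 h c : 0 <= (maxn 1 (yd c))%:R * wt R c * h c ^+ 2.
Proof. by rewrite mulr_ge0 ?sqr_ge0// mulr_ge0// ltW// wt_gt0. Qed.

Lemma energy_ge0 h m : 0 <= energy h m.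
Proof. by apply: sumr_ge0 => c _; exact: energy_summand_ge0. Qed.

(** G has order 2, so its norm is O(rho^2) and falls below beta rho for small rho. The factor |a| +
    1 is the loss incurred in [energy_step]; halving the radius absorbs it because |a| + 1 <=
    2^|a|. *)
Lemma choose_radius : exists2 rho : R, 0 < rho &
  (forall l, conv rho (fun a => (mdegree a).+1%:R * G l a)) /\
  \sum_l nrm rho (fun a => (mdegree a).+1%:R * G l a) <= beta * rho.
Proof.
have [s s0 cG] := germ_fin germG.
pose G' l a := (mdegree a).+1%:R * G l a.
have t0 : 0 < s / 2 by rewrite divr_gt0.
have cG' l : conv (s / 2) (G' l).
  apply: absum_le (absum_norm (cG l)) => a.
  rewrite /G' normrM normrM [X in _ <= X]normrM normr_nat mulrAC mulrC ler_wpM2l//.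
  rewrite !normrX (gtr0_norm t0) (gtr0_norm s0) expr_div_n mulrCA ler_piMr ?exprn_ge0 ?(ltW s0)//.
  rewrite ler_pdivrMr ?exprn_gt0// mul1r -natrX ler_nat.
  exact: ltn_expl.
pose N := 1 + \sum_l nrm (s / 2) (G' l).
have N0 : 0 < N by rewrite ltr_pwDl// sumr_ge0// => l _; rewrite nrm_ge0// ltW.
pose rho := Order.min (s / 2) (beta * (s / 2) ^+ 2 / N).
have r0 : 0 < rho by rewrite lt_min t0 divr_gt0// mulr_gt0// exprn_gt0.
have rs : rho <= s / 2 by rewrite ge_min lexx.
exists rho => //; split=> [l|]; first exact: conv_le (ltW r0) rs (cG' l).
apply: (@le_trans _ _ (\sum_l (rho / (s / 2)) ^+ 2 * nrm (s / 2) (G' l))).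
  apply: ler_sum => l _; apply: nrm_ord (ltW r0) rs t0 (cG' l) _ => a a2.
  by rewrite /G' ordG// mulr0.
rewrite -mulr_sumr; apply: (@le_trans _ _ ((rho / (s / 2)) ^+ 2 * N)).
  by rewrite ler_wpM2l ?sqr_ge0// lerDr.
rewrite expr_div_n mulrAC ler_pdivrMr ?exprn_gt0//.
have : rho * (rho * N) <= rho * (beta * (s / 2) ^+ 2).
  by rewrite ler_wpM2l ?(ltW r0)// -ler_pdivlMr// ge_min lexx orbT.
by move: (s / 2) => u; lra.
Qed.

(** Let Y be the left-hand side. Pairing the equation with h, [fischer] bounds 2 beta Y by twice the
    pairing of [rhs] with h, which splits in two. One part is at most beta Y, since the sums of the
    [g l] add up to at most beta, and is absorbed; the other involves only lower energies and is at
    most beta C / rho^(2m). *)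
Lemma energy_step h rho C m : 0 < rho ->
  (forall l, conv rho (fun a => (mdegree a).+1%:R * G l a)) ->
  \sum_l nrm rho (fun a => (mdegree a).+1%:R * G l a) <= beta * rho ->
  (forall c, (0 < yd c)%N -> Lop Lam h c = rhs h c) ->
  0 <= C -> (1 < m)%N ->
  (forall k, (k < m)%N -> energy h k <= C / rho ^+ (2 * k)) ->
  \sum_(c <- slice n m) (yd c)%:R * wt R c * h c ^+ 2 <= C / rho ^+ (2 * m).
Proof.
move=> r0 cG' sG' hL C0 m1 IH.
pose G' l a := (mdegree a).+1%:R * G l a.
pose g l a := `|G' l a| * rho ^+ mdegree a / rho.
set Y := \sum_(c <- _) _.
pose e c := (maxn 1 (yd c))%:R * wt R c * h c ^+ 2.
have e0 c : 0 <= e c by exact: energy_summand_ge0.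
have Y0 : 0 <= Y.
  by apply: sumr_ge0 => c _; rewrite mulr_ge0 ?sqr_ge0// mulr_ge0// ltW// wt_gt0.
have g0 l a : 0 <= g l a by rewrite /g divr_ge0 ?(ltW r0)// mulr_ge0// exprn_ge0// ltW.
have G'0 l a : yd a = 0%N -> G' l a = 0 by move=> ya; rewrite /G' axisG// mulr0.
have G'2 l a : (mdegree a < 2)%N -> G' l a = 0 by move=> a2; rewrite /G' ordG// mulr0.
have sg l : absum (g l) /\ tsum (g l) = nrm rho (G' l) / rho.
  have h1 := conv_abs (ltW r0) (cG' l).
  have E : g l = (fun a => rho^-1 * (`|G' l a| * rho ^+ mdegree a)).
    by apply/funext => a; rewrite /g mulrC.
  by rewrite E; split; [exact: absumZ|rewrite tsumZ// mulrC].
have tg : \sum_l tsum (g l) <= beta.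
  under eq_bigr do rewrite (sg _).2.
  by rewrite -mulr_suml ler_pdivrMr.
have gnorm l : (fun a => `|g l a|) = g l by apply/funext => a; rewrite ger0_norm.
(* The weighted AM-GM inequality with weight rho^(|a| - 1). *)
have term l c p : (0 < yd c)%N -> p.1 + p.2 = c ->
    2 * (wt R c * - (G l p.1 * pd l h p.2) * h c) <=
    g l p.1 * ((yd c)%:R * wt R c * h c ^+ 2) +
    `|G' l p.1| * rho / rho ^+ mdegree p.1 * e (p.2 + dl l).
  case: p => a b /= yc abc.
  have [Ga|Ga] := eqVneq (G l a) 0.
    rewrite Ga mul0r oppr0 mulr0 mul0r mulr0 addr_ge0// mulr_ge0//.
      by rewrite mulr_ge0 ?sqr_ge0// mulr_ge0// ltW// wt_gt0.
    by rewrite divr_ge0 ?mulr_ge0// ?exprn_ge0// ltW.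
  have ya : (0 < yd a)%N by rewrite lt0n; apply: contraNneq Ga => /axisG ->.
  have wc := wt_gt0 R c; have y0 : 0 < (yd c)%:R :> R by rewrite ltr0n.
  pose t := rho ^+ mdegree a / rho.
  have t0 : 0 < t by rewrite divr_gt0// exprn_gt0.
  have tV : rho / rho ^+ mdegree a = t^-1 by rewrite /t invf_div.
  have -> : g l a = `|G' l a| * t by rewrite /g /t mulrA.
  rewrite -(mulrA `|G' l a| rho) tV.
  have hG : `|G' l a| = (mdegree a).+1%:R * `|G l a| by rewrite /G' normrM normr_nat.
  (* [wt_shift] costs yd(c)^2. One factor yd(c) is left to cancel in the AM-GM inequality; the other
     is bounded through yd(a + b) <= (|a| + 1) max(1, yd(b + dl l)). *)
  have key : wt R c * pd l h b ^+ 2 <= (yd c)%:R * ((mdegree a).+1%:R * e (b + dl l)).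
    apply: (@le_trans _ _ ((yd c)%:R ^+ 2 * (wt R (b + dl l) * h (b + dl l) ^+ 2))).
      rewrite [X in X <= _](_ : _ = ((b l).+1%:R ^+ 2 * wt R c) * h (b + dl l) ^+ 2); last first.
        by rewrite /pd; ring.
      rewrite [X in _ <= X](_ : _ = ((yd c)%:R ^+ 2 * wt R (b + dl l)) * h (b + dl l) ^+ 2); last by ring.
      rewrite ler_wpM2r ?sqr_ge0//.
      by have := wt_shift R b l ya; rewrite abc.
    rewrite expr2 -(mulrA (yd c)%:R) ler_wpM2l ?(ltW y0)// /e.
    rewrite [X in _ <= X](_ : _ = ((mdegree a).+1 * maxn 1 (yd (b + dl l)))%:R *
      (wt R (b + dl l) * h (b + dl l) ^+ 2)); last by rewrite natrM; ring.
    apply: ler_wpM2r; first by rewrite mulr_ge0 ?sqr_ge0// ltW// wt_gt0.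
    rewrite ler_nat -abc !ydD yd_dl; have := mdegree_yd a.
    by case: (l != ord0) => /=; clear; nia.
  have e1 : 0 <= e (b + dl l) by exact: e0.
  have hx : h c ^+ 2 = `|h c| ^+ 2 by rewrite real_normK ?num_real.
  have hy : pd l h b ^+ 2 = `|pd l h b| ^+ 2 by rewrite real_normK ?num_real.
  rewrite hx hG; rewrite hy in key.
  apply: (@le_trans _ _ (2 * (wt R c * (`|G l a| * `|pd l h b|) * `|h c|))).
    rewrite ler_wpM2l// -normrM -normrN -(mulrA (wt R c)) -[X in _ <= X](mulrA (wt R c)).
    by rewrite ler_wpM2l ?(ltW wc)// -normrM ler_norm.
  move: key (normr_ge0 (h c)) (normr_ge0 (pd l h b)) (normr_ge0 (G l a)) e1 wc y0 t0.
  have : 1 <= (mdegree a).+1%:R :> R by rewrite ler1n.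
  move: (wt R c) (yd c)%:R (t) (mdegree a).+1%:R `|h c| `|pd l h b| `|G l a| (e _).
  move=> w d u q x y z f q1 key x0 yy0 z0 f0 w0 d0 u0.
  have amgm : 2 * (w * x * y) <= u * (d * w * x ^+ 2) + u^-1 * (w * y ^+ 2 / d).
    rewrite -subr_ge0.
    have -> : u * (d * w * x ^+ 2) + u^-1 * (w * y ^+ 2 / d) - 2 * (w * x * y) =
        w / (u * d) * (u * d * x - y) ^+ 2.
      by field; rewrite !gt_eqF.
    by rewrite mulr_ge0 ?sqr_ge0// divr_ge0 ?mulr_ge0// ltW.
  have k2 : u^-1 * (w * y ^+ 2 / d) <= u^-1 * (q * f).
    by rewrite ler_wpM2l ?invr_ge0 ?(ltW u0)// ler_pdivrMr// [X in _ <= X]mulrC.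
  have k3 : u * (d * w * x ^+ 2) <= q * (u * (d * w * x ^+ 2)).
    by rewrite ler_peMl// !mulr_ge0 ?sqr_ge0// ltW.
  have -> : 2 * (w * (z * y) * x) = z * (2 * (w * x * y)) by ring.
  have -> : q * z * u * (d * w * x ^+ 2) + q * z / u * f =
     z * (q * (u * (d * w * x ^+ 2)) + u^-1 * (q * f)) by ring.
  rewrite ler_wpM2l//; apply: le_trans amgm _.
  exact: lerD k3 k2.
have fis := fischer Lam_col0 Lam_coercive m h.
have B1 : 2 * \sum_(c <- slice n m) wt R c * Lop Lam h c * h c <=
    \sum_l \sum_(c <- slice n m) \sum_(p <- mpairs c)
      g l p.1 * ((yd c)%:R * wt R c * h c ^+ 2) +
    \sum_l \sum_(c <- slice n m) \sum_(p <- mpairs c)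
      `|G' l p.1| * rho / rho ^+ mdegree p.1 * e (p.2 + dl l).
  rewrite -big_split /=.
  under [X in _ <= X]eq_bigr do rewrite -big_split /=.
  rewrite exchange_big mulr_sumr; apply: ler_sum => c _.
  under [X in _ <= X]eq_bigr do rewrite -big_split /=.
  have sum0 : 0 <= \sum_l \sum_(p <- mpairs c)
     (g l p.1 * ((yd c)%:R * wt R c * h c ^+ 2) +
      `|G' l p.1| * rho / rho ^+ mdegree p.1 * e (p.2 + dl l)).
    apply: sumr_ge0 => l _; apply: sumr_ge0 => p _; rewrite addr_ge0// mulr_ge0//.
      by rewrite mulr_ge0 ?sqr_ge0// mulr_ge0// ltW// wt_gt0.
    by rewrite divr_ge0 ?mulr_ge0 ?exprn_ge0// ltW.
  case: (posnP (yd c)) => yc; first by rewrite (Lop_yd0 Lam_col0)// mulr0 mul0r mulr0.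
  rewrite hL// /rhs -sumrN mulr_sumr mulr_suml mulr_sumr; apply: ler_sum => l _.
  rewrite mulE -sumrN mulr_sumr mulr_suml mulr_sumr big_seq [X in _ <= X]big_seq.
  apply: ler_sum => p; rewrite mem_mpairs => /eqP; exact: term.
have B2 : \sum_l \sum_(c <- slice n m) \sum_(p <- mpairs c)
      g l p.1 * ((yd c)%:R * wt R c * h c ^+ 2) <= beta * Y.
  apply: (@le_trans _ _ (\sum_l tsum (g l) * Y)); last first.
    by rewrite -mulr_suml ler_wpM2r.
  apply: ler_sum => l _; rewrite mulr_sumr; apply: ler_sum => c _.
  rewrite -mulr_suml ler_wpM2r//.
    by rewrite mulr_ge0 ?sqr_ge0// mulr_ge0// ltW// wt_gt0.
  have := sum_mpairs_fst_le c (sg l).1; rewrite gnorm; apply: le_trans.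
  by rewrite le_eqVlt; apply/orP; left; apply/eqP; apply: eq_bigr => p _; rewrite ger0_norm.
have B3 : \sum_l \sum_(c <- slice n m) \sum_(p <- mpairs c)
      `|G' l p.1| * rho / rho ^+ mdegree p.1 * e (p.2 + dl l) <=
      beta * (C / rho ^+ (2 * m)).
  apply: (@le_trans _ _ (\sum_l tsum (g l) * (C / rho ^+ (2 * m)))); last first.
    by rewrite -mulr_suml ler_wpM2r// divr_ge0 ?exprn_ge0// ltW.
  apply: ler_sum => l _.
  rewrite (big_slice_mpairs m (fun a b => `|G' l a| * rho / rho ^+ mdegree a * e (b + dl l))).
  apply: (@le_trans _ _ (\sum_(a <- dle m) g l a * (C / rho ^+ (2 * m)))).
    rewrite big_seq [X in _ <= X]big_seq; apply: ler_sum => a; rewrite mem_dle => am.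
    case: (ltnP (mdegree a) 2) => a2.
      rewrite big1; first by apply: (mulr_ge0 (g0 l a)); rewrite divr_ge0 ?exprn_ge0 ?(ltW r0).
      by move=> b _; rewrite G'2// normr0 !mul0r.
    rewrite -mulr_sumr -(big_slice_dl _ l e).
    set k := (m - mdegree a)%N.
    have hk : \sum_(c <- slice n k.+1 | (0 < c l)%N) e c <= energy h k.+1.
      rewrite /energy [X in _ <= X](bigID (fun c : mi => (0 < c l)%N)) /= lerDl.
      by apply: sumr_ge0 => c _; exact: e0.
    have h1 : 0 <= `|G' l a| * rho / rho ^+ mdegree a.
      by rewrite divr_ge0 ?mulr_ge0 ?exprn_ge0// ltW.
    (* Here |a| >= 2 is used: b + [dl l] has degree m - |a| + 1, which is below m. *)
    have hm : (k.+1 < m)%N by rewrite /k; clear -a2 am; lia.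
    apply: le_trans (ler_wpM2l h1 (le_trans hk (IH _ hm))) _.
    rewrite le_eqVlt; apply/orP; left; apply/eqP.
    rewrite /g (_ : 2 * m = mdegree a + mdegree a + (2 * k))%N; last by rewrite /k; clear -a2 am; lia.
    rewrite (_ : 2 * k.+1 = 2 * k + 2)%N; last by rewrite mulnS addnC.
    rewrite !exprD; field.
    by rewrite !gt_eqF ?exprn_gt0.
  rewrite -mulr_suml ler_wpM2r ?divr_ge0 ?exprn_ge0 ?(ltW r0)//.
  have := sum_uniq_le_tsum (filter_uniq _ (mlow_uniq n.+1 m)) (sg l).1; rewrite gnorm.
  move=> /(_ (fun a => (mdegree a <= m)%N)); apply: le_trans.
  by rewrite le_eqVlt; apply/orP; left; apply/eqP; apply: eq_bigr => a _; rewrite ger0_norm.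
rewrite -(ler_pM2l beta0).
move: fis B1 B2 B3; rewrite -/Y; move: (\sum_(c <- slice n m) _) (\sum_l _) (\sum_l _).
move=> S1 S2 S3; lra.
Qed.

(** Over a box of exponents the sum factors into p geometric sums, each at most 2. *)
Lemma absum_geometric p : absum (fun c : multi_index p => (2^-1 : R) ^+ mdegree c).
Proof.
apply: (proj1 (absum_bound (M := 2 ^+ p) _)) => X.
have i0 : 0 <= (2^-1 : R) by rewrite invr_ge0.
pose K := (\max_(c <- X) mdegree c)%N.
under eq_bigr => c _ do rewrite ger0_norm ?exprn_ge0//.
apply: (@le_trans _ _ (\sum_(c <- mlow p K) (2^-1 : R) ^+ mdegree c)).
  rewrite (perm_big [seq c <- mlow p K | c \in X]).
    rewrite big_filter big_mkcond; apply: ler_sum => c _.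
    by case: ifP => // _; rewrite exprn_ge0.
  apply: uniq_perm; rewrite ?filter_uniq ?fset_uniq ?mlow_uniq// => c.
  rewrite mem_filter andb_idr// => cX; apply: mem_mlow.
  by rewrite /K (big_rem c)//= leq_maxl.
rewrite big_map big_enum /=.
rewrite (eq_bigr (fun f : {ffun 'I_p -> 'I_K.+1} => \prod_i (2^-1 : R) ^+ f i)); last first.
  by move=> f _; rewrite /mdegree -prodrXr; apply: eq_bigr => i _; rewrite ffunE.
rewrite -(bigA_distr_bigA (fun _ (j : 'I_K.+1) => (2^-1 : R) ^+ j)).
rewrite prodr_const card_ord lerXn2r ?nnegrE//; first by rewrite sumr_ge0// => j _; rewrite exprn_ge0.
have : \sum_(j < K.+1) (2^-1 : R) ^+ j = 2 - 2^-1 ^+ K.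
  elim: K => [|k IH]; first by rewrite big_ord1 !expr0; lra.
  by rewrite big_ord_recr /= IH exprS; lra.
by move=> ->; rewrite gerBl exprn_ge0.
Qed.

Lemma germ_geometric (u : mi -> R) M s : 0 < s ->
  (forall c, `|u c| <= M * s ^+ mdegree c) -> germ u.
Proof.
move=> s0 us; exists (2^-1 / s); first by rewrite divr_gt0// invr_gt0.
apply: absum_le (absumZ M (absum_geometric n.+1)) => c.
rewrite normrM [X in _ * X]ger0_norm; last by rewrite exprn_ge0// divr_ge0 ?invr_ge0// ltW.
apply: le_trans (ler_wpM2r _ (us c)) _.
  by rewrite exprn_ge0// divr_ge0 ?invr_ge0// ltW.
by rewrite -mulrA -exprMn [s * _]mulrC divfK ?gt_eqF.
Qed.

(** The energy is 0 in degree 0 and defines [C] in degree 1. In higher degrees the axis coefficients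
    of h are 0, so the energy is the sum bounded by [energy_step]. With [wt_lower], the coefficients
    of h grow at most geometrically. *)
Lemma axis_first_integral : exists h : mi -> R,
  [/\ germ h, h (dl ord0) = 1 &
      forall c, \sum_l mul (fun a => \sum_j Lam l j * fvar R j a + G l a) (pd l h) c = 0].
Proof.
have [h [h0 hL]] := formal_solution.
have [rho r0 [cG sG]] := choose_radius.
have N0 : 0 < (2 * n.+1)%:R :> R by rewrite ltr0n.
exists h; split; last 2 first.
- by rewrite h0 ?yd_dl// /fvar eqxx.
- move=> c.
  (* An index of y-degree 0 splits only into indices of y-degree 0, where all coefficients of the
     field vanish. *)
  case: (posnP (yd c)) => yc; last by rewrite mul_Lop hL// /rhs addNr.
  rewrite big1// => l _; rewrite mulE big_seq big1// => -[a b].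
  rewrite mem_mpairs /= => /eqP abc.
  have ya : yd a = 0%N by have := congr1 (@yd n) abc; rewrite ydD yc; lia.
  rewrite axisG// addr0 big1 ?mul0r// => j _.
  have [->|j0] := eqVneq j ord0; first by rewrite Lam_col0 mul0r.
  rewrite /fvar; case: eqVneq => [aj|]; last by rewrite mulr0.
  by rewrite aj yd_dl j0 in ya.
pose C := energy h 1 * rho ^+ 2.
have C0 : 0 <= C by rewrite mulr_ge0 ?energy_ge0// sqr_ge0.
have bound m : energy h m <= C / rho ^+ (2 * m).
  elim/ltn_ind: m => m IH; case: m IH => [|[|m]] IH.
  - rewrite /energy big_seq big1 ?divr_ge0 ?exprn_ge0 ?(ltW r0)// => c.
    rewrite mem_slice mdegree_eq0 => /eqP ->; rewrite h0.
      by rewrite /fvar eq_sym dl_neq0 expr0n /= mulr0.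
    by rewrite /yd big1// => k _; rewrite ffunE.
  - by rewrite /C muln1 mulfK// expf_neq0// gt_eqF.
  - apply: le_trans (energy_step r0 cG sG hL C0 _ IH) => //.
    rewrite /energy big_seq [X in _ <= X]big_seq; apply: ler_sum => c.
    rewrite mem_slice => /eqP cm; case: (posnP (yd c)) => yc.
      rewrite h0// /fvar; case: eqVneq => [cd|_]; last by rewrite expr0n /= !mulr0.
      by rewrite cd mdegree_dl in cm.
    by rewrite (maxn_idPr yc).
apply: (germ_geometric (M := 1 + C) (s := (2 * n.+1)%:R / rho)); first by rewrite divr_gt0.
move=> c; set m := mdegree c.
have s0 : 0 <= ((2 * n.+1)%:R / rho) ^+ m by rewrite exprn_ge0// divr_ge0// ltW.
rewrite -(ler_pXn2r (n := 2))// ?nnegrE ?mulr_ge0// ?addr_ge0// real_normK ?num_real//.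
have h1 : wt R c * h c ^+ 2 <= C / rho ^+ (2 * m).
  apply: le_trans (bound m); rewrite /energy (bigD1_seq c) ?slice_uniq ?mem_slice//=.
  apply: (@le_trans _ _ ((maxn 1 (yd c))%:R * wt R c * h c ^+ 2)).
    by rewrite -mulrA ler_peMl ?ler1n ?leq_maxl// mulr_ge0 ?sqr_ge0// ltW// wt_gt0.
  by rewrite lerDl sumr_ge0// => d _; exact: energy_summand_ge0.
have h2 := wt_lower R c; rewrite -/m in h2.
apply: (@le_trans _ _ ((2 * n.+1)%:R ^+ m * (wt R c * h c ^+ 2))).
  by rewrite mulrA ler_peMl ?sqr_ge0.
apply: le_trans (ler_wpM2l (exprn_ge0 _ (ltW N0)) h1) _.
rewrite [(2 * m)%N]mulnC exprM expr_div_n.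
have A1 : 1 <= (2 * n.+1)%:R ^+ m :> R by rewrite exprn_ege1// ler1n.
have q0 : 0 < rho ^+ m by rewrite exprn_gt0.
move: A1 q0; move: (_ ^+ m) (rho ^+ m) => A q A1 q0.
rewrite mulrA [X in _ <= X](_ : _ = ((1 + C) * A) ^+ 2 / q ^+ 2); last by field; rewrite gt_eqF.
rewrite ler_wpM2r ?invr_ge0 ?sqr_ge0// exprMn mulrC; apply: ler_pM => //.
- exact: le_trans A1.
- by nra.
- by rewrite expr2 ler_peMl// (le_trans _ A1).
Qed.

End Construction.
End FirstIntegral.

(** * Zeros on the axis and the identity theorem *)

Section Identity.
Variable R : realType.

Lemma monomial_axis n (t : R) (c : multi_index n.+1) :
  monomial (t *: delta_mx 0 0) c = if yd c == 0%N then t ^+ mdegree c else 0.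
Proof.
rewrite monomialZ /monomial; case: eqP => yc.
  rewrite big1 ?mulr1// => i _; have [->|i0] := eqVneq i ord0; first by rewrite mxE eqxx expr1n.
  by have := leq_yd c i0; rewrite yc leqn0 => /eqP ->; rewrite expr0.
have [k k0 ck] : exists2 k, k != ord0 & (0 < c k)%N by apply: yd_gt0P; rewrite lt0n; exact/eqP.
by rewrite (bigD1 k)//= mxE (negPf k0) /= expr0n eqn0Ngt ck /= mul0r mulr0.
Qed.

Lemma axis_inj n (c d : multi_index n.+1) : yd c = 0%N -> yd d = 0%N ->
  mdegree c = mdegree d -> c = d.
Proof.
move=> yc y_d; rewrite !mdegree_yd yc y_d !addn0 => cd; apply/ffunP => k.
have [->//|k0] := eqVneq k ord0.
have := leq_yd c k0; have := leq_yd d k0; rewrite yc y_d !leqn0.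
by move=> /eqP -> /eqP ->.
Qed.

(** Once the lower axis coefficients are known to vanish, a zero t satisfies c_a t^i + O(t^(i+1)) =
    0, hence |c_a| <= K |t|, and t can be taken arbitrarily small. *)
Lemma axis_zeros n (c : multi_index n.+1 -> R) : germ c ->
  (forall e, 0 < e -> exists t, [/\ t != 0, `|t| <= e & ev c (t *: delta_mx 0 0) = 0]) ->
  forall a, yd a = 0%N -> c a = 0.
Proof.
move=> [r r0 cc] zc a; have [m am] := ubnP (mdegree a).
elim: m => // m IH in a am * => ya.
pose i := mdegree a.
have low b : yd b = 0%N -> (mdegree b < i)%N -> c b = 0.
  by move=> yb bi; apply: IH => //; rewrite /i in bi; lia.
pose K := nrm r c / r ^+ i.+1.
have K0 : 0 <= K by rewrite divr_ge0 ?nrm_ge0 ?exprn_ge0// ltW.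
have main t : t != 0 -> `|t| <= r -> ev c (t *: delta_mx 0 0) = 0 -> `|c a| <= `|t| * K.
  move=> t0 tr ct.
  have tr1 : `|t| / r <= 1 by rewrite ler_pdivrMr// mul1r.
  pose u b := c b * monomial (t *: delta_mx 0 0) b.
  have box : inbox r (t *: delta_mx 0 0 : 'cV[R]_n.+1).
    move=> k; rewrite !mxE normrM; apply: le_trans tr; rewrite ler_piMr//.
    by rewrite normr_nat lern1 leq_b1.
  have su : absum u by exact: conv_ev (ltW r0) cc box.
  pose v b := if b == a then 0 else u b.
  pose w b := if b == a then u b else 0.
  have vle b : `|v b| <= (`|t| / r) ^+ i.+1 * (`|c b| * r ^+ mdegree b).
    have p0 : 0 <= (`|t| / r) ^+ i.+1 * (`|c b| * r ^+ mdegree b).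
      by rewrite mulr_ge0 ?exprn_ge0 ?divr_ge0 ?(ltW r0)// mulr_ge0// exprn_ge0// ltW.
    rewrite /v; case: (eqVneq b a) => [_|ba]; first by rewrite normr0.
    rewrite /u monomial_axis; case: (eqVneq (yd b) 0%N) => [yb|_]; last by rewrite mulr0 normr0.
    case: (ltngtP (mdegree b) i) => bi.
    - by rewrite low// mul0r normr0 mul0r mulr0.
    - rewrite normrM normrX mulrCA ler_wpM2l//.
      have -> : `|t| ^+ mdegree b = (`|t| / r) ^+ mdegree b * r ^+ mdegree b.
        by rewrite -exprMn divfK// gt_eqF.
      rewrite ler_wpM2r ?exprn_ge0 ?(ltW r0)// ler_wiXn2l//.
      by rewrite divr_ge0// ltW.
    - by case/eqP: ba; exact: axis_inj.
  have scl := absumZ ((`|t| / r) ^+ i.+1) (conv_abs (ltW r0) cc).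
  have sv : absum v by exact: absum_le scl.
  have sw : absum w.
    apply: (absum_fin (X := [:: a])) => b; rewrite /w inE.
    by case: ifP => //; rewrite eqxx.
  have uE : ev c (t *: delta_mx 0 0) = tsum w + tsum v.
    rewrite -tsumD// /ev; congr tsum; apply/funext => b; rewrite /w /v -/(u b).
    by case: ifP; rewrite ?addr0 ?add0r.
  have wE : tsum w = c a * t ^+ i.
    rewrite (tsum1 (x := a)); last by move=> b /negPf ba; rewrite /w ba.
    by rewrite /w eqxx /u monomial_axis ya eqxx.
  have vE : `|tsum v| <= (`|t| / r) ^+ i.+1 * nrm r c.
    apply: le_trans (ler_norm_tsum sv) _; rewrite /nrm -tsumZ; last exact: conv_abs (ltW r0) cc.
    by apply: ler_tsum => //; exact: absum_norm.
  have : `|c a| * `|t| ^+ i <= (`|t| * K) * `|t| ^+ i.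
    rewrite -normrX -normrM -wE (_ : tsum w = - tsum v); last first.
      by apply/eqP; rewrite -addr_eq0 -uE ct.
    rewrite normrN; apply: le_trans vE _; rewrite le_eqVlt; apply/orP; left; apply/eqP.
    by rewrite /K expr_div_n normrX (exprS `|t|); ring.
  by rewrite ler_pM2r// exprn_gt0// normr_gt0.
apply/eqP; rewrite -normr_le0; apply/ler_addgt0Pl => e e0; rewrite addr0.
have d0 : 0 < Order.min r (e / (1 + K)) by rewrite lt_min r0 divr_gt0// ltr_pwDl.
have [t [t0 td ct]] := zc _ d0.
move: td; rewrite le_min => /andP[tr te].
apply: le_trans (main t t0 tr ct) _; apply: le_trans (ler_wpM2r K0 te) _.
rewrite mulrAC ler_pdivrMr ?ltr_pwDl// ler_wpM2l ?(ltW e0)// lerDr//.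
Qed.

Lemma inbox_ball n r (x : 'cV[R]_n) : ball 0 r x -> inbox r x.
Proof.
move=> [_ h] i; have := h i 0; rewrite -ball_normE /= mxE sub0r normrN; exact: ltW.
Qed.

(** The ball is a union of segments through 0. It serves as the connected domain demanded of a first
    integral. *)
Lemma connected_ball0 n r : connected (ball (0 : 'cV[R]_n) r).
Proof.
have [r0|r0] := ltP 0 r; last first.
  have -> : ball (0 : 'cV[R]_n) r = set0; last exact: connected0.
  by apply/seteqP; split => // x [r1]; rewrite ltNge r0 in r1.
pose seg (x : 'cV[R]_n) := (fun t : R => t *: x) @` `[0, 1].
have -> : ball (0 : 'cV[R]_n) r = \bigcup_(x in ball (0 : 'cV[R]_n) r) seg x.
  apply/seteqP; split => [x xr|x [y [_ yr] [t /= +] <-]].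
    by exists x => //; exists 1; rewrite ?scale1r//= in_itv /= lexx ler01.
  rewrite in_itv /= => /andP[t0 t1]; split=> // i j.
  have := yr i j; rewrite -!ball_normE /= !mxE !sub0r !normrN normrM (ger0_norm t0).
  by apply: le_lt_trans; rewrite ler_piMl.
apply: bigcup_connected.
  exists 0 => x _; exists 0; rewrite ?scale0r//= in_itv /= lexx ler01.
  by [].
move=> x _; apply: connected_continuous_connected; first exact: segment_connected.
apply: continuous_subspaceT => t; exact: scalel_continuous.
Qed.

Lemma constant_coeffs n (c : multi_index n -> R) k : germ c ->
  (\forall x \near (0 : 'cV[R]_n), ev c x = k) -> forall a, a != 0 -> c a = 0.
Proof.
move=> gc ck a a0.
have -> : c = (fun b => k * @fone R n b).
  apply: germ_eq => //; first by apply: germZ; exact: germ_one.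
  have := near_evZ k (germ_one R n); apply: filterS2 ck => x -> ->.
  by rewrite ev_one mulr1.
by rewrite /fone (negPf a0) mulr0.
Qed.

(** The set [S] of points near which H equals H(p0) is open. It is also closed in U: at a limit
    point p, the expansion of H can be recentred at a point of [S], where only its constant term
    survives. *)
Lemma identity_theorem n (U : set 'cV[R]_n) (H : 'cV[R]_n -> R) p0 :
  open U -> connected U -> U p0 -> analytic_on U H ->
  (\forall x \near p0, H x = H p0) -> forall x, U x -> H x = H p0.
Proof.
move=> oU cU U0 aH H0.
pose S := [set p : 'cV[R]_n | \forall x \near p, H x = H p0].
have oS : open S.
  rewrite openE => p /near_inbox[r r0 rS]; apply/near_inbox.
  exists (r / 2) => [|q qp]; first by rewrite divr_gt0.
  apply/near_inbox; exists (r / 2) => [|x xq]; first by rewrite divr_gt0.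
  apply: rS => i; have -> : (x - p) i 0 = (x - q) i 0 + (q - p) i 0 by rewrite !mxE; ring.
  by apply: le_trans (ler_normD _ _) _; rewrite (splitr r) lerD.
suff SU : U `&` S = U by move=> x Ux; move: Ux; rewrite -SU => -[_ /nbhs_singleton].
apply: cU; first by exists p0.
  by exists S.
exists (closure S); first exact: closed_closure.
apply/seteqP; split => [x [Ux Sx]|p [Up Sp]]; first by split=> //; exact: subset_closure.
split=> //; have [c /has_taylorP[r r0 [cc cE]]] := aH p Up.
(* With q in [S] within r / 4 of p, the recentred expansion is valid on the cube of radius r / 2
   around q, which contains the cube of radius r / 4 around p. *)
have r40 : 0 < r / 4 by rewrite divr_gt0.
have [q [Sq qp]] : S `&` [set q | inbox (r / 4) (q - p)] !=set0.
  by apply: Sp; apply/near_inbox; exists (r / 4).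
rewrite /= in qp.
have cc' : conv (r / 4 + r / 2) c.
  by apply: conv_le _ _ cc; [rewrite addr_ge0// divr_ge0// ltW|lra].
have r20 : 0 < r / 2 by rewrite divr_gt0.
have [ce eE _] := recenter r20 (ltW r40) cc' qp.
have HE x : inbox (r / 2) x -> H (q + x) = ev (comp c (translation (q - p))) x.
  move=> xr; rewrite eE// cE; first by congr ev; rewrite addrAC.
  move=> i; have -> : (q + x - p) i 0 = (q - p) i 0 + x i 0 by rewrite !mxE; ring.
  apply: le_trans (ler_normD _ _) _; have := qp i; have := xr i; lra.
have Hq : \forall x \near (0 : 'cV[R]_n), ev (comp c (translation (q - p))) x = H p0.
  have /near_inbox[s s0 sH] := Sq; apply/near0P; exists (Order.min s (r / 2)).
    by rewrite lt_min s0.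
  move=> x xs; rewrite -HE; last by apply: inbox_le xs; rewrite ge_min lexx orbT.
  by apply: sH; rewrite addrC addKr; apply: inbox_le xs; rewrite ge_min lexx.
have ge : germ (comp c (translation (q - p))) by exists (r / 2).
have k0 := constant_coeffs ge Hq.
have e0 : comp c (translation (q - p)) 0 = H p0.
  by rewrite -(ev_germ0 ge); exact: (nbhs_singleton Hq).
have Hc x : inbox (r / 2) x -> H (q + x) = H p0.
  move=> /HE ->; rewrite /ev (tsum1 (x := 0)) ?monomial0 ?mulr1// => a a0.
  by rewrite k0// mul0r.
apply/near_inbox; exists (r / 4) => // x xp.
rewrite -(subrK q x) addrC; apply: Hc => i.
have -> : (x - q) i 0 = (x - p) i 0 - (q - p) i 0 by rewrite !mxE; ring.
apply: le_trans (ler_normB _ _) _; have := qp i; have := xp i; lra.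
Qed.

(** The substitution of -X for X sends each factor X - lam to -(X + lam); the resulting signs (-1)^n
    cancel. *)
Lemma eigenvalue_listN n (A : 'M[R]_n) lam : eigenvalue_list A lam ->
  eigenvalue_list (- A) (fun i => - lam i).
Proof.
rewrite /eigenvalue_list map_mxN; move: (map_mx _ A) => M MA.
have h : char_poly M \Po (- 'X) = (-1) ^+ n * char_poly (- M).
  have := det_map_mx (comp_poly (- 'X)) (char_poly_mx M); rewrite -/(char_poly M) /= => <-.
  rewrite (_ : map_mx _ _ = (-1) *: char_poly_mx (- M)) ?detZ//.
  apply/matrixP => i j; rewrite !mxE raddfB /= comp_polyC polyCN opprK mulN1r opprD.
  by case: (i == j); rewrite ?mulr1n ?mulr0n ?comp_polyX ?raddf0 ?oppr0.
have : (-1) ^+ n * char_poly (- M) = (-1) ^+ n * \prod_i ('X - (- lam i)%:P).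
  rewrite -h MA rmorph_prod /=.
  rewrite (eq_bigr (fun i => (-1) * ('X - (- lam i)%:P))); last first.
    by move=> i _; rewrite raddfB /= comp_polyX comp_polyC polyCN opprK mulN1r opprD.
  by rewrite big_split /= prodr_const card_ord.
by move/mulfI; apply; rewrite signr_eq0.
Qed.

End Identity.

(** * Coordinates rectifying the singular points *)

Section Core.
Variables (R : realType) (n : nat).
Local Notation vec := 'cV[R]_n.+1.
Local Notation mi := (multi_index n.+1).
Variables (A P Q L L' : 'M[R]_n.+1) (b : R).
Variables (V : set vec) (f : vec -> vec) (cf : 'I_n.+1 -> mi -> R).
Hypotheses (V_open : open V) (V0 : V 0).
Hypothesis germ_cf : forall i, germ (cf i).
Hypothesis ord_cf : forall i, ord 2 (cf i).
Hypothesis near_cf : \forall z \near (0 : vec), forall i, f z i 0 = ev (cf i) z.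
Hypotheses (PQ : P *m Q = 1%:M) (QAP : Q *m A *m P = L) (b0 : 0 < b).
Hypotheses (L_row0 : forall j, L 0 j = 0) (L_col0 : forall j, L j 0 = 0).
Hypothesis L'_row0 : forall j, L' 0 j = 0.
Hypotheses (LL' : L *m L' = 1%:M - delta_mx 0 0) (L'L : L' *m L = 1%:M - delta_mx 0 0).
Hypothesis L_coercive : forall y : 'I_n.+1 -> R,
  b * \sum_(k | k != ord0) y k ^+ 2 <= \sum_k \sum_l L k l * y k * y l.

Local Notation X := (vector_field A f).

(* The coordinates [x = (Q z)_0] and [y = B^-1 (Q (X z))_{>0}], where [L] is [B] bordered by
   zeros: in them the singular points lie on the axis [y = 0]. *)
Definition Theta l : mi -> R :=
  fun a => \sum_j Q l j * fvar R j a + \sum_j (L' *m Q) l j * cf j a.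

Definition Xfam k : mi -> R := fun a => \sum_j A k j * fvar R j a + cf k a.

(** The derivative of the coordinate Theta_l along X, still expressed in z. *)
Definition Gam l : mi -> R := fun a => \sum_k mul (pd k (Theta l)) (Xfam k) a.

Lemma germ_lin (M : 'M[R]_n.+1) l : germ (fun a : mi => \sum_j M l j * fvar R j a).
Proof. by apply: germ_sum => j; apply: germZ; exact: germ_var. Qed.

Lemma near_lin (M : 'M[R]_n.+1) l :
  \forall z \near (0 : vec), ev (fun a : mi => \sum_j M l j * fvar R j a) z = (M *m z) l 0.
Proof.
have h j : germ (fun a : mi => M l j * fvar R j a) by apply: germZ; exact: germ_var.
have h2 := near_all (fun j => near_evZ (M l j) (germ_var R j)).
apply: filterS2 (near_ev_sum h) h2 => z -> zE; rewrite mxE; apply: eq_bigr => j _.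
by rewrite zE ev_var.
Qed.

Lemma lin_dl (M : 'M[R]_n.+1) l k : \sum_j M l j * fvar R j (dl k) = M l k.
Proof.
rewrite (bigD1 k)//= /fvar eqxx mulr1 big1 ?addr0// => j /negPf jk.
by rewrite (inj_eq (@dl_inj n.+1)) eq_sym jk mulr0.
Qed.

Lemma lin_0 (M : 'M[R]_n.+1) l : \sum_j M l j * fvar R j (0 : mi) = 0.
Proof. by rewrite big1// => j _; rewrite /fvar eq_sym dl_neq0 mulr0. Qed.

Lemma cf_0 i : cf i 0 = 0.
Proof. by apply: ord_cf; rewrite mdegree0. Qed.

Lemma cf_dl i k : cf i (dl k) = 0.
Proof. by apply: ord_cf; rewrite mdegree_dl. Qed.

Lemma germ_cfs l : germ (fun a => \sum_j (L' *m Q) l j * cf j a).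
Proof. by apply: germ_sum => j; exact: germZ. Qed.

Lemma germ_Theta l : germ (Theta l).
Proof. by apply: germD; [exact: germ_lin|exact: germ_cfs]. Qed.

Lemma Theta_dl l k : Theta l (dl k) = Q l k.
Proof.
rewrite /Theta lin_dl big1 ?addr0// => j _; by rewrite cf_dl mulr0.
Qed.

Lemma ord_Theta l : ord 1 (Theta l).
Proof.
apply/ord1P; rewrite /Theta lin_0 big1 ?addr0// => j _; by rewrite cf_0 mulr0.
Qed.

Lemma near_Theta : \forall z \near (0 : vec), evs Theta z = Q *m z + L' *m Q *m f z.
Proof.
have h1 := near_all (fun l => near_evD (germ_lin Q l) (germ_cfs l)).
have h2 := near_all (fun l => near_lin Q l).
have h3 := near_all (fun l => near_ev_sum (fun j => germZ ((L' *m Q) l j) (germ_cf j))).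
have h4 := near_all (fun l => near_all (fun j => near_evZ ((L' *m Q) l j) (germ_cf j))).
have h12 := near_and h1 h2; have h34 := near_and h3 h4; have h := near_and h12 h34.
apply: filterS2 near_cf h => z zf [[z1 z2] [z3 z4]]; apply/colP => l.
rewrite mxE z1 z2 z3 [RHS]mxE; congr (_ + _); rewrite [RHS]mxE; apply: eq_bigr => j _.
by rewrite z4 zf.
Qed.

Lemma germ_Xfam k : germ (Xfam k).
Proof. by apply: germD => //; exact: germ_lin. Qed.

Lemma near_Xfam : \forall z \near (0 : vec), forall k, ev (Xfam k) z = X z k 0.
Proof.
have h1 := near_all (fun l => near_evD (germ_lin A l) (germ_cf l)).
have h2 := near_all (fun l => near_lin A l).
have h := near_and h1 h2.
apply: filterS2 near_cf h => z zf [z1 z2] k.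
by rewrite z1 z2 -zf [RHS]mxE.
Qed.

Lemma germ_Gam l : germ (Gam l).
Proof.
by apply: germ_sum => k; apply: germ_mul; [exact/germ_pd/germ_Theta|exact: germ_Xfam].
Qed.

Lemma near_Gam : \forall z \near (0 : vec), forall l,
  ev (Gam l) z = \sum_k ev (pd k (Theta l)) z * X z k 0.
Proof.
have g l k : germ (mul (pd k (Theta l)) (Xfam k)).
  by apply: germ_mul; [exact/germ_pd/germ_Theta|exact: germ_Xfam].
have h1 := near_all (fun l => near_ev_sum (g l)).
have h2 := near_all (fun l => near_all (fun k =>
  near_ev_mul (germ_pd k (germ_Theta l)) (germ_Xfam k))).
apply: filterS2 near_Xfam (near_and h1 h2) => z zX [z1 z2] l.
by rewrite z1; apply: eq_bigr => k _; rewrite z2 zX.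
Qed.

Lemma Gam_0 l : Gam l 0 = 0.
Proof.
by rewrite /Gam big1// => k _; rewrite mul_0 /Xfam lin_0 cf_0 addr0 mulr0.
Qed.

Lemma Gam_dl l i : Gam l (dl i) = (Q *m A) l i.
Proof.
rewrite /Gam mxE; apply: eq_bigr => k _; rewrite mul_dl /Xfam lin_0 lin_dl cf_0 cf_dl.
by rewrite !addr0 mulr0 addr0 /pd ffunE mul1r add0r Theta_dl.
Qed.

(** * The vector field in the rectifying coordinates *)

Variable psi : 'I_n.+1 -> mi -> R.
Hypothesis germ_psi : forall i, germ (psi i).
Hypothesis ord_psi : forall i, ord 1 (psi i).
Hypothesis psi_dl : forall i j, psi i (dl j) = P i j.
Hypothesis Theta_psi : \forall x \near (0 : vec), evs Theta (evs psi x) = x.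
Hypothesis psi_Theta : \forall z \near (0 : vec), evs psi (evs Theta z) = z.

Definition F l : mi -> R := comp (Gam l) psi.

(** The vector v with F = F_0 v on the axis: the derivative of Theta in the direction P e_0,
    expressed in u. *)
Definition VV l : mi -> R := comp (fun a => \sum_k P k 0 * pd k (Theta l) a) psi.

Lemma germ_F l : germ (F l).
Proof. by apply: germ_comp => //; exact: germ_Gam. Qed.

Lemma near_F : \forall u \near (0 : vec), forall l,
  ev (F l) u = \sum_k ev (pd k (Theta l)) (evs psi u) * X (evs psi u) k 0.
Proof.
have h1 := near_all (fun l => near_ev_comp (germ_Gam l) germ_psi ord_psi).
have h2 := near_evs germ_psi ord_psi near_Gam.
by apply: filterS2 h1 h2 => u u1 u2 l; rewrite u1 u2.
Qed.

Lemma psi_0 : \col_i psi i 0 = 0.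
Proof. by apply/colP => i; rewrite !mxE; apply: ord_psi; rewrite mdegree0. Qed.

Lemma F_0 l : F l 0 = 0.
Proof.
rewrite -(ev_germ0 (germ_F l)).
have h := near_ev_comp (germ_Gam l) germ_psi ord_psi.
rewrite /F (nbhs_singleton h) (_ : evs psi 0 = 0) ?(ev_germ0 (germ_Gam l)) ?Gam_0//.
by rewrite -[RHS]psi_0; apply/colP => i; rewrite !mxE ev_germ0.
Qed.

Lemma absum_at0 (c : mi -> R) : absum (fun a => c a * monomial (0 : vec) a).
Proof.
apply: (absum_fin (X := [:: 0])) => a; rewrite inE; apply: contraNT => /mi_neq0P[k ak].
by rewrite /monomial (bigD1 k)//= mxE expr0n eqn0Ngt ak /= mul0r mulr0.
Qed.

Lemma F_dl l j : F l (dl j) = L l j.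
Proof.
rewrite /F comp_dl psi_0; last by move=> i; exact: absum_at0.
rewrite -QAP mxE; apply: eq_bigr => i _; rewrite psi_dl; congr (_ * _).
by rewrite ev_germ0; [rewrite /pd ffunE mul1r add0r Gam_dl|apply: germ_pd; exact: germ_Gam].
Qed.

Lemma FE l : F l = (fun a => \sum_j L l j * fvar R j a + tail2 (F l) a).
Proof.
apply/funext => a; rewrite [LHS]tail2E F_0 mul0r add0r; congr (_ + _).
by apply: eq_bigr => j _; rewrite F_dl.
Qed.

(** Differentiating a function of u along X amounts to differentiating it along F, so the first
    integral equation can be moved between the coordinates z and u. *)
Lemma transport (H : vec -> R) (h : mi -> R) : germ h ->
  (\forall z \near (0 : vec), H z = ev h (evs Theta z)) ->
  \forall z \near (0 : vec), (exists c, has_taylor_series H z c) /\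
    inner (gradient H z) (X z) = \sum_l ev (pd l h) (evs Theta z) * ev (F l) (evs Theta z).
Proof.
move=> gh /(chain_rule gh germ_Theta ord_Theta) hH.
have hF := near_evs germ_Theta ord_Theta near_F.
have hpF := near_and psi_Theta hF.
apply: filterS2 hH hpF => z [ez gradz] [pz Fz]; split=> //.
rewrite /inner.
under eq_bigr => k _.
  rewrite mxE gradz mulr_suml.
  under eq_bigr => l _.
    rewrite (bigD1 k)//= mxE !eqxx mulr1 big1 ?addr0; last first.
      by move=> j /negPf jk; rewrite mxE jk mulr0.
    over.
  over.
rewrite exchange_big; apply: eq_bigr => l _; rewrite Fz pz mulr_sumr.
by apply: eq_bigr => k _; rewrite mulrA.
Qed.

Lemma proj_axis (u : vec) : (1%:M - delta_mx 0 0) *m u = 0 -> u = u 0 0 *: delta_mx 0 0.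
Proof.
rewrite mulmxBl mul1mx => /eqP; rewrite subr_eq0 => /eqP ->; apply/colP => k.
rewrite !mxE (bigD1 0)//= big1 ?addr0; last first.
  by move=> j /negPf j0; rewrite mxE j0 andbF mul0r.
rewrite [in RHS](bigD1 0)//= big1 ?addr0; last first.
  by move=> j /negPf j0; rewrite mxE j0 andbF mul0r.
by rewrite !mxE !eqxx !andbT mul1r mulrC.
Qed.

(** [L'] inverts [L] off the axis, so applying [L] to Theta(z) returns the y-part of Q X(z). Thus
    Theta(z) lies on the axis exactly when that part vanishes. *)
Lemma L_lin z : L *m (Q *m z + L' *m Q *m f z) = (1%:M - delta_mx 0 0) *m (Q *m X z).
Proof.
have QA : Q *m A = L *m Q by rewrite -QAP -!mulmxA PQ mulmx1.
have EL : (delta_mx 0 0 : 'M[R]_n.+1) *m L = 0.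
  apply/matrixP => i j; rewrite !mxE big1// => k _; rewrite mxE.
  by case: (eqVneq k 0) => [->|_]; rewrite ?L_row0 ?mulr0// andbF mul0r.
have -> : Q *m X z = L *m (Q *m z) + Q *m f z.
  by rewrite /vector_field mulmxDr !mulmxA QA.
rewrite !mulmxDr !mulmxA LL'; congr (_ + _).
by rewrite mulmxBl mul1mx EL subr0.
Qed.

(** On the axis, [L_lin] makes Q X parallel to e_0. The coefficient is F_0: row 0 of [L'] is zero,
    so Theta_0 is linear and its gradient is row 0 of Q. *)
Lemma near_axis : \forall u \near (0 : vec), forall t, u = t *: delta_mx 0 0 ->
  X (evs psi u) = ev (F 0) u *: (P *m delta_mx 0 0) /\
  forall l, ev (F l) u = ev (F 0) u * ev (VV l) u.
Proof.
have QP : Q *m P = 1%:M by exact: mulmx1C.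
have gW l : germ (fun a => \sum_k P k 0 * pd k (Theta l) a).
  by apply: germ_sum => k; apply/germZ/germ_pd/germ_Theta.
have h1 := near_evs germ_psi ord_psi near_Theta.
have h2 := near_all (fun l => near_ev_comp (gW l) germ_psi ord_psi).
have gZ l k : germ (fun a => P k 0 * pd k (Theta l) a) by apply/germZ/germ_pd/germ_Theta.
have h3 := near_evs germ_psi ord_psi (near_all (fun l => near_ev_sum (gZ l))).
have h4 := near_evs germ_psi ord_psi (near_all (fun l => near_all (fun k =>
   near_evZ (P k 0) (germ_pd k (germ_Theta l))))).
have pd0 k : pd k (Theta 0) = (fun a => Q 0 k * @fone R n.+1 a).
  apply/funext => a; rewrite /pd /Theta [X in _ + X]big1 ?addr0; last first.
    move=> j _; rewrite mxE big1 ?mul0r// => i _; by rewrite L'_row0 mul0r.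
  have [->|a0] := eqVneq a 0.
    by rewrite add0r lin_dl ffunE mul1r /fone eqxx mulr1.
  rewrite /fone (negPf a0) mulr0 big1 ?mulr0// => j _; rewrite /fvar.
  case: eqVneq => [e|]; last by rewrite mulr0.
  have := congr1 (@mdegree _) e; rewrite mdegreeD !mdegree_dl addn1 => -[] /eqP.
  by rewrite mdegree_eq0 (negPf a0).
have h5 := near_evs germ_psi ord_psi (near_all (fun k => near_evZ (Q 0 k) (germ_one R n.+1))).
have h := near_and (near_and (near_and h1 h2) (near_and h3 h4)) (near_and near_F h5).
apply: filterS2 Theta_psi h => u up [[[u1 u2] [u3 u4]] [uF u5]] t ut.
set z := evs psi u in up u1 u2 u3 u4 uF u5 *.
have QX : Q *m X z = (Q *m X z) 0 0 *: delta_mx 0 0.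
  apply: proj_axis; rewrite -L_lin -u1 up ut -scalemxAr.
  rewrite (_ : L *m delta_mx 0 0 = 0) ?scaler0//; apply/colP => i.
  rewrite !mxE (bigD1 0)//= L_col0 mul0r add0r big1// => k /negPf k0.
  by rewrite mxE k0 mulr0.
have F0E : ev (F 0) u = (Q *m X z) 0 0.
  rewrite uF mxE; apply: eq_bigr => k _; congr (_ * _).
  by rewrite pd0 u5 ev_one mulr1.
have XE : X z = ev (F 0) u *: (P *m delta_mx 0 0).
  by rewrite F0E scalemxAr -QX mulmxA PQ mul1mx.
have VE l : ev (VV l) u = \sum_k P k 0 * ev (pd k (Theta l)) z.
  apply: etrans (u2 l) _; apply: etrans (u3 l) _; apply: eq_bigr => k _.
  exact: u4 l k.
split=> [|l]; first exact: XE.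
apply: etrans (uF l) _; rewrite VE mulr_sumr; apply: eq_bigr => k _.
have -> : X z k 0 = ev (F 0) u * P k 0.
  rewrite [in LHS]XE mxE; congr (_ * _); rewrite mxE (bigD1 0)//= mxE !eqxx mulr1.
  by rewrite big1 ?addr0// => j /negPf j0; rewrite mxE j0 mulr0.
by move: (ev (F 0) u) (ev (pd k (Theta l)) z) => p q; ring.
Qed.

Lemma germ_VV l : germ (VV l).
Proof.
by apply: germ_comp => //; apply: germ_sum => k; apply/germZ/germ_pd/germ_Theta.
Qed.

Lemma VV_0 l : VV l 0 = (l == 0)%:R.
Proof.
have gW : germ (fun a => \sum_k P k 0 * pd k (Theta l) a).
  by apply: germ_sum => k; apply/germZ/germ_pd/germ_Theta.
rewrite -(ev_germ0 (germ_VV l)) /VV (nbhs_singleton (near_ev_comp gW germ_psi ord_psi)).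
rewrite (_ : evs psi 0 = 0) ?(ev_germ0 gW); last first.
  by rewrite -[RHS]psi_0; apply/colP => i; rewrite !mxE ev_germ0.
have /matrixP/(_ l 0) := mulmx1C PQ; rewrite !mxE => <-.
apply: eq_bigr => k _; rewrite /pd ffunE mul1r add0r Theta_dl; exact: mulrC.
Qed.

Lemma evs_psi0 : evs psi 0 = 0.
Proof. by rewrite -[RHS]psi_0; apply/colP => i; rewrite !mxE ev_germ0. Qed.

Lemma evs_Theta0 : evs Theta 0 = 0.
Proof.
apply/colP => i; rewrite !mxE ev_germ0; last exact: germ_Theta.
by apply: ord_Theta; rewrite mdegree0.
Qed.

Lemma inbox_half_ball r (z : vec) : 0 < r -> inbox (r / 2) z -> ball 0 r z.
Proof.
move=> r0 zr; split=> // i j; rewrite [j]ord1 -ball_normE /= mxE sub0r normrN.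
by apply: le_lt_trans (zr i) _; rewrite ltr_pdivrMr// ltr_pMr// ltr1n.
Qed.

Lemma X_0 : X 0 = 0.
Proof.
apply/colP => k; rewrite -(nbhs_singleton near_Xfam) (ev_germ0 (germ_Xfam k)) mxE.
by rewrite /Xfam lin_0 cf_0 addr0.
Qed.

Lemma near_V : \forall z \near (0 : vec), V z.
Proof. exact: (open_nbhs_nbhs (conj V_open V0)). Qed.

Lemma near_sum_mul (h : mi -> R) : germ h ->
  germ (fun c => \sum_l mul (F l) (pd l h) c) /\
  \forall u \near (0 : vec), ev (fun c => \sum_l mul (F l) (pd l h) c) u =
    \sum_l ev (pd l h) u * ev (F l) u.
Proof.
move=> gh; have gl l : germ (mul (F l) (pd l h)).
  by apply: germ_mul; [exact: germ_F|exact: germ_pd].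
split; first exact: germ_sum.
have h2 := near_all (fun l => near_ev_mul (germ_F l) (germ_pd l gh)).
apply: filterS2 (near_ev_sum gl) h2 => u -> u2; apply: eq_bigr => l _.
by rewrite u2 mulrC.
Qed.

Lemma germ0 : germ (fun _ : mi => 0 : R).
Proof.
by exists 1 => //; rewrite /conv; under eq_fun do rewrite mul0r; exact: absum0.
Qed.

Lemma ev_zero (x : vec) : ev (fun _ : mi => 0) x = 0.
Proof. by rewrite /ev; under eq_fun do rewrite mul0r; exact: tsum0. Qed.

(** * From a non-isolated singular point to a first integral *)

Lemma axis_F : ~ isolated (singular_points V X) 0 ->
  forall l a, yd a = 0%N -> F l a = 0.
Proof.
move=> niso l; apply: axis_zeros (germ_F l) _ => e e0.
have hF := near_evs germ_Theta ord_Theta near_F.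
have he : \forall z \near (0 : vec), inbox e (evs Theta z).
  by apply: (near_evs germ_Theta ord_Theta); apply/near0P; exists e.
have hN := near_and (near_and near_Theta psi_Theta) (near_and hF he).
(* If F_l had no zero on the axis within e other than 0, the neighbourhood on which the coordinates
   are valid would isolate the singular point 0. *)
apply: contrapT => no; apply: niso; split.
  by apply/mem_set; split; [exact: V0|exact: X_0].
exists [set z | (evs Theta z = Q *m z + L' *m Q *m f z /\ evs psi (evs Theta z) = z) /\
  ((forall l : 'I_n.+1, ev (F l) (evs Theta z) = \sum_k ev (pd k (Theta l)) (evs psi (evs Theta z)) *
    X (evs psi (evs Theta z)) k 0) /\ inbox e (evs Theta z))]; first exact: hN.
apply/seteqP; split => [z [[[z1 z2] [z3 z4]] [Vz Xz]]|z -> /=]; last first.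
  split; last by split; [exact: V0|exact: X_0].
  exact: (nbhs_singleton hN).
apply: contrapT => zn0; apply: no.
(* [L' *m L] is the projection off the axis, so by [L_lin] it annihilates Theta at every singular
   point of this neighbourhood. *)
have uE : evs Theta z = (evs Theta z) 0 0 *: delta_mx 0 0.
  apply: proj_axis; rewrite -L'L -mulmxA [in X in _ *m X]z1 L_lin Xz.
  by rewrite !mulmx0.
exists ((evs Theta z) 0 0); split.
- apply/eqP => t0; apply: zn0; rewrite /= -z2 uE t0 scale0r; exact: evs_psi0.
- exact: z4.
- by rewrite -uE z3 z2 Xz big1// => k _; rewrite mxE mulr0.
Qed.

Lemma nonisolated_first_integral : ~ isolated (singular_points V X) 0 ->
  has_analytic_first_integral V X.
Proof.
move=> /axis_F aF.
have [|||h [gh h1 hF]] := axis_first_integral b0 L_row0 L_col0 L_coercive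
  (G := fun l => tail2 (F l)).
- by move=> l; apply: germ_tail2; exact: germ_F.
- by move=> l; exact: ord_tail2.
- by move=> l a ya; rewrite /tail2; case: ifP => // _; exact: aF.
have kE : (fun c => \sum_l mul (F l) (pd l h) c) = (fun _ => 0).
  apply/funext => c; rewrite -[RHS](hF c); apply: eq_bigr => l _.
  by rewrite {1}FE.
have [H HdE] : exists H : vec -> R, forall z, H z = ev h (evs Theta z).
  by exists (fun z => ev h (evs Theta z)).
have HE : \forall z \near (0 : vec), H z = ev h (evs Theta z).
  by apply/near0P; exists 1.
have hT := transport gh HE.
have [_ kv] := near_sum_mul gh; rewrite kE in kv.
have k0 := near_evs germ_Theta ord_Theta kv.
have [r r0 hr] := proj1 (near0P _) (near_and near_V (near_and hT k0)).
have inU z : ball 0 r z -> inbox r z by exact: inbox_ball.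
exists (ball 0 r), H; split.
- split; [exact: ball_open|exact: connected_ball0|exact: ballxx|].
  by move=> z /inU/hr[].
- by move=> z /inU/hr[_ [[ez _] _]].
- apply: contrapT => noxy.
  (* If H were constant on the ball, h would be constant near 0, contrary to its coefficient 1 at
     x. *)
  have Hc : \forall u \near (0 : vec), ev h u = H 0.
    have hb : \forall z \near (0 : vec), H z = H 0.
      apply/near0P; exists (r / 2); first by rewrite divr_gt0.
      move=> z zr; apply: contrapT => ne; apply: noxy; exists z, 0.
      split; [exact: inbox_half_ball|exact: ballxx|exact: ne].
    have := near_evs germ_psi ord_psi hb; apply: filterS2 Theta_psi => u ut.
    by rewrite HdE ut.
  have := constant_coeffs gh Hc (a := dl ord0); rewrite dl_neq0 h1 => /(_ isT)/eqP.
  by rewrite oner_eq0.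
- move=> z /inU/hr[_ [[_ iz] kz]]; rewrite iz -kz; exact: ev_zero.
Qed.

(** * From a first integral to a non-isolated singular point *)

Lemma axis_nonvanishing : isolated (singular_points V X) 0 ->
  exists2 e, 0 < e & forall t, t != 0 -> `|t| <= e -> ev (F 0) (t *: delta_mx 0 0) != 0.
Proof.
move=> [_ [N N0 NS]].
have hN : \forall z \near (0 : vec), N z by exact: N0.
have h := near_evs germ_psi ord_psi (near_and hN near_V).
have [e e0 he] := proj1 (near0P _) (near_and near_axis (near_and h Theta_psi)).
exists e => // t t0 te; apply/negP => /eqP F0.
have box : inbox e (t *: delta_mx 0 0 : vec).
  move=> k; rewrite !mxE normrM; apply: le_trans te; rewrite ler_piMr//.
  by rewrite normr_nat lern1 leq_b1.
have [ax [[Nz Vz] Tz]] := he _ box.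
have [Xz _] := ax t erefl; rewrite F0 scale0r in Xz.
(* A zero t of F_0 gives the singular point psi(t e_0), which isolation forces to be 0; applying
   Theta then yields t = 0. *)
have : (N `&` singular_points V X) (evs psi (t *: delta_mx 0 0)).
  by split=> //; split.
rewrite NS /= => z0; move: Tz; rewrite z0 evs_Theta0 => /colP/(_ 0).
by rewrite !mxE !eqxx mulr1 => /esym/eqP; rewrite (negPf t0).
Qed.

Lemma first_integral_nonisolated : has_analytic_first_integral V X ->
  ~ isolated (singular_points V X) 0.
Proof.
move=> [U [H [[oU cU U0 UV] aH [x [y [Ux Uy Hxy]]] HX]]] /axis_nonvanishing[e e0 Fne].
have [eta etaT] := aH 0 U0.
have /has_taylorP[s s0 [ceta etaE]] := etaT.
have geta : germ eta by exists s.
have Heta : \forall z \near (0 : vec), H z = ev eta z.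
  by apply/near0P; exists s => // z zs; rewrite etaE subr0.
pose h := comp eta psi.
have gh : germ h by exact: germ_comp.
have HE : \forall z \near (0 : vec), H z = ev h (evs Theta z).
  have h1 := near_evs germ_Theta ord_Theta (near_ev_comp geta germ_psi ord_psi).
  apply: filterS2 Heta (near_and h1 psi_Theta) => z -> [-> ->]; by [].
have hT := transport gh HE.
have nU : \forall z \near (0 : vec), U z by exact: (open_nbhs_nbhs (conj oU U0)).
have [gk kv] := near_sum_mul gh.
have k0 : (fun c => \sum_l mul (F l) (pd l h) c) = (fun _ => 0).
  apply: germ_eq gk germ0 _.
  have h1 := near_evs germ_psi ord_psi (near_and nU hT).
  apply: filterS2 kv (near_and h1 Theta_psi) => u -> [[uU [_ ui]] ut].
  by move: ui; rewrite (HX _ uU) ut ev_zero => <-.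
(* Non-constancy is given only somewhere on U. The identity theorem on the connected set U brings it
   back to the germ at 0. *)
have nonconst : exists c, c != 0 /\ h c <> 0.
  apply: contrapT => no; apply: Hxy.
  have Hconst : \forall z \near (0 : vec), H z = H 0.
    have hE z : H z = ev h (evs Theta z) -> H z = h 0.
      move=> ->; rewrite /ev (tsum1 (x := 0)) ?monomial0 ?mulr1// => a a0.
      rewrite (_ : h a = 0) ?mul0r//; apply: contrapT => ha; apply: no.
      by exists a.
    have H0 := hE _ (nbhs_singleton HE).
    by apply: filterS HE => z /hE ->.
  by rewrite (identity_theorem oU cU U0 aH Hconst Ux) (identity_theorem oU cU U0 aH Hconst Uy).
have [m [[c [cm [c0 hc]]] min_m]] : exists m,
    (exists c, mdegree c = m /\ c != 0 /\ h c <> 0) /\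
    forall a, a != 0 -> (mdegree a < m)%N -> h a = 0.
  have ex : exists m, `[< exists c, mdegree c = m /\ c != 0 /\ h c <> 0 >].
    by have [c [c0 hc]] := nonconst; exists (mdegree c); apply/asboolP; exists c.
  case: (ex_minnP ex) => m /asboolP hm mmin; exists m; split=> // a a0 am.
  apply: contrapT => ha; move: am; rewrite ltnNge mmin//.
  by apply/asboolP; exists a.
(* The terms of F of degree at least 2 meet coefficients of h of degree below m, which vanish except
   possibly the constant one; [pd] never sees the constant term. *)
have Lh a : mdegree a = m -> Lop L h a = 0.
  move=> am; have /(congr1 (@^~ a)) /= := k0.
  rewrite (eq_bigr (fun l => mul (fun a => \sum_j L l j * fvar R j a + tail2 (F l) a) (pd l h) a)); last first.
    by move=> l _; rewrite {1}FE.
  rewrite mul_Lop [X in _ + X]big1 ?addr0// => l _.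
  rewrite mulE big_seq big1// => -[p q]; rewrite mem_mpairs /= => /eqP pq.
  rewrite /tail2; case: leqP => p1; first by rewrite mul0r.
  rewrite /pd min_m ?mulr0//.
    by rewrite addmi_eq0 dl_neq0 andbF.
  by rewrite mdegreeD mdegree_dl -am -pq mdegreeD; lia.
have yc : yd c = 0%N.
  case: (posnP (yd c)) => // yc; case: hc.
  exact: (Lop_inj b0 L_col0 L_coercive Lh cm yc).
have ck : (0 < c ord0)%N.
  by rewrite lt0n; apply: contraNneq c0 => ck; rewrite -mdegree_eq0 mdegree_yd ck yc.
pose K : mi -> R := fun a => \sum_l mul (pd l h) (VV l) a.
have gK l : germ (mul (pd l h) (VV l)).
  by apply: germ_mul; [exact: germ_pd|exact: germ_VV].
have KE : \forall u \near (0 : vec), ev K u = \sum_l ev (pd l h) u * ev (VV l) u.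
  have h2 := near_all (fun l => near_ev_mul (germ_pd l gh) (germ_VV l)).
  apply: filterS2 (near_ev_sum gK) h2 => u uK u2; apply: etrans uK _.
  by apply: eq_bigr => l _; exact: u2.
(* On the axis F_0 [K] is the derivative of h along F, hence 0. Cancelling F_0 at small t > 0
   provides the accumulating zeros required by [axis_zeros]. *)
have K0 : forall a, yd a = 0%N -> K a = 0.
  apply: axis_zeros; first exact: germ_sum.
  move=> d d0.
  have [r r0 hr] := proj1 (near0P _) (near_and near_axis (near_and KE kv)).
  pose t := Order.min (Order.min e d) r.
  have t0 : 0 < t by rewrite !lt_min e0 d0 r0.
  have td : `|t| <= d by rewrite gtr0_norm// !ge_min lexx orbT.
  have te : `|t| <= e by rewrite gtr0_norm// !ge_min lexx.
  have tr : `|t| <= r by rewrite gtr0_norm// !ge_min lexx orbT.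
  have tn0 : t != 0 by rewrite gt_eqF.
  exists t; split=> //.
  have box : inbox r (t *: delta_mx 0 0 : vec).
    move=> k; rewrite !mxE normrM; apply: le_trans tr; rewrite ler_piMr//.
    by rewrite normr_nat lern1 leq_b1.
  have [ax [-> kz]] := hr _ box.
  have [_ FV] := ax t erefl.
  apply/eqP; rewrite -(mulrI_eq0 _ (lregP (Fne t tn0 te))).
  have : \sum_l ev (pd l h) (t *: delta_mx 0 0) * ev (F l) (t *: delta_mx 0 0) = 0.
    by rewrite -kz k0 ev_zero.
  move=> S0; rewrite -[X in _ == X]S0; apply/eqP; rewrite mulr_sumr; apply: eq_bigr => l _.
  by rewrite mulrCA; congr (_ * _); exact/esym/FV.
have yp : yd (mi_pred c ord0) = 0%N.
  by have := congr1 (@yd n) (mi_predK ck); rewrite ydD yc; lia.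
have mp := congr1 (@mdegree _) (mi_predK ck).
rewrite mdegreeD mdegree_dl cm in mp.
(* In degree m - 1 only the constant coefficients of v contribute, as the derivatives of h have no
   terms of lower degree; and v(0) = e_0. *)
have mulK l : mul (pd l h) (VV l) (mi_pred c ord0) = pd l h (mi_pred c ord0) * (l == 0)%:R.
  rewrite /mul (tsum1 (x := (mi_pred c ord0, 0))) /= ?addr0 ?eqxx ?VV_0// => -[p q] ne /=.
  case: eqP => // pq; have q0 : q != 0.
    by apply: contraNneq ne => q0; rewrite xpair_eqE q0 eqxx -pq q0 addr0 eqxx.
  have pm := congr1 (@mdegree _) pq; rewrite mdegreeD in pm.
  rewrite -mdegree_eq0 in q0.
  rewrite /pd min_m ?mulr0 ?mul0r//; first by rewrite addmi_eq0 dl_neq0 andbF.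
  by rewrite mdegreeD mdegree_dl; lia.
have := K0 _ yp; rewrite /K (bigD1 ord0)//= big1 ?addr0; last first.
  by move=> l /negPf l0; rewrite mulK l0 mulr0.
rewrite mulK eqxx mulr1 /pd mi_predK// => /eqP; rewrite mulf_eq0 pnatr_eq0 /=.
by move=> /eqP.
Qed.

End Core.

(** * The equivalence in each half-plane *)

Lemma first_integral_iff_pos (R : realType) (n : nat) (A : 'M[R]_n.+1)
    (V : set 'cV[R]_n.+1) (f : 'cV[R]_n.+1 -> 'cV[R]_n.+1) (lam : 'I_n.+1 -> R[i]) :
  open V -> V 0 ->
  (forall i, exists2 c : multi_index n.+1 -> R,
      has_taylor_series (fun x => f x i 0) 0 c & forall a, (mdegree a <= 1)%N -> c a = 0) ->
  eigenvalue_list A lam -> lam ord0 = 0 ->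
  (forall i, i != ord0 -> 0 < complex.Re (lam i)) ->
  has_analytic_first_integral V (vector_field A f) <->
  ~ isolated (singular_points V (vector_field A f)) 0.
Proof.
move=> oV V0 f2 lamE lam00 lam_pos.
have [P [Q [L [L' [b [[PQ QAP b0] L0 L'0 [LL' L'L] Lc]]]]]] :=
  coercive_normal_form lamE lam00 lam_pos.
have /choice[cf cfP] : forall i, exists c : multi_index n.+1 -> R,
    has_taylor_series (fun x => f x i 0) 0 c /\ forall a, (mdegree a <= 1)%N -> c a = 0.
  by move=> i; have [c c1 c2] := f2 i; exists c.
have germ_cf i : germ (cf i).
  by have [/has_taylorP[r r0 [cc _]] _] := cfP i; exists r.
have ord_cf i : ord 2 (cf i) by move=> a a2; exact: (cfP i).2.
have near_cf : \forall z \near (0 : 'cV[R]_n.+1), forall i, f z i 0 = ev (cf i) z.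
  apply: near_all => i; have [/has_taylorP[r r0 [_ h]] _] := cfP i.
  by apply/near0P; exists r => // z zr; rewrite h subr0.
have L_row0 j : L 0 j = 0 by have [] := L0 j.
have L_col0 j : L j 0 = 0 by have [] := L0 j.
have gT := germ_Theta Q L' germ_cf; have oT := ord_Theta Q L' ord_cf.
have lT := Theta_dl Q L' ord_cf.
have [psi [gp op lp Tp pT]] := local_inverse PQ gT oT lT.
split.
- exact: (first_integral_nonisolated oV V0 germ_cf ord_cf near_cf PQ QAP b0
    L_row0 L_col0 L'0 LL' Lc gp op lp Tp pT).
- exact: (nonisolated_first_integral oV V0 germ_cf ord_cf near_cf PQ QAP b0
    L_row0 L_col0 LL' L'L Lc gp op lp Tp pT).
Qed.

Lemma vector_fieldN (R : realType) (n : nat) (A : 'M[R]_n) (f : 'cV[R]_n -> 'cV[R]_n) x :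
  vector_field (- A) (fun z => - f z) x = - vector_field A f x.
Proof. by rewrite /vector_field mulNmx opprD. Qed.

Theorem theorem1 (R : realType) (n : nat) (A : 'M[R]_n.+1)
    (V : set 'cV[R]_n.+1) (f : 'cV[R]_n.+1 -> 'cV[R]_n.+1)
    (lam : 'I_n.+1 -> R[i])
    (V_open : open V) (V0 : V 0)
    (f_analytic : forall i, analytic_on V (fun x => f x i 0))
    (f_order2 : forall i, exists2 c : multi_index n.+1 -> R,
        has_taylor_series (fun x => f x i 0) 0 c &
        forall a, (mdegree a <= 1)%N -> c a = 0)
    (lam_eigen : eigenvalue_list A lam)
    (lam0 : lam ord0 = 0)
    (lam_half_plane :
        (forall i, i != ord0 -> 0 < complex.Re (lam i)) \/
        (forall i, i != ord0 -> complex.Re (lam i) < 0)) :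
  has_analytic_first_integral V (vector_field A f) <->
  ~ isolated (singular_points V (vector_field A f)) 0.
Proof.
case: lam_half_plane => [lam_pos|lam_neg].
  exact: first_integral_iff_pos V_open V0 f_order2 lam_eigen lam0 lam_pos.
have f2 i : exists2 c : multi_index n.+1 -> R,
    has_taylor_series (fun x => (- f x) i 0) 0 c & forall a, (mdegree a <= 1)%N -> c a = 0.
  have [c /has_taylorP[r r0 [cc cE]] c1] := f_order2 i.
  exists (fun a => -1 * c a); last by move=> a a1; rewrite c1// mulr0.
  apply/has_taylorP; exists r => //; split; first exact: convZ.
  by move=> x xr; rewrite (evZ _ (ltW r0) cc xr) -cE// mxE mulN1r.
have lamN : forall i, i != ord0 -> 0 < complex.Re (- lam i).
  move=> i /lam_neg; case: (lam i) => a b /=; by rewrite oppr_gt0.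
have lamN0 : - lam ord0 = 0 by rewrite lam0 oppr0.
have := first_integral_iff_pos V_open V0 f2 (eigenvalue_listN lam_eigen) lamN0 lamN.
have XN : vector_field (- A) (fun z => - f z) = (fun x => - vector_field A f x).
  by apply/funext => x; exact: vector_fieldN.
rewrite XN (_ : singular_points V (fun x => - _) = singular_points V (vector_field A f)); last first.
  by apply/seteqP; split=> x [Vx /eqP]; rewrite ?oppr_eq0 => /eqP X0; split => //; rewrite X0 oppr0.
suff -> : has_analytic_first_integral V (fun x => - vector_field A f x) <->
   has_analytic_first_integral V (vector_field A f) by [].
have innerN (u v : 'cV[R]_n.+1) : inner u (- v) = - inner u v.
  by rewrite /inner -sumrN; apply: eq_bigr => k _; rewrite mxE mulrN.
split=> -[U [H [hU aH nH XH]]]; exists U, H; split=> // x Ux.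
  by have /eqP := XH x Ux; rewrite innerN oppr_eq0 => /eqP.
by rewrite innerN XH// oppr0.
Qed.
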